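(* Let $\beta,\gamma\ge 1$ and let $A\in\mathcal{B}_n(\beta,\gamma)$ be a banded matrix whose field of values $W(A)$ is contained in a convex continuum $E\subset\mathbb{C}$. Let $\phi$ be the conformal map sending the exterior of $E$ onto the exterior of the unit disk, and let $\psi$ be its inverse. Then for any $\tau>1$ such that $f$ is analytic on the level set $G_\tau$, defined as the complement of the set $\{\psi(z) : |z|>\tau\}$, and for all $k,\ell\in\{1,\dots,n\}$, $$\left|\left(f(A)\right)_{k,\ell}\right| \le 2\,\frac{\tau}{\tau-1}\,\max_{|z|=\tau}\left|f(\psi(z))\right|\left(\frac{1}{\tau}\right)^{\xi},$$ where $\xi=\lceil(\ell-k)/\beta\rceil$ if $k<\ell$ and $\xi=\lceil(k-\ell)/\gamma\rceil$ if $k\ge\ell$.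
   Context: $\mathcal{B}_n(\beta,\gamma)$ is the set of matrices $A\in\mathbb{C}^{n\times n}$ with upper bandwidth $\beta$ and lower bandwidth $\gamma$, i.e. $(A)_{k,\ell}=0$ whenever $\ell-k>\beta$ or $k-\ell>\gamma$. The field of values is $W(A)=\{\mathbf{v}^*A\mathbf{v} : \mathbf{v}\in\mathbb{C}^n,\ \|\mathbf{v}\|=1\}$ (Euclidean norm). A continuum is a non-empty, compact, connected subset of $\mathbb{C}$. The map $\phi$ is the Riemann map of the exterior of $E$ onto $\{|z|>1\}$ normalized by $\phi(\infty)=\infty$ and $\lim_{z\to\infty}\phi(z)/z=d>0$. A function is analytic on a closed set if it is analytic on an open neighbourhood of it. The matrix function is defined by $f(A)=\frac{1}{2\pi i}\int_\Gamma f(z)(zI-A)^{-1}\,dz$, with $\Gamma$ a system of Jordan curves, in the domain of analyticity of $f$, encircling each eigenvalue of $A$ exactly once with positive orientation. *)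

(* Defs.v *)
From HB Require Import structures.
From mathcomp Require Import all_boot all_order all_algebra.
From mathcomp Require Import all_classical all_reals all_analysis.
From mathcomp Require Import complex.

Set Implicit Arguments.
Unset Strict Implicit.
Unset Printing Implicit Defensive.

Import Order.TTheory GRing.Theory Num.Theory.
Import numFieldNormedType.Exports.
Import Normc.

Local Open Scope classical_set_scope.
Local Open Scope ring_scope.
Local Open Scope complex_scope.
Local Open Scope sesquilinear_scope.

(* The alias [^o] gives R[i] its topology and its structure of normed module
   over itself, so that [derivable] below is complex differentiability. *)
Notation cplx R := (R[i]^o).

Section Complex_analysis.
Variable R : realType.
Local Notation C := (cplx R).

Definition holomorphic_on (U : set C) (f : C -> C) : Prop :=
  forall z, U z -> derivable f z 1.

Definition analytic_nbhd (K Omega : set C) (f : C -> C) : Prop :=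
  [/\ open Omega, K `<=` Omega & holomorphic_on Omega f].

Definition biholomorphic (U V : set C) (phi psi : C -> C) : Prop :=
  [/\ holomorphic_on U phi /\ holomorphic_on V psi,
      phi @` U `<=` V /\ psi @` V `<=` U,
      forall z, U z -> psi (phi z) = z &
      forall w, V w -> phi (psi w) = w].

(* The punctured neighbourhoods of infinity in the Riemann sphere. *)
Definition cinfty_nbhs : set_system C :=
  [set P | exists M : R, forall z : C, M < normc z -> P z].

(* [convex_set] takes its coefficients in R[i]; as 0 <= t <= 1 in R[i] forces
   t to be real, this is the usual convexity. *)
Definition convex_continuum (E : set C) : Prop :=
  [/\ E !=set0, compact E, connected E & convex_set (E : set (convex_lmodType C))].

Definition unit_disk_exterior : set C := [set w | 1 < normc w].

(* phi is the Riemann map of the complement of E onto the exterior of the unit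
   disk, fixing infinity with a positive derivative there; psi is its inverse. *)
Definition exterior_riemann_map (E : set C) (phi psi : C -> C) : Prop :=
  [/\ biholomorphic (~` E) unit_disk_exterior phi psi,
      phi z @[z --> cinfty_nbhs] --> cinfty_nbhs &
      exists2 d : R, 0 < d & phi z / z @[z --> cinfty_nbhs] --> (d%:C : C)].

Definition level_set (psi : C -> C) (tau : R) : set C :=
  ~` (psi @` [set w | tau < normc w]).

(* Contours are parametrized by `[0, 1]. The pieces of a piecewise C^1 path are
   required to extend to C^1 functions on the whole line, which is the same as
   being C^1 up to the end points. *)
Definition C1_path (g : R -> C) : Prop :=
  forall p : C -> R, p = @complex.Re R \/ p = @complex.Im R ->
    (forall t : R, derivable (p \o g) t 1) /\ continuous (derive1 (p \o g)).

Definition piecewise_C1 (gam : R -> C) : Prop :=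
  exists2 s : seq R, itv_partition 0 1 s &
    forall i, (i < size s)%N ->
      exists2 g : R -> C, C1_path g &
        {in `[nth 0 (0 :: s) i, nth 0 s i], gam =1 g}.

Definition jordan_curve (gam : R -> C) : Prop :=
  [/\ piecewise_C1 gam, gam 0 = gam 1 & {in `[0, 1[ &, injective gam}].

Definition path_derive (gam : R -> C) (t : R) : C :=
  derive1 (@complex.Re R \o gam) t +i* derive1 (@complex.Im R \o gam) t.

Definition contour_integral (gam : R -> C) (F : C -> C) : C :=
  (\int[lebesgue_measure]_(t in `[0, 1])
      complex.Re (F (gam t) * path_derive gam t)) +i*
  (\int[lebesgue_measure]_(t in `[0, 1])
      complex.Im (F (gam t) * path_derive gam t)).

Definition system_integral (Gam : seq (R -> C)) (F : C -> C) : C :=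
  \sum_(gam <- Gam) contour_integral gam F.

Definition winding_number (Gam : seq (R -> C)) (z : C) : C :=
  (2 * pi%:C * 'i)^-1 * system_integral Gam (fun w => (w - z)^-1).

Definition system_image (Gam : seq (R -> C)) : set C :=
  \bigcup_(gam in [set` Gam]) (gam @` `[0, 1]).

End Complex_analysis.

Section Matrices.
Variables (R : realType) (n : nat).
Local Notation C := (cplx R).
Implicit Types A : 'M[R[i]]_n.

(* Subtraction is truncated, which is harmless as beta and gamma are >= 0. *)
Definition banded (beta gamma : nat) A : Prop :=
  forall k l : 'I_n, (beta < l - k)%N || (gamma < k - l)%N -> A k l = 0.

Definition euclidean_norm (v : 'cV[R[i]]_n) : R :=
  Num.sqrt (\sum_(i < n) normc (v i 0) ^+ 2).

Definition field_of_values A : set C :=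
  [set z | exists2 v : 'cV[R[i]]_n,
     euclidean_norm v = 1 & z = (v^t* *m A *m v) 0 0].

(* Gam lies in Omega and winds exactly once, positively, around each eigenvalue
   of A. It must also not wind around points outside Omega: Omega may have holes
   or several components, and around these the integral defining f(A) would
   depend on Gam. *)
Definition encircles_spectrum (Omega : set C) A (Gam : seq (R -> C)) : Prop :=
  [/\ forall gam, gam \in Gam -> jordan_curve gam,
      system_image Gam `<=` Omega,
      forall z, ~ Omega z -> winding_number Gam z = 0 &
      forall a, eigenvalue A a ->
        ~ system_image Gam a /\ winding_number Gam a = 1].

Definition matrix_function (Gam : seq (R -> C)) (f : C -> C) A : 'M[R[i]]_n :=
  \matrix_(k, l) ((2 * pi%:C * 'i)^-1 *
    system_integral Gam (fun z => f z * invmx (z%:M - A) k l)).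

End Matrices.

Definition decay_exponent (R : realType) (beta gamma k l : nat) : int :=
  if (k < l)%N then Num.ceil ((l%:R - k%:R) / beta%:R : R)
  else Num.ceil ((k%:R - l%:R) / gamma%:R : R).

(* Main.v *)
Require Import Defs.

From mathcomp Require Import all_boot all_order all_algebra.
From mathcomp Require Import all_classical all_reals all_analysis.
From mathcomp Require Import measurable_realfun complex ring lra zify.

(** Why the bound holds.

   After the substitution z = psi(w), the entry of f(A) with indices k and l is
   the mean over the circle |w| = tau of f(psi(w)) Q(w)_kl, where

      Q(w) = w psi'(w) (psi(w) - A)^-1

   is holomorphic for |w| > 1, because the spectrum lies in W(A), hence in E,
   and tends to the identity at infinity (lemma matrix_function_mean). It then
   suffices to show |Q(w)_kl| <= 2 tau / (tau - 1) tau^-xi for |w| = tau (lemma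
   Q_bound). This follows from three facts.

   - The band. The powers A^j with j < xi vanish at the entry (k, l), so that the
     expansion of the resolvent at infinity gives Q(w)_kl = O(w^-xi) when k and
     l differ (lemma Q_decay).

   - Convexity. For z in E and t > 1, the homothety of centre z and ratio t maps
     the complement of E into itself, and Schwarz's lemma says that |phi|
     increases along it. At t = 1 this means that conj(w psi'(w)) (psi(w) - z)
     has nonnegative real part (lemma starlike_Re). As W(A) is contained in E,
     the Hermitian part of Q(w) is nonnegative (lemma resolvent_positive), whence
     |Q(w)_kl + conj Q(w)_lk| <= Re (Q(w)_kk + Q(w)_ll) (lemma Q_offdiag).

   - Orthogonality. On a circle of radius rho between 1 and tau, Q(v)_kl involves
     only the powers v^-j with j >= xi, and conj Q(v)_lk only nonnegative powers
     of v. The truncated Cauchy kernel sum over j >= xi of (v / w)^j, of modulus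
     at most (rho / tau)^xi tau / (tau - rho), therefore recovers Q(w)_kl from
     the sum Q(v)_kl + conj Q(v)_lk. This sum is dominated by a real part with
     mean 2, its value at infinity, and rho tends to 1 (lemma decay_bound).

   The diagonal, where xi = 0, is reduced to xi = 1 by subtracting from Q(w)_kk
   its limit 1.

   The substitution z = psi(w) rests on Cauchy's theorem in its homology form
   (theorem homology_cauchy, by Dixon's argument): the contours of the definition
   of f(A) and the level curve of index tau wind equally often about every point
   where the integrand is not holomorphic (lemmas winding_inside,
   winding_outside and contour_deformation). Cauchy's theorem is proved for
   bounded functionals instead of contours, which covers piecewise C^1 systems
   and circles at once. Its local part starts from Goursat's theorem on
   rectangles, which exponential coordinates turn into the invariance of the mean
   of a holomorphic function over concentric circles. *)

Set Implicit Arguments.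
Unset Strict Implicit.
Unset Printing Implicit Defensive.
Import Order.TTheory GRing.Theory Num.Theory.
Import numFieldNormedType.Exports.
Import Normc.
Local Open Scope classical_set_scope.
Local Open Scope ring_scope.
Local Open Scope complex_scope.

(** * Modulus, real and imaginary parts *)

Section ComplexNorm.
Variable R : realType.
Local Notation C := (cplx R).
Implicit Types (z w : C) (x y : R).

Lemma normrE z : `|z| = (normc z)%:C%C.
Proof. by []. Qed.

Lemma normc_ge0 z : 0 <= normc z.
Proof. by case: z => a b /=; exact: sqrtr_ge0. Qed.

Lemma normcD z w : normc (z + w) <= normc z + normc w.
Proof. exact: le_normcD. Qed.

Lemma normcMC z w : normc (z * w) = normc z * normc w.
Proof. exact: normcM. Qed.

Lemma normcNC z : normc (- z) = normc z.
Proof. exact: normcN. Qed.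

Lemma normcBC z w : normc (z - w) = normc (w - z).
Proof. by rewrite -normcNC opprB. Qed.

Lemma normcX z n : normc (z ^+ n) = normc z ^+ n.
Proof.
elim: n => [|n IH]; first by rewrite !expr0; exact: normc1.
by rewrite !exprS normcMC IH.
Qed.

Lemma normc_real x : normc (x%:C%C : C) = `|x|.
Proof. by rewrite /= expr0n addr0 sqrtr_sqr. Qed.

Lemma normc_eq0 z : (normc z == 0) = (z == 0).
Proof.
apply/eqP/eqP => [/eq0_normc //|->]; exact: normc0.
Qed.

Lemma normc_gt0 z : (0 < normc z) = (z != 0).
Proof. by rewrite lt_neqAle normc_ge0 andbT eq_sym normc_eq0. Qed.

Lemma normc_ge_absRe z : `|complex.Re z| <= normc z.
Proof. by case: z => a b /=; rewrite -sqrtr_sqr ler_wsqrtr// lerDl sqr_ge0. Qed.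

Lemma normc_ge_absIm z : `|complex.Im z| <= normc z.
Proof. by case: z => a b /=; rewrite -sqrtr_sqr ler_wsqrtr// lerDr sqr_ge0. Qed.

Lemma normc_le_ReIm z : normc z <= `|complex.Re z| + `|complex.Im z|.
Proof.
case: z => a b /=; rewrite -[leRHS]ger0_norm ?addr_ge0// -sqrtr_sqr ler_wsqrtr//.
rewrite sqrrD !real_normK ?num_real// -addrA lerD2l lerDr.
by rewrite mulrn_wge0// mulr_ge0.
Qed.

Lemma normc_sqr z : normc z ^+ 2 = complex.Re z ^+ 2 + complex.Im z ^+ 2.
Proof. by case: z => a b /=; rewrite sqr_sqrtr// addr_ge0// sqr_ge0. Qed.

Lemma normc_dist z w : `|normc w - normc z| <= normc (z - w).
Proof.
have := normcD (z - w) w; have := normcD (w - z) z; rewrite !subrK (normcBC w z).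
by move=> ? ?; rewrite ler_norml; apply/andP; split; lra.
Qed.

Lemma normc_conj z : normc (z^*)%C = normc z.
Proof. by case: z => a b /=; rewrite sqrrN. Qed.

Lemma conjc_mul z : ((z^*)%C * z)%R = ((normc z ^+ 2)%:C)%C.
Proof.
case: z => a b; rewrite normc_sqr /=; apply/eqP; rewrite eq_complex /=.
by apply/andP; split; apply/eqP; ring.
Qed.

Lemma Re_mul z w :
  complex.Re (z * w) = complex.Re z * complex.Re w - complex.Im z * complex.Im w.
Proof. by case: z => a b; case: w. Qed.

Lemma Im_mul z w :
  complex.Im (z * w) = complex.Re z * complex.Im w + complex.Im z * complex.Re w.
Proof. by case: z => a b; case: w. Qed.

Lemma Re_add z w : complex.Re (z + w) = complex.Re z + complex.Re w.
Proof. by case: z => a b; case: w. Qed.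
Lemma Im_add z w : complex.Im (z + w) = complex.Im z + complex.Im w.
Proof. by case: z => a b; case: w. Qed.
Lemma Re_opp z : complex.Re (- z) = - complex.Re z.
Proof. by case: z. Qed.
Lemma Im_opp z : complex.Im (- z) = - complex.Im z.
Proof. by case: z. Qed.

Lemma complex_ext z w : complex.Re z = complex.Re w -> complex.Im z = complex.Im w -> z = w.
Proof. by case: z => a b; case: w => c d /= -> ->. Qed.

End ComplexNorm.

(** * Limits of complex functions *)

Section ComplexTopology.
Variable R : realType.
Local Notation C := (cplx R).

(** A separate predicate, made opaque once its rules are available, so that
   limits are compared by their functions and values and never by unfolding the
   neighbourhoods of complex numbers. *)
Definition clim (T : Type) (F : set_system T) (f : T -> C) (l : C) : Prop :=
  f x @[x --> F] --> l.

Lemma cvg_normcP (T : Type) (F : set_system T) {FF : Filter F} (f : T -> C) (l : C) :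
  clim F f l <->
  (forall e : R, 0 < e -> \forall x \near F, normc (f x - l) < e).
Proof.
split=> [/cvgrPdist_lt H e e0|H].
  have e0' : 0 < (e%:C%C : C) by rewrite ltcR.
  by near=> x; rewrite normcBC -ltcR -normrE; near: x; exact: H.
apply/cvgrPdist_lt => e; case: e => a b; rewrite ltcE /= => /andP[/eqP -> a0].
near=> x; rewrite normrE -[_ +i* _]/(a%:C) ltcR normcBC; near: x; exact: H.
Unshelve. all: by end_near. Qed.

Lemma nbhs_normcP (z : C) (P : set C) :
  nbhs z P <-> exists2 e : R, 0 < e & forall w, normc (w - z) < e -> P w.
Proof.
split.
  move=> /nbhs_ballP[e /= e0 H].
  have : exists2 a : R, 0 < a & e = a%:C%C.
    by case: e e0 {H} => a b; rewrite ltcE /= => /andP[/eqP -> a0]; exists a.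
  move=> [a a0 ea]; exists a => // w wz; apply: H.
  by rewrite ea -ball_normE /ball_ /= normrE ltcR normcBC.
move=> [e e0 H]; apply/nbhs_ballP; exists (e%:C)%C; first by rewrite /= ltcR.
by move=> w; rewrite -ball_normE /ball_ /= normrE ltcR normcBC => /H.
Qed.

Lemma near_normc (z : C) (e : R) : 0 < e -> \forall w \near z, normc (w - z) < e.
Proof. by move=> e0; apply/nbhs_normcP; exists e. Qed.

Lemma open_normcP (U : set C) : open U <->
  forall z, U z -> exists2 e : R, 0 < e & forall w, normc (w - z) < e -> U w.
Proof.
rewrite openE; split => [H z /H|H z /H]; first by move/nbhs_normcP.
by move=> ?; apply/nbhs_normcP.
Qed.

Section Lims.
Context (T : Type) (F : set_system T) {FF : Filter F}.
Implicit Types (f g : T -> C).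

Lemma climC (c : C) : clim F (fun=> c) c.
Proof. exact: (@cvg_cst C c T F FF). Qed.

Lemma cvgRe f (l : C) : clim F f l ->
  complex.Re (f x) @[x --> F] --> complex.Re l.
Proof.
move=> /cvg_normcP H; apply/cvgrPdist_lt => e /H {}H.
near=> x; rewrite distrC; apply: le_lt_trans (_ : normc (f x - l) < e); last by near: x.
by rewrite -Re_opp -Re_add normc_ge_absRe.
Unshelve. all: by end_near. Qed.

Lemma cvgIm f (l : C) : clim F f l ->
  complex.Im (f x) @[x --> F] --> complex.Im l.
Proof.
move=> /cvg_normcP H; apply/cvgrPdist_lt => e /H {}H.
near=> x; rewrite distrC; apply: le_lt_trans (_ : normc (f x - l) < e); last by near: x.
by rewrite -Im_opp -Im_add normc_ge_absIm.
Unshelve. all: by end_near. Qed.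

Lemma cvgComplex (u v : T -> R) (a b : R) : u x @[x --> F] --> a -> v x @[x --> F] --> b ->
  clim F (fun x => u x +i* v x) (a +i* b).
Proof.
move=> /cvgrPdist_lt Hu /cvgrPdist_lt Hv; apply/cvg_normcP => e e0.
have e2 : 0 < e / 2 by rewrite divr_gt0.
near=> x; apply: le_lt_trans (normc_le_ReIm _) _ => /=.
rewrite [ltRHS]splitr ltrD// distrC; near: x; [exact: Hu|exact: Hv].
Unshelve. all: by end_near. Qed.

Lemma cvgRealC (u : T -> R) (a : R) : u x @[x --> F] --> a ->
  clim F (fun x => (u x)%:C) a%:C.
Proof. by move=> H; apply: cvgComplex => //; exact: cvg_cst. Qed.

Lemma cvgNormc f (l : C) : clim F f l -> normc (f x) @[x --> F] --> normc l.
Proof.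
move=> /cvg_normcP H; apply/cvgrPdist_lt => e /H {}H.
near=> x; apply: le_lt_trans (_ : normc (f x - l) < e); last by near: x.
exact: normc_dist.
Unshelve. all: by end_near. Qed.

Lemma cvgConj f (l : C) : clim F f l -> clim F (fun x => (f x)^*%C) l^*%C.
Proof.
move=> /cvg_normcP H; apply/cvg_normcP => e /H {}H; near=> x.
by rewrite -[X in normc X]rmorphB normc_conj; near: x.
Unshelve. all: by end_near. Qed.

Lemma cvgMC f g (a b : C) : clim F f a -> clim F g b ->
  clim F (fun x => f x * g x) (a * b).
Proof. rewrite /clim; exact: cvgM. Qed.

Lemma cvgDC f g (a b : C) : clim F f a -> clim F g b ->
  clim F (fun x => f x + g x) (a + b).
Proof. rewrite /clim; exact: cvgD. Qed.

Lemma cvgBC f g (a b : C) : clim F f a -> clim F g b ->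
  clim F (fun x => f x - g x) (a - b).
Proof. rewrite /clim; exact: cvgB. Qed.

Lemma cvgNC f (a : C) : clim F f a ->
  clim F (fun x => - f x) (- a).
Proof. by move=> ?; exact: (@cvgN _ _ _ F FF f). Qed.

Lemma cvgVC f (a : C) : a != 0 -> clim F f a ->
  clim F (fun x => (f x)^-1) (a^-1).
Proof. rewrite /clim; exact: cvgV. Qed.

Lemma cvgXC f (a : C) n : clim F f a ->
  clim F (fun x => f x ^+ n) (a ^+ n).
Proof.
move=> H; elim: n => [|n IH]; first exact: climC.
under [X in clim _ X _]funext => x do rewrite exprS.
by rewrite exprS; exact: cvgMC.
Qed.

End Lims.
Lemma climE (T : Type) (F : set_system T) (f : T -> C) (l : C) :
  clim F f l = (f x @[x --> F] --> l).
Proof. by []. Qed.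

Lemma clim_id (z : C) : clim (nbhs z) (fun x => x) z.
Proof. by rewrite climE; exact: cvg_id. Qed.

Lemma clim_near (T : Type) (F : set_system T) {FF : Filter F} (f g : T -> C) (l : C) :
  (\forall x \near F, f x = g x) -> clim F f l -> clim F g l.
Proof.
move=> fg /cvg_normcP H; apply/cvg_normcP => e /H {}H; near=> x.
by rewrite -(near fg x)//; near: x.
Unshelve. all: by end_near. Qed.

Lemma clim_comp (T U : Type) (F : set_system T) (G : set_system U) (h : T -> U) (f : U -> C) (l : C) :
  h x @[x --> F] --> G -> clim G f l -> clim F (fun x => f (h x)) l.
Proof. by move=> hF; rewrite !climE; apply: cvg_comp. Qed.

Lemma clim_compC (T : Type) (F : set_system T) (h : T -> C) (f : C -> C) (l m : C) :
  clim F h m -> clim (nbhs m) f l -> clim F (fun x => f (h x)) l.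
Proof. by rewrite climE => hF; exact: clim_comp. Qed.

End ComplexTopology.
#[global] Opaque clim.

(** * Derivatives of functions and of paths *)

Section ComplexDerivative.
Variable R : realType.
Local Notation C := (cplx R).
Implicit Types (F G : C -> C) (g : R -> C) (z w l m c : C).

(** Caratheodory's form of the derivative, of F with respect to e: the
   difference quotient is a function continuous at the point, so that the rules
   of calculus reduce to the algebra of limits. Taking for e the identity of the
   plane or the inclusion of the line gives the derivatives of functions and of
   paths. *)
Definition slope (T : topologicalType) (e F : T -> C) (t : T) l := exists q : T -> C,
  [/\ clim (nbhs t) q l, q t = l & forall s, F s - F t = q s * (e s - e t)].

Definition hasd F z l := slope (fun x => x) F z l.

Definition pathd g (t : R) l := slope (fun s : R => s%:C) g t l.

Section Slope.
Variables (T : topologicalType) (e : T -> C) (t : T).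
Hypotheses (e_inj : injective e) (e_cvg : clim (nbhs t) e (e t)).
Implicit Types (u v : T -> C).

Lemma slopeP u l : slope e u t l <-> forall eps : R, 0 < eps ->
  \forall s \near t, normc (u s - u t - l * (e s - e t)) <= eps * normc (e s - e t).
Proof.
split=> [[q [/cvg_normcP qt _ uE]] eps /qt H|H].
  near=> s; rewrite uE -mulrBl normcMC ler_wpM2r ?normc_ge0// ltW//.
  by near: s.
exists (fun s => if e s == e t then l else (u s - u t) / (e s - e t)).
split; last 1 first.
- move=> s; have [/e_inj ->|st] := eqVneq (e s) (e t); first by rewrite !subrr mulr0.
  by rewrite divfK// subr_eq0.
- apply/(cvg_normcP (F := nbhs t)) => eps e0; have e20 : 0 < eps / 2 by rewrite divr_gt0.
  near=> s; have [st|st] := eqVneq (e s) (e t); first by rewrite subrr normc0.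
  have st' : e s - e t != 0 by rewrite subr_eq0.
  apply: le_lt_trans (_ : eps / 2 < eps); last by rewrite ltr_pdivrMr// ltr_pMr// ltrDl.
  have n0 : 0 < normc (e s - e t) by rewrite normc_gt0.
  rewrite -(ler_pM2r n0) -normcMC mulrBl divfK//.
  by near: s; exact: H.
- by rewrite eqxx.
Unshelve. all: by end_near. Qed.

Lemma slope_cvg u l : slope e u t l -> clim (nbhs t) u (u t).
Proof.
move=> [q [qt _ uE]].
have E : u = (fun s => q s * (e s - e t) + u t) by apply/funext => s; rewrite -uE subrK.
have : clim (nbhs t) (fun s => q s * (e s - e t) + u t) (l * (e t - e t) + u t).
  apply: cvgDC; last exact: climC.
  by apply: cvgMC; [exact: qt|apply: cvgBC; [exact: e_cvg|exact: climC]].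
by rewrite subrr mulr0 add0r -E.
Qed.

Lemma slope_near u v l : (\forall s \near t, u s = v s) -> slope e u t l -> slope e v t l.
Proof.
move=> uv /slopeP H; apply/slopeP => eps /H {}H.
have uvt := nbhs_singleton uv.
by near=> s; rewrite -(near uv s)// -uvt; near: s.
Unshelve. all: by end_near. Qed.

Lemma slope_cst c : slope e (fun=> c) t 0.
Proof. by exists (fun=> 0); split; [exact: climC|by []|move=> s; rewrite subrr mul0r]. Qed.

Lemma slope_base : slope e e t 1.
Proof. by exists (fun=> 1); split; [exact: climC|by []|move=> s; rewrite mul1r]. Qed.

Lemma slopeD u v l m : slope e u t l -> slope e v t m -> slope e (fun s => u s + v s) t (l + m).
Proof.
move=> [q [qt ql uE]] [r [rt rl vE]]; exists (fun s => q s + r s); split.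
- by apply: cvgDC; [exact: qt|exact: rt].
- by rewrite ql rl.
- by move=> s; rewrite mulrDl -uE -vE; ring.
Qed.

Lemma slopeM u v l m : slope e u t l -> slope e v t m ->
  slope e (fun s => u s * v s) t (l * v t + u t * m).
Proof.
move=> Hu; have ut := slope_cvg Hu; move: Hu.
move=> [q [qt ql uE]] [r [rt rl vE]]; exists (fun s => q s * v t + u s * r s); split.
- by apply: cvgDC; apply: cvgMC; [exact: qt|exact: climC|exact: ut|exact: rt].
- by rewrite ql rl.
- by move=> s; rewrite mulrDl mulrAC -uE -mulrA -vE; ring.
Qed.

Lemma slope_comp F u l m : hasd F (u t) l -> slope e u t m -> slope e (F \o u) t (l * m).
Proof.
move=> [q [qt ql FE]] Hu; have ut := slope_cvg Hu; move: Hu.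
move=> [r [rt rl uE]]; exists (fun s => q (u s) * r s); split.
- by apply: cvgMC; [exact: (clim_compC ut qt)|exact: rt].
- by rewrite ql rl.
- by move=> s /=; rewrite -mulrA -uE -FE.
Qed.

End Slope.

Lemma hasdP F z l : hasd F z l <-> forall e : R, 0 < e ->
  \forall w \near z, normc (F w - F z - l * (w - z)) <= e * normc (w - z).
Proof. by apply: slopeP => x y. Qed.

Lemma hasd_cvg F z l : hasd F z l -> clim (nbhs z) F (F z).
Proof. by move=> H; exact: (slope_cvg (@clim_id R z) H). Qed.

Lemma hasd_near F G z l : (\forall w \near z, F w = G w) -> hasd F z l -> hasd G z l.
Proof. by apply: slope_near => x y. Qed.

Lemma hasd_cst c z : hasd (fun=> c) z 0.
Proof. exact: slope_cst. Qed.

Lemma hasd_id z : hasd id z 1.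
Proof. exact: slope_base. Qed.

Lemma hasdD F G z l m : hasd F z l -> hasd G z m -> hasd (fun x => F x + G x) z (l + m).
Proof. exact: slopeD. Qed.

Lemma hasdM F G z l m : hasd F z l -> hasd G z m ->
  hasd (fun x => F x * G x) z (l * G z + F z * m).
Proof. by move=> HF HG; exact: (slopeM (@clim_id R z) HF HG). Qed.

Lemma hasd_comp F G z l m : hasd F z l -> hasd G (F z) m -> hasd (G \o F) z (m * l).
Proof. by move=> HF HG; exact: (slope_comp (@clim_id R z) HG HF). Qed.

(** The quotient identity must hold at all x, including those where F vanishes
   and the convention 0^-1 = 0 breaks it; there, away from z, the function is
   replaced by the expression that makes the identity trivial. *)
Lemma hasdV F z l : F z != 0 -> hasd F z l ->
  hasd (fun x => (F x)^-1) z (- l / F z ^+ 2).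
Proof.
move=> Fz0 HF; have Fz := hasd_cvg HF.
have nF : \forall x \near z, F x != 0.
  have n0 : 0 < normc (F z) by rewrite normc_gt0.
  have /cvg_normcP/(_ _ n0) := Fz; apply: filterS => x.
  by apply: contraTneq => ->; rewrite sub0r normcNC ltxx.
have [q [qz ql Fq]] := HF.
suff : hasd (fun x => if F x == 0 then (F z)^-1 - q x / F z ^+ 2 * (x - z) else (F x)^-1) z (- l / F z ^+ 2).
  apply: hasd_near; near=> x; rewrite ifN//; near: x; exact: nF.
exists (fun x => if F x == 0 then - q x / F z ^+ 2 else - q x / (F x * F z)); split.
- have : clim (nbhs z) (fun x => - q x / (F x * F z)) (- l / F z ^+ 2).
    apply: cvgMC; first exact: cvgNC.
    rewrite expr2; apply: cvgVC; first by rewrite mulf_neq0.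
    by apply: cvgMC; [exact: Fz|exact: climC].
  apply: cvg_trans; apply: near_eq_cvg; near=> x.
  by rewrite ifN//; near: x; exact: nF.
- by rewrite ifN// ql expr2.
- move=> x; rewrite [in X in _ - X]ifN//; case: eqP => [_|/eqP Fx]; first by ring.
  by rewrite mulrAC mulNr -Fq; field; rewrite Fz0 Fx.
Unshelve. all: by end_near. Qed.

Lemma real_inj : injective (fun s : R => s%:C : C).
Proof. by move=> s t []. Qed.

Lemma real_cvg (t : R) : clim (nbhs t) (fun s : R => s%:C : C) t%:C.
Proof. by apply: cvgRealC; exact: cvg_id. Qed.

Lemma pathdP g t l : pathd g t l <-> forall e : R, 0 < e ->
  \forall s \near t, normc (g s - g t - l * (s - t)%:C) <= e * `|s - t|.
Proof.
rewrite /pathd slopeP; last exact: real_inj.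
by split=> H e /H; apply: filterS => s; rewrite -rmorphB normc_real.
Qed.

Lemma pathd_cvg g t l : pathd g t l -> clim (nbhs t) g (g t).
Proof. by move=> H; exact: (slope_cvg (@real_cvg t) H). Qed.

Lemma pathd_near g (h : R -> C) t l : (\forall s \near t, g s = h s) -> pathd g t l -> pathd h t l.
Proof. by apply: slope_near; exact: real_inj. Qed.

Lemma pathd_cst c t : pathd (fun=> c) t 0.
Proof. exact: slope_cst. Qed.

Lemma pathd_real t : pathd (fun s => s%:C) t 1.
Proof. exact: slope_base. Qed.

Lemma pathdD g (h : R -> C) t l m : pathd g t l -> pathd h t m -> pathd (fun s => g s + h s) t (l + m).
Proof. exact: slopeD. Qed.

Lemma pathdZ c g t l : pathd g t l -> pathd (fun s => c * g s) t (c * l).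
Proof. by move=> H; have := slopeM (@real_cvg t) (pathd_cst c t) H; rewrite mul0r add0r. Qed.

Lemma pathd_comp F g t l m : hasd F (g t) l -> pathd g t m -> pathd (F \o g) t (l * m).
Proof. by move=> HF Hg; exact: (slope_comp (@real_cvg t) HF Hg). Qed.

Lemma hasd_unique F z l m : hasd F z l -> hasd F z m -> l = m.
Proof.
move=> /hasdP Hl /hasdP Hm; apply/eqP; rewrite -subr_eq0 -normc_eq0.
rewrite eq_le normc_ge0 andbT; apply/ler_addgt0Pl => e e0.
rewrite addr0; have e20 : 0 < e / 2 by rewrite divr_gt0.
have /nbhs_normcP[d d0 H] : \forall w \near z,
    normc (F w - F z - l * (w - z)) <= e / 2 * normc (w - z) /\
    normc (F w - F z - m * (w - z)) <= e / 2 * normc (w - z).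
  by near=> w; split; near: w; [exact: Hl|exact: Hm].
have Ez : z + (d / 2)%:C - z = (d / 2)%:C by rewrite addrAC subrr add0r.
have [] := H (z + (d / 2)%:C).
  by rewrite Ez normc_real gtr0_norm ?divr_gt0// ltr_pdivrMr// ltr_pMr// ltrDl.
rewrite Ez normc_real gtr0_norm ?divr_gt0// => A B.
have d2 : 0 < d / 2 by rewrite divr_gt0.
rewrite -(ler_pM2r d2) -[X in _ * X <= _](gtr0_norm d2) -normc_real -normcMC.
have -> : (l - m) * (d / 2)%:C = (F (z + (d/2)%:C) - F z - m * (d / 2)%:C) - (F (z + (d/2)%:C) - F z - l * (d / 2)%:C) by ring.
apply: le_trans (normcD _ _) _; rewrite normcNC.
rewrite [X in _ <= X * _]splitr mulrDl lerD//.
Unshelve. all: by end_near. Qed.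

Lemma hasdN F z l : hasd F z l -> hasd (fun x => - F x) z (- l).
Proof.
move=> H; have := hasdM (hasd_cst (-1) z) H; rewrite mul0r add0r mulN1r.
by congr hasd; apply/funext => x; rewrite mulN1r.
Qed.

Lemma hasdB F G z l m : hasd F z l -> hasd G z m -> hasd (fun x => F x - G x) z (l - m).
Proof. by move=> HF HG; apply: hasdD => //; exact: hasdN. Qed.

Lemma hasdZ c F z l : hasd F z l -> hasd (fun x => c * F x) z (c * l).
Proof. by move=> H; have := hasdM (hasd_cst c z) H; rewrite mul0r add0r. Qed.

Lemma hasdX F z l n : hasd F z l -> hasd (fun x => F x ^+ n.+1) z (n.+1%:R * F z ^+ n * l).
Proof.
move=> HF; elim: n => [|n IH].
  by rewrite expr0 !mul1r; congr hasd: HF; apply/funext => x; rewrite expr1.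
have := hasdM HF IH.
have -> : (fun x => F x * F x ^+ n.+1) = (fun x => F x ^+ n.+2).
  by apply/funext => x; rewrite [RHS]exprS.
by congr hasd; rewrite [n.+2%:R]mulrSr !exprS; ring.
Qed.

Lemma derivable_hasd F z : derivable F z 1 <-> exists l, hasd F z l.
Proof.
have E h l : h != 0 -> h^-1 *: ((F \o shift z) (h *: (1 : C)) - F z) - l =
    h^-1 * (F (z + h) - F z - l * h).
  move=> h0; rewrite /shift /= [h *: _]mulr1 [h + z]addrC.
  by rewrite [LHS]/(_ * _ - _) !mulrBr mulrCA mulVf// mulr1.
split.
  move=> /cvg_ex[l]; rewrite -climE => /cvg_normcP H.
  exists l; apply/hasdP => e /H.
  rewrite /dnbhs near_withinE => /nbhs_normcP[d d0 {}H].
  apply/nbhs_normcP; exists d => // w wz.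
  have [->|wz0] := eqVneq w z; first by rewrite !subrr mulr0 subr0 normc0 mulr0.
  have h0 : w - z != 0 by rewrite subr_eq0.
  have := H (w - z); rewrite /= subr0 E// => /(_ wz h0).
  by rewrite normcMC normcV mulrC ltr_pdivrMr ?normc_gt0// [z + _]addrC subrK => /ltW.
move=> [l /hasdP H]; apply/cvg_ex; exists l; rewrite -climE.
apply/cvg_normcP => e e0; have e20 : 0 < e / 2 by rewrite divr_gt0.
have /nbhs_normcP[d d0 {}H] := H _ e20.
rewrite /dnbhs near_withinE; apply/nbhs_normcP; exists d => // h.
rewrite subr0 => hd h0 /=; rewrite E// [z + h]addrC normcMC normcV mulrC ltr_pdivrMr ?normc_gt0//.
have := H (z + h); rewrite [z + h]addrC addrK => /(_ hd) /le_lt_trans; apply.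
by rewrite ltr_pM2r ?normc_gt0// ltr_pdivrMr// ltr_pMr// ltrDl.
Qed.

Definition dC F z : C := xget 0 [set l | hasd F z l].

Lemma dCP F z l : hasd F z l -> dC F z = l.
Proof.
move=> H; apply: (hasd_unique _ H).
by apply: (@xgetPex _ 0 [set m | hasd F z m]); exists l.
Qed.

Definition hol (U : set C) F := forall z, U z -> hasd F z (dC F z).

Lemma holP U F : hol U F <-> forall z, U z -> exists l, hasd F z l.
Proof.
split=> H z Uz; first by exists (dC F z); exact: H.
by have [l Hl] := H z Uz; rewrite (dCP Hl).
Qed.

Lemma holomorphic_hol U F : holomorphic_on U F <-> hol U F.
Proof.
rewrite holP; split => H z Uz; first by apply/derivable_hasd; exact: H.
by apply/derivable_hasd; exact: H.
Qed.

End ComplexDerivative.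

(** * Paths through their real and imaginary parts *)

Section PathDerivative.
Variable R : realType.
Local Notation C := (cplx R).
Implicit Types (u : R -> R) (g : R -> C) (t : R) (l : C).

Lemma real_nbhsP (t : R) (P : set R) :
  nbhs t P <-> exists2 e : R, 0 < e & forall s, `|s - t| < e -> P s.
Proof.
split=> [/nbhs_ballP[e /= e0 H]|[e e0 H]].
  by exists e => // s st; apply: H; rewrite /ball /= distrC.
by apply/nbhs_ballP; exists e => //= s; rewrite /ball /= distrC => /H.
Qed.

Lemma real_deriveP u t (a : R) : is_derive t (1:R) u a <->
  forall e : R, 0 < e ->
  \forall s \near t, `|u s - u t - a * (s - t)| <= e * `|s - t|.
Proof.
have E h : h != 0 -> h^-1 *: ((u \o shift t) (h *: (1 : R)) - u t) - a =
    h^-1 * (u (t + h) - u t - a * h).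
  move=> h0; rewrite /shift /= [h *: _]mulr1 [h + t]addrC.
  by rewrite [LHS]/(_ * _ - _) !mulrBr mulrCA mulVf// mulr1.
split.
  move=> [H1 H2] e e0.
  have : h^-1 *: ((u \o shift t) (h *: (1 : R)) - u t) @[h --> 0^'] --> a.
    by rewrite -H2; exact: H1.
  move=> /cvgrPdist_lt/(_ _ e0).
  rewrite /dnbhs near_withinE => /real_nbhsP[d d0 {}H].
  apply/real_nbhsP; exists d => // w wz.
  have [->|wz0] := eqVneq w t; first by rewrite !subrr mulr0 subr0 normr0 mulr0.
  have h0 : w - t != 0 by rewrite subr_eq0.
  have := H (w - t); rewrite /= subr0 [`|a - _|]distrC E// => /(_ wz h0).
  by rewrite normrM normfV mulrC ltr_pdivrMr ?normr_gt0// [t + _]addrC subrK => /ltW.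
move=> H; suff H1 : h^-1 *: ((u \o shift t) (h *: (1 : R)) - u t) @[h --> 0^'] --> a.
  by split; [apply/cvg_ex; exists a|exact: cvg_lim H1].
apply/cvgrPdist_lt => e e0; have e20 : 0 < e / 2 by rewrite divr_gt0.
have /real_nbhsP[d d0 {}H] := H _ e20.
rewrite /dnbhs near_withinE; apply/real_nbhsP; exists d => // h.
rewrite subr0 => hd h0 /=; rewrite distrC E// [t + h]addrC normrM normfV mulrC ltr_pdivrMr ?normr_gt0//.
have := H (t + h); rewrite [t + h]addrC addrK => /(_ hd) /le_lt_trans; apply.
by rewrite ltr_pM2r ?normr_gt0// ltr_pdivrMr// ltr_pMr// ltrDl.
Qed.

Lemma pathd_ReIm g t l : pathd g t l <->
  is_derive t (1:R) (@complex.Re R \o g) (complex.Re l) /\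
  is_derive t (1:R) (@complex.Im R \o g) (complex.Im l).
Proof.
rewrite pathdP !real_deriveP; split.
  move=> H; split=> e /H {}H; near=> s.
    apply: le_trans (_ : normc (g s - g t - l * (s - t)%:C) <= _); last by near: s.
    apply: le_trans (normc_ge_absRe _).
    by rewrite !(Re_add, Re_opp) Re_mul /= mulr0 subr0.
  apply: le_trans (_ : normc (g s - g t - l * (s - t)%:C) <= _); last by near: s.
  apply: le_trans (normc_ge_absIm _).
  by rewrite !(Im_add, Im_opp) Im_mul /= mulr0 add0r.
move=> [H1 H2] e e0; have e20 : 0 < e / 2 by rewrite divr_gt0.
have {}H1 := H1 _ e20; have {}H2 := H2 _ e20; near=> s.
apply: le_trans (normc_le_ReIm _) _.
rewrite !(Re_add, Re_opp, Im_add, Im_opp) Re_mul Im_mul /= !mulr0 subr0 add0r.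
have -> : e * `|s - t| = e / 2 * `|s - t| + e / 2 * `|s - t| by rewrite -mulrDl -splitr.
by rewrite lerD//; near: s.
Unshelve. all: by end_near. Qed.

Lemma path_deriveE g t l : pathd g t l -> path_derive g t = l.
Proof.
move=> /pathd_ReIm[[_ A] [_ B]]; rewrite /path_derive !derive1E.
by apply: complex_ext.
Qed.

End PathDerivative.

(** * Integrals of complex functions on a segment *)

Section ComplexIntegral.
Variable R : realType.
Local Notation C := (cplx R).
Local Notation mu := (@lebesgue_measure R).
Implicit Types (a b : R) (u v : R -> C).

Definition Ic a b u : C :=
  (\int[mu]_(t in `[a, b]) complex.Re (u t)) +i*
  (\int[mu]_(t in `[a, b]) complex.Im (u t)).

Definition ccont a b u := forall t, a <= t <= b -> clim (nbhs t) u (u t).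

Lemma real_ccont_integrable a b (r : R -> R) :
  (forall t, a <= t <= b -> r s @[s --> t] --> r t) ->
  mu.-integrable `[a, b] (EFin \o r).
Proof.
move=> H; apply: continuous_compact_integrable; first exact: segment_compact.
apply: continuous_in_subspaceT => t; rewrite inE /= in_itv /=; exact: H.
Qed.

Lemma ccont_Re a b u : ccont a b u -> mu.-integrable `[a, b] (EFin \o (fun t => complex.Re (u t))).
Proof. by move=> H; apply: real_ccont_integrable => t /H /cvgRe. Qed.

Lemma ccont_Im a b u : ccont a b u -> mu.-integrable `[a, b] (EFin \o (fun t => complex.Im (u t))).
Proof. by move=> H; apply: real_ccont_integrable => t /H /cvgIm. Qed.

Lemma ccontD a b u v : ccont a b u -> ccont a b v -> ccont a b (fun t => u t + v t).
Proof. by move=> Hu Hv t tab; apply: cvgDC; [exact: Hu|exact: Hv]. Qed.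

Lemma ccontM a b u v : ccont a b u -> ccont a b v -> ccont a b (fun t => u t * v t).
Proof. by move=> Hu Hv t tab; apply: cvgMC; [exact: Hu|exact: Hv]. Qed.

Lemma ccontC a b (c : C) : ccont a b (fun=> c).
Proof. by move=> t _; exact: climC. Qed.

Lemma eq_Ic a b u v : (forall t, a <= t <= b -> u t = v t) -> Ic a b u = Ic a b v.
Proof.
by move=> H; congr (_ +i* _); apply: eq_Rintegral => t;
  rewrite inE /= in_itv /= => /H ->.
Qed.

Lemma IcD a b u v : ccont a b u -> ccont a b v ->
  Ic a b (fun t => u t + v t) = Ic a b u + Ic a b v.
Proof.
move=> Hu Hv; apply: complex_ext => /=.
  rewrite -RintegralD//; [|exact: ccont_Re|exact: ccont_Re].
  by apply: eq_Rintegral => t _; rewrite Re_add.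
rewrite -RintegralD//; [|exact: ccont_Im|exact: ccont_Im].
by apply: eq_Rintegral => t _; rewrite Im_add.
Qed.

Lemma real_ccontZ a b (r : R -> R) (c : R) : mu.-integrable `[a, b] (EFin \o r) ->
  mu.-integrable `[a, b] (EFin \o (fun t => c * r t)).
Proof. by move=> H; apply: (eq_integrable _ _ _ _ (integrableZl _ c H)) => //. Qed.

Lemma IcZ a b (c : C) u : ccont a b u -> Ic a b (fun t => c * u t) = c * Ic a b u.
Proof.
move=> Hu; have iR := ccont_Re Hu; have iI := ccont_Im Hu.
apply: complex_ext; rewrite ?Re_mul ?Im_mul /=.
  rewrite -!RintegralZl// -RintegralB//; [|exact: real_ccontZ..].
  by apply: eq_Rintegral => t _; rewrite Re_mul.
rewrite -!RintegralZl// -RintegralD//; [|exact: real_ccontZ..].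
by apply: eq_Rintegral => t _; rewrite Im_mul.
Qed.

Lemma IcN a b u : ccont a b u -> Ic a b (fun t => - u t) = - Ic a b u.
Proof.
by move=> Hu; rewrite -mulN1r -IcZ//; apply: eq_Ic => t _; rewrite mulN1r.
Qed.

Lemma ccontN a b u : ccont a b u -> ccont a b (fun t => - u t).
Proof. by move=> Hu t tab; apply: cvgNC; exact: Hu. Qed.

Lemma IcB a b u v : ccont a b u -> ccont a b v ->
  Ic a b (fun t => u t - v t) = Ic a b u - Ic a b v.
Proof. by move=> Hu Hv; rewrite (IcD Hu (ccontN Hv)) (IcN Hv). Qed.

Lemma Ic_cst a b (c : C) : a <= b -> Ic a b (fun=> c) = (b - a)%:C * c.
Proof.
move=> ab; apply: complex_ext; rewrite ?Re_mul ?Im_mul /= Rintegral_cst//=;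
  rewrite lebesgue_measure_itv /= lte_fin; case: ltgtP ab => // [ab|->] _ /=; ring.
Qed.

(** Multiplying by a unimodular constant rotates the integral onto the positive
   real axis, where it is the integral of a real part. *)
Lemma Ic_norm_le a b u (m : R -> R) : ccont a b u ->
  mu.-integrable `[a, b] (EFin \o m) ->
  (forall t, a <= t <= b -> normc (u t) <= m t) ->
  normc (Ic a b u) <= \int[mu]_(t in `[a, b]) m t.
Proof.
move=> Hu im um; set I := Ic a b u.
have [->|I0] := eqVneq I 0.
  rewrite normc0; apply: Rintegral_ge0 => t /=; rewrite in_itv /= => /um.
  exact/le_trans/normc_ge0.
have nI : 0 < normc I by rewrite normc_gt0.
pose c : C := (I^*)%C / (normc I)%:C.
have nc : normc c = 1.
  by rewrite normcMC normcV normc_conj normc_real gtr0_norm// divff// gt_eqF.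
have cI : c * I = (normc I)%:C.
  rewrite mulrAC conjc_mul expr2 rmorphM /= mulfK//.
  by rewrite -normc_eq0 normc_real gtr0_norm// gt_eqF.
have -> : normc I = complex.Re (Ic a b (fun t => c * u t)) by rewrite IcZ// -/I cI.
apply: le_Rintegral => //.
  by apply: (@ccont_Re a b (fun t => c * u t)); apply: ccontM; [exact: ccontC|exact: Hu].
move=> t /=; rewrite in_itv /= => tab.
apply: le_trans (um _ tab); rewrite -[leRHS]mul1r -nc -normcMC.
by apply: le_trans (ler_norm _) _; exact: normc_ge_absRe.
Qed.

Lemma Ic_le a b u (M : R) : a <= b -> ccont a b u ->
  (forall t, a <= t <= b -> normc (u t) <= M) ->
  normc (Ic a b u) <= (b - a) * M.
Proof.
move=> ab Hu uM.
have -> : (b - a) * M = \int[mu]_(t in `[a, b]) M.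
  rewrite Rintegral_cst//= lebesgue_measure_itv /= lte_fin mulrC.
  by case: ltgtP ab => // -> _ /=; rewrite subrr.
apply: Ic_norm_le => //; apply: real_ccont_integrable => t _; exact: cvg_cst.
Qed.

Lemma real_FTC a b (g r : R -> R) : a <= b ->
  (forall t, a <= t <= b -> is_derive t (1:R) g (r t)) ->
  (forall t, a <= t <= b -> r s @[s --> t] --> r t) ->
  \int[mu]_(t in `[a, b]) r t = g b - g a.
Proof.
rewrite le_eqVlt => /predU1P[<- _ _|ab dg cr].
  by rewrite set_itv1 Rintegral_set1 subrr.
have gc t : a <= t <= b -> g s @[s --> t] --> g t.
  by move=> /dg[H _]; apply: differentiable_continuous; apply/derivable1_diffP.
rewrite /Rintegral (@continuous_FTC2 _ r g)//=.
- by apply: continuous_in_subspaceT => t; rewrite inE /= in_itv /=; exact: cr.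
- split.
  + move=> t; rewrite in_itv /= => /andP[at_ tb].
    by have [] : is_derive t (1:R) g (r t) by apply: dg; rewrite !ltW.
  + by apply: cvg_at_right_filter; apply: gc; rewrite lexx ltW.
  + by apply: cvg_at_left_filter; apply: gc; rewrite lexx ltW.
- move=> t; rewrite in_itv /= => /andP[at_ tb].
  by rewrite derive1E; apply: derive_val; apply: dg; rewrite !ltW.
Qed.

Lemma Ic_FTC a b (g u : R -> C) : a <= b ->
  (forall t, a <= t <= b -> pathd g t (u t)) -> ccont a b u ->
  Ic a b u = g b - g a.
Proof.
move=> ab dg Hu; apply: complex_ext; rewrite ?(Re_add, Re_opp, Im_add, Im_opp) /=.
  apply: (@real_FTC a b (@complex.Re R \o g)) => // t tab.
    by have /pathd_ReIm[] := dg _ tab.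
  exact: cvgRe (Hu _ tab).
apply: (@real_FTC a b (@complex.Im R \o g)) => // t tab.
  by have /pathd_ReIm[] := dg _ tab.
exact: cvgIm (Hu _ tab).
Qed.

Lemma Ic_point a u : Ic a a u = 0.
Proof. by rewrite /Ic set_itv1 !Rintegral_set1. Qed.

Lemma Ic_chasles a b c u : a <= c -> c <= b -> ccont a b u ->
  Ic a b u = Ic a c u + Ic c b u.
Proof.
move=> ac cb Hu; have iR := ccont_Re Hu; have iI := ccont_Im Hu.
apply: complex_ext; rewrite ?Re_add ?Im_add /=.
  have := @Rintegral_itvB R (fun t => complex.Re (u t)) (BLeft a) (BRight b) c iR.
  rewrite !bnd_simp => /(_ ac cb) => H.
  rewrite -[in X in _ + X]Rintegral_itv_obnd_cbnd -?H; first by rewrite addrC subrK.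
  by apply: integrableS iR => //; apply: subset_itvr; rewrite bnd_simp.
have := @Rintegral_itvB R (fun t => complex.Im (u t)) (BLeft a) (BRight b) c iI.
rewrite !bnd_simp => /(_ ac cb) => H.
rewrite -[in X in _ + X]Rintegral_itv_obnd_cbnd -?H; first by rewrite addrC subrK.
by apply: integrableS iI => //; apply: subset_itvr; rewrite bnd_simp.
Qed.

End ComplexIntegral.

(** * Goursat's theorem on rectangles *)

Section Goursat.
Variable R : realType.
Local Notation C := (cplx R).
Implicit Types (F G : C -> C) (a b c d : R).

Lemma hline_clim (x y : R) : clim (nbhs x) (fun s => s +i* y : C) (x +i* y).
Proof. by apply: cvgComplex; [exact: cvg_id|exact: cvg_cst]. Qed.

Lemma vline_clim (x y : R) : clim (nbhs y) (fun s => x +i* s : C) (x +i* y).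
Proof. by apply: cvgComplex; [exact: cvg_cst|exact: cvg_id]. Qed.

Lemma hline_pathd (x y : R) : pathd (fun s => s +i* y : C) x 1.
Proof.
exists (fun=> 1); split; [exact: climC|by []|].
by move=> s; rewrite mul1r -rmorphB; apply: complex_ext => /=; rewrite ?subrr.
Qed.

Lemma vline_pathd (x y : R) : pathd (fun s => x +i* s : C) y 'i.
Proof.
exists (fun=> 'i); split; [exact: climC|by []|].
by move=> s; rewrite -rmorphB; apply: complex_ext; rewrite ?Re_mul ?Im_mul /=; ring.
Qed.

(** The integral of F along the boundary of the rectangle [a, b] x [c, d], run
   counterclockwise. *)
Definition rint F a b c d : C :=
  Ic a b (fun x => F (x +i* c)) - Ic a b (fun x => F (x +i* d)) +
  'i * (Ic c d (fun y => F (b +i* y)) - Ic c d (fun y => F (a +i* y))).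

Definition rcont F a b c d := forall x y, a <= x <= b -> c <= y <= d ->
  clim (nbhs (x +i* y : C)) F (F (x +i* y)).

Lemma hline_cont F a b c d y : rcont F a b c d -> c <= y <= d ->
  ccont a b (fun x => F (x +i* y)).
Proof.
by move=> H ycd x xab; apply: (clim_compC (@hline_clim x y)); exact: H.
Qed.

Lemma vline_cont F a b c d x : rcont F a b c d -> a <= x <= b ->
  ccont c d (fun y => F (x +i* y)).
Proof.
by move=> H ycd y xab; apply: (clim_compC (@vline_clim x y)); exact: H.
Qed.

Lemma hline_FTC F G a b y : a <= b ->
  (forall x, a <= x <= b -> hasd G (x +i* y) (F (x +i* y))) ->
  ccont a b (fun x => F (x +i* y)) ->
  Ic a b (fun x => F (x +i* y)) = G (b +i* y) - G (a +i* y).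
Proof.
move=> ab dG cF; rewrite (@Ic_FTC _ a b (fun x => G (x +i* y)))// => x xab.
have := pathd_comp (dG _ xab) (@hline_pathd x y).
by rewrite mulr1.
Qed.

Lemma vline_FTC F G c d x : c <= d ->
  (forall y, c <= y <= d -> hasd G (x +i* y) (F (x +i* y))) ->
  ccont c d (fun y => F (x +i* y)) ->
  'i * Ic c d (fun y => F (x +i* y)) = G (x +i* d) - G (x +i* c).
Proof.
move=> ab dG cF; rewrite -IcZ//.
have ci : ccont c d (fun y => 'i * F (x +i* y)).
  by apply: ccontM; [exact: ccontC|exact: cF].
rewrite (@Ic_FTC _ c d (fun y => G (x +i* y)) _ ab _ ci)// => y xab.
have := pathd_comp (dG _ xab) (@vline_pathd x y).
by rewrite mulrC.
Qed.

Lemma rint_prim F G a b c d : a <= b -> c <= d -> rcont F a b c d ->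
  (forall x y, a <= x <= b -> c <= y <= d -> hasd G (x +i* y) (F (x +i* y))) ->
  rint F a b c d = 0.
Proof.
move=> ab cd cF dG; rewrite /rint mulrBr.
have ha : a <= a <= b by rewrite lexx.
have hb : a <= b <= b by rewrite lexx andbT.
have hc : c <= c <= d by rewrite lexx.
have hd : c <= d <= d by rewrite lexx andbT.
rewrite (hline_FTC (G := G) ab _ (hline_cont cF hc)); last by move=> x ?; exact: dG.
rewrite (hline_FTC (G := G) ab _ (hline_cont cF hd)); last by move=> x ?; exact: dG.
rewrite (vline_FTC (G := G) cd _ (vline_cont cF ha)); last by move=> x ?; exact: dG.
rewrite (vline_FTC (G := G) cd _ (vline_cont cF hb)); last by move=> x ?; exact: dG.
by ring.
Qed.

Lemma rintD F G a b c d : a <= b -> c <= d -> rcont F a b c d -> rcont G a b c d ->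
  rint (fun w => F w + G w) a b c d = rint F a b c d + rint G a b c d.
Proof.
move=> ab cd cF cG; rewrite /rint.
have ha : a <= a <= b by rewrite lexx.
have hb : a <= b <= b by rewrite lexx andbT.
have hc : c <= c <= d by rewrite lexx.
have hd : c <= d <= d by rewrite lexx andbT.
rewrite (IcD (hline_cont cF hc) (hline_cont cG hc)) (IcD (hline_cont cF hd) (hline_cont cG hd)).
rewrite (IcD (vline_cont cF ha) (vline_cont cG ha)) (IcD (vline_cont cF hb) (vline_cont cG hb)).
by ring.
Qed.

Lemma rint_splitx F a b c d m : a <= m <= b -> c <= d -> rcont F a b c d ->
  rint F a b c d = rint F a m c d + rint F m b c d.
Proof.
move=> /andP[am mb] cd cF; rewrite /rint.
have hc : c <= c <= d by rewrite lexx.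
have hd : c <= d <= d by rewrite lexx andbT.
rewrite (Ic_chasles am mb (hline_cont cF hc)) (Ic_chasles am mb (hline_cont cF hd)).
by ring.
Qed.

Lemma rint_splity F a b c d m : c <= m <= d -> a <= b -> rcont F a b c d ->
  rint F a b c d = rint F a b c m + rint F a b m d.
Proof.
move=> /andP[am mb] cd cF; rewrite /rint.
have ha : a <= a <= b by rewrite lexx.
have hb : a <= b <= b by rewrite lexx andbT.
rewrite (Ic_chasles am mb (vline_cont cF ha)) (Ic_chasles am mb (vline_cont cF hb)).
by ring.
Qed.

Lemma rcont_sub F a b c d a' b' c' d' : a <= a' -> b' <= b -> c <= c' -> d' <= d ->
  rcont F a b c d -> rcont F a' b' c' d'.
Proof.
move=> aa bb cc dd H x y /andP[ax xb] /andP[cy yd]; apply: H; apply/andP; split.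
- exact: le_trans aa ax.
- exact: le_trans xb bb.
- exact: le_trans cc cy.
- exact: le_trans yd dd.
Qed.

Lemma rint_le F a b c d (M : R) : a <= b -> c <= d -> rcont F a b c d ->
  (forall x y, a <= x <= b -> c <= y <= d -> normc (F (x +i* y)) <= M) ->
  normc (rint F a b c d) <= 2 * ((b - a) + (d - c)) * M.
Proof.
move=> ab cd cF FM; rewrite /rint.
have ha : a <= a <= b by rewrite lexx.
have hb : a <= b <= b by rewrite lexx andbT.
have hc : c <= c <= d by rewrite lexx.
have hd : c <= d <= d by rewrite lexx andbT.
have n1 : normc ('i : C) = 1 by rewrite /= expr0n /= add0r expr1n sqrtr1.
apply: le_trans (normcD _ _) _; rewrite normcMC n1 mul1r.
have A : normc (Ic a b (fun x => F (x +i* c)) - Ic a b (fun x => F (x +i* d))) <= 2 * (b - a) * M.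
  apply: le_trans (normcD _ _) _; rewrite normcNC -mulrA mulr_natl mulr2n.
  apply: lerD; first by apply: (Ic_le ab (hline_cont cF hc)) => ? ?; exact: FM.
  by apply: (Ic_le ab (hline_cont cF hd)) => ? ?; exact: FM.
have B : normc (Ic c d (fun y => F (b +i* y)) - Ic c d (fun y => F (a +i* y))) <= 2 * (d - c) * M.
  apply: le_trans (normcD _ _) _; rewrite normcNC -mulrA mulr_natl mulr2n.
  apply: lerD; first by apply: (Ic_le cd (vline_cont cF hb)) => ? ?; exact: FM.
  by apply: (Ic_le cd (vline_cont cF ha)) => ? ?; exact: FM.
by apply: le_trans (lerD A B) _; rewrite -mulrDl -mulrDr.
Qed.

Let rect := (R * R * R * R)%type.
Let bad F (e : R) (r : rect) :=
  let: (a, b, c, d) := r in e * ((b - a) + (d - c)) ^+ 2 < normc (rint F a b c d).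
Let quarter (r : rect) (i j : bool) : rect :=
  let: (a, b, c, d) := r in
  (if i then (a + b) / 2 else a, if i then b else (a + b) / 2,
   if j then (c + d) / 2 else c, if j then d else (c + d) / 2).
Let step F e (r : rect) : rect :=
  if bad F e (quarter r false false) then quarter r false false else
  if bad F e (quarter r false true) then quarter r false true else
  if bad F e (quarter r true false) then quarter r true false else
  quarter r true true.
Let wfr (r : rect) := let: (a, b, c, d) := r in (a <= b) && (c <= d).
Let rc F (r : rect) := let: (a, b, c, d) := r in rcont F a b c d.

Let step_quarter F e r : exists i j, step F e r = quarter r i j.
Proof.
rewrite /step; case: ifP => _; first by exists false, false.
case: ifP => _; first by exists false, true.
by case: ifP => _; [exists true, false|exists true, true].
Qed.

Let step_bad F e r : wfr r -> rc F r -> bad F e r -> bad F e (step F e r).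
Proof.
move=> wr cr br; rewrite /step.
case: ifP => // b1; case: ifP => // b2; case: ifP => // b3.
apply/negPn/negP => b4.
case: r wr cr br b1 b2 b3 b4 => [[[a b] c] d] /andP[ab cd] cF.
rewrite /bad /quarter !ltNge => /negP H /negbT/negPn b1 /negbT/negPn b2 /negbT/negPn b3 /negPn b4.
apply: H.
set m := (a + b) / 2 in b1 b2 b3 b4; set n := (c + d) / 2 in b1 b2 b3 b4.
have [am mb] := midf_le ab; have [cn nd] := midf_le cd; rewrite -/m in am mb; rewrite -/n in cn nd.
rewrite (@rint_splitx F a b c d m) ?am//.
rewrite (@rint_splity F a m c d n) ?cn//; last exact: (rcont_sub _ _ _ _ cF).
rewrite (@rint_splity F m b c d n) ?cn//; last exact: (rcont_sub _ _ _ _ cF).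
apply: le_trans (normcD _ _) _.
apply: le_trans (lerD (normcD _ _) (normcD _ _)) _.
apply: le_trans (lerD (lerD b1 b2) (lerD b3 b4)) _.
have -> : m - a = (b - a) / 2 by rewrite /m; field.
have -> : b - m = (b - a) / 2 by rewrite /m; field.
have -> : n - c = (d - c) / 2 by rewrite /n; field.
have -> : d - n = (d - c) / 2 by rewrite /n; field.
by rewrite le_eqVlt; apply/orP; left; apply/eqP; field.
Qed.

Let half_sub (i : bool) a b : a <= b ->
  a <= (if i then (a + b) / 2 else a) /\ (if i then b else (a + b) / 2) <= b.
Proof. by move=> ab; have [? ?] := midf_le ab; case: i; rewrite lexx. Qed.

(** A rectangle violating the bound e * (half-perimeter)^2 has a quarter
   that violates it, and so on, while differentiability at their common
   point, and the vanishing of the integral of an affine function, give the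
   bound for the small ones. *)
Lemma goursat F a b c d : a <= b -> c <= d ->
  (forall x y, a <= x <= b -> c <= y <= d -> exists l, hasd F (x +i* y) l) ->
  rint F a b c d = 0.
Proof.
move=> ab cd dF; apply/eqP; rewrite -normc_eq0 eq_le normc_ge0 andbT.
have cF : rcont F a b c d by move=> x y hx hy; have [l /hasd_cvg] := dF x y hx hy.
apply/ler_addgt0Pl => e0 e00; rewrite addr0.
set s0 := (b - a) + (d - c).
have s00 : 0 <= s0 by rewrite addr_ge0// subr_ge0.
pose e := e0 / (s0 ^+ 2 + 1).
have e_gt0 : 0 < e by rewrite divr_gt0// ltr_wpDl// sqr_ge0.
suff : ~~ bad F e (a, b, c, d).
  rewrite /bad -leNgt -/s0 => /le_trans; apply.
  by rewrite /e mulrAC ler_pdivrMr ?ltr_wpDl ?sqr_ge0// ler_pM2l// lerDl.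
apply/negP => bad0.
pose r n := iter n (step F e) (a, b, c, d).
pose ra n := (r n).1.1.1; pose rb n := (r n).1.1.2; pose rcc n := (r n).1.2; pose rd n := (r n).2.
have rE n : r n = (ra n, rb n, rcc n, rd n).
  by rewrite /ra /rb /rcc /rd; case: (r n) => [[[? ?] ?] ?].
have inv n : [/\ a <= ra n, rb n <= b, c <= rcc n & rd n <= d] /\
    [/\ rb n - ra n = (b - a) / 2 ^+ n, rd n - rcc n = (d - c) / 2 ^+ n & bad F e (r n)].
  elim: n => [|n [[i1 i2 i3 i4] [i5 i6 i7]]].
    by rewrite /ra /rb /rcc /rd /r /= expr0 !divr1.
  have w1 : ra n <= rb n by rewrite -subr_ge0 i5 divr_ge0 ?subr_ge0// exprn_ge0.
  have w2 : rcc n <= rd n by rewrite -subr_ge0 i6 divr_ge0 ?subr_ge0// exprn_ge0.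
  have b' : bad F e (r n.+1).
    apply: (@step_bad F e (r n)) => //; first by rewrite rE /wfr w1.
    by rewrite rE; exact: (rcont_sub i1 i2 i3 i4).
  have [i [j E]] := step_quarter F e (r n).
  have E' : r n.+1 = quarter (r n) i j by rewrite -E.
  have [q1 q2] := half_sub i w1; have [q3 q4] := half_sub j w2.
  split; [|split=> //]; rewrite /ra /rb /rcc /rd E' rE /=.
  - by split; [exact: le_trans i1 q1|exact: le_trans q2 i2|exact: le_trans i3 q3|exact: le_trans q4 i4].
  - by rewrite exprS invfM mulrCA -i5; case: (i); field.
  - by rewrite exprS invfM mulrCA -i6; case: (j); field.
have mono n : [/\ ra n <= ra n.+1, rb n.+1 <= rb n, rcc n <= rcc n.+1 & rd n.+1 <= rd n].
  have [_ [i5 i6 _]] := inv n.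
  have w1 : ra n <= rb n by rewrite -subr_ge0 i5 divr_ge0 ?subr_ge0// exprn_ge0.
  have w2 : rcc n <= rd n by rewrite -subr_ge0 i6 divr_ge0 ?subr_ge0// exprn_ge0.
  have [i [j E]] := step_quarter F e (r n).
  have E' : r n.+1 = quarter (r n) i j by rewrite -E.
  have [q1 q2] := half_sub i w1; have [q3 q4] := half_sub j w2.
  by rewrite {2}/ra {1}/rb {2}/rcc {1}/rd E' rE.
have nested (u v : nat -> R) :
    (forall n, u n <= u n.+1) -> (forall n, v n.+1 <= v n) -> (forall n, u n <= v n) ->
    exists x, forall n, u n <= x <= v n.
  move=> hu hv uv.
  have hu' : {homo u : m n / (m <= n)%N >-> m <= n} by apply: homo_leq => // ? ? ?; exact: le_trans.
  have hv' : {homo v : m n / (m <= n)%N >-> n <= m} by apply: homo_leq => // ? ? ? ? /le_trans; exact.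
  have huv m n : u m <= v n.
    apply: le_trans (hu' _ _ (leq_maxl m n)) _.
    by apply: le_trans (uv _) _; apply: hv'; exact: leq_maxr.
  have hs : has_sup (range u).
    by split; [exists (u 0%N), 0%N|exists (v 0%N) => _ [m _ <-]].
  exists (sup (range u)) => n; apply/andP; split.
    by apply: sup_upper_bound => //; exists n.
  by apply: ge_sup; [exists (u 0%N), 0%N|move=> _ [m _ <-]].
have [x hx] : exists x, forall n, ra n <= x <= rb n.
  apply: nested => n; [by have [] := mono n|by have [] := mono n|].
  by have [_ [i5 _ _]] := inv n; rewrite -subr_ge0 i5 divr_ge0 ?subr_ge0// exprn_ge0.
have [y hy] : exists y, forall n, rcc n <= y <= rd n.
  apply: nested => n; [by have [] := mono n|by have [] := mono n|].
  by have [_ [_ i5 _]] := inv n; rewrite -subr_ge0 i5 divr_ge0 ?subr_ge0// exprn_ge0.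
have [l /hasdP dl] := dF x y (hx 0%N) (hy 0%N).
have e4 : 0 < e / 4 by rewrite divr_gt0.
have /nbhs_normcP[del del0 {}dl] := dl _ e4.
have [n hn] : exists n, s0 / 2 ^+ n < del.
  have := @cvg_geometric R s0 (2^-1).
  rewrite ger0_norm ?invr_ge0// invf_lt1 ?ltr1n// => /(_ isT).
  move=> /cvgrPdist_lt/(_ _ del0)[N _ HN]; exists N.
  have := HN N (leqnn N); rewrite /geometric /= sub0r normrN => /(le_lt_trans _); apply.
  by rewrite exprVn ler_norm.
have [[i1 i2 i3 i4] [i5 i6 i7]] := inv n.
have w1 : ra n <= rb n by rewrite -subr_ge0 i5 divr_ge0 ?subr_ge0// exprn_ge0.
have w2 : rcc n <= rd n by rewrite -subr_ge0 i6 divr_ge0 ?subr_ge0// exprn_ge0.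
move: i7; rewrite rE /bad ltNge => /negP; apply.
set s := rb n - ra n + _.
have sdel : s < del by rewrite /s i5 i6 -mulrDl.
have s_ge0 : 0 <= s by rewrite addr_ge0// subr_ge0.
pose z : C := x +i* y.
pose A w := F z + l * (w - z).
pose G w := F z * w + l / 2 * (w - z) ^+ 2.
have dG w : hasd G w (A w).
  have -> : A w = F z * 1 + l / 2 * (2%:R * (w - z) ^+ 1 * (1 - 0)) by rewrite /A; field.
  apply: hasdD; first exact: hasdZ (hasd_id w).
  by apply: hasdZ; apply: hasdX; exact: hasdB (hasd_id w) (hasd_cst z w).
have dA w : hasd A w (0 + l * (1 - 0)).
  apply: hasdD; first exact: hasd_cst.
  by apply: hasdZ; exact: hasdB (hasd_id w) (hasd_cst z w).
have cA : rcont A (ra n) (rb n) (rcc n) (rd n).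
  by move=> u v _ _; exact: hasd_cvg (dA _).
have cFn := rcont_sub i1 i2 i3 i4 cF.
have cE : rcont (fun w => F w - A w) (ra n) (rb n) (rcc n) (rd n).
  by move=> u v hu hv; apply: cvgBC; [exact: cFn|exact: cA].
have EF : (fun w => (F w - A w) + A w) = F by apply/funext => w; rewrite subrK.
have := rintD w1 w2 cE cA.
rewrite EF (rint_prim w1 w2 cA (fun u v _ _ => dG _)) addr0 => ->.
apply: le_trans (rint_le (M := e / 4 * s) w1 w2 cE _) _; last first.
  rewrite -/s (_ : 2 * s * _ = e / 2 * s ^+ 2); last by field.
  by rewrite ler_wpM2r ?sqr_ge0// ler_pdivrMr// ler_pMr// ler1n.
move=> u v hu hv; have := hx n; have := hy n => hyn hxn.
have hw : normc ((u +i* v : C) - z) <= s.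
  apply: le_trans (normc_le_ReIm _) _; move: hu hv hxn hyn; rewrite /s /=; clear.
  by move=> /andP[? ?] /andP[? ?] /andP[? ?] /andP[? ?]; apply: lerD; rewrite ler_norml; lra.
have := dl _ (le_lt_trans hw sdel).
rewrite /A opprD addrA => /le_trans; apply.
by rewrite ler_wpM2l// ltW.
Qed.

End Goursat.

(** * The exponential and the parametrization of circles *)

Section ComplexExponential.
Variable R : realType.
Local Notation C := (cplx R).
Implicit Types (z w : C).

Definition cexp (z : C) : C :=
  (expR (complex.Re z))%:C * (cos (complex.Im z) +i* sin (complex.Im z)).

Lemma cexpD z w : cexp (z + w) = cexp z * cexp w.
Proof.
rewrite /cexp !(Re_add, Im_add) expRD cosD sinD.
by apply: complex_ext; rewrite !(Re_mul, Im_mul) /=; ring.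
Qed.

Lemma normc_cexp z : normc (cexp z) = expR (complex.Re z).
Proof.
rewrite normcMC normc_real ger0_norm ?expR_ge0//= cos2Dsin2 sqrtr1 mulr1//.
Qed.

(** At 0 the increment splits into increments of the real exponential and of
   the circle; the functional equation transports the derivative to z. *)
Lemma hasd_cexp z : hasd cexp z (cexp z).
Proof.
have [a [a1 _ aE]] : pathd (fun x : R => (expR x)%:C : C) 0 1.
  apply/pathd_ReIm; split; first by have := is_derive_expR (0 : R); rewrite expR0.
  exact: is_derive_cst.
have Hb : pathd (fun y : R => cos y +i* sin y : C) 0 'i.
  apply/pathd_ReIm; split.
    by have := is_derive_cos (0 : R); rewrite sin0 oppr0.
  by have := is_derive_sin (0 : R); rewrite cos0.
have b0 := pathd_cvg Hb; have [b [b1 _ bE]] := Hb; rewrite cos0 sin0 in b0 bE.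
rewrite expR0 in aE.
have d0 : hasd cexp 0 1.
  apply/hasdP => e e0; have e2 : 0 < e / 2 by rewrite divr_gt0.
  have Re0 : complex.Re w @[w --> (0:C)] --> (0 : R) by exact: (cvgRe (@clim_id R 0)).
  have Im0 : complex.Im w @[w --> (0:C)] --> (0 : R) by exact: (cvgIm (@clim_id R 0)).
  have L1 : clim (nbhs (0:C)) (fun w => a (complex.Re w) * (cos (complex.Im w) +i* sin (complex.Im w))) (1 * (1 +i* 0)).
    by apply: cvgMC; [exact: (clim_comp Re0 a1)|exact: (clim_comp Im0 b0)].
  have L2 := clim_comp Im0 b1.
  move/cvg_normcP : L1 => /(_ _ e2) L1; move/cvg_normcP : L2 => /(_ _ e2) L2.
  near=> w.
  have E : cexp w - cexp 0 - 1 * (w - 0) =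
      (complex.Re w)%:C * (a (complex.Re w) * (cos (complex.Im w) +i* sin (complex.Im w)) - 1 * (1 +i* 0))
      + (complex.Im w)%:C * (b (complex.Im w) - 'i).
    have -> : cexp 0 = 1 by rewrite /cexp /= expR0 cos0 sin0 mul1r.
    have A := aE (complex.Re w); have B := bE (complex.Im w); rewrite rmorph0 !subr0 in A B.
    have {}A : (expR (complex.Re w))%:C = 1 + a (complex.Re w) * (complex.Re w)%:C :> C by rewrite -A addrC subrK.
    rewrite /cexp A [w in X in _ - _ - X]complexE; have -> : (1 +i* 0 : C) = 1 by [].
    move: B; rewrite (_ : (1 +i* 0 : C) = 1) //.
    move: (cos _ +i* sin _) (b _) (a _) => be ka al B.
    have -> : be = 1 + ka * (complex.Im w)%:C by rewrite -B addrC subrK.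
    by rewrite complexiE; ring.
  rewrite E subr0; apply: le_trans (normcD _ _) _; rewrite !normcMC !normc_real.
  have -> : e * normc w = normc w * (e / 2) + normc w * (e / 2) by field.
  apply: lerD; apply: ler_pM; rewrite ?normr_ge0 ?normc_ge0//.
  - exact: normc_ge_absRe.
  - by apply: ltW; near: w.
  - exact: normc_ge_absIm.
  - by apply: ltW; near: w.
have E : cexp = (fun x => cexp z * (cexp \o (fun x => x - z)) x).
  by apply/funext => x /=; rewrite -cexpD addrC subrK.
rewrite [X in hasd X]E -[X in hasd _ _ X]mulr1; apply: hasdZ.
rewrite -[X in hasd _ _ X]mulr1 -[X in hasd _ _ (_ * X)](subr0 1).
apply: hasd_comp; last by rewrite subrr.
by apply: hasdB; [exact: hasd_id|exact: hasd_cst].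
Unshelve. all: by end_near. Qed.

(** The unit circle, run through once at constant speed on `[0, 1]. *)
Definition ucirc (t : R) : C := cexp ((2 * pi)%:C * 'i * t%:C).

Lemma ucircE t : ucirc t = cos (2 * pi * t) +i* sin (2 * pi * t).
Proof.
have -> : ucirc t = cexp (0 +i* (2 * pi * t)).
  by congr cexp; apply: complex_ext; rewrite !(Re_mul, Im_mul) /=; ring.
by rewrite /cexp /= expR0 mul1r.
Qed.

Lemma normc_ucirc t : normc (ucirc t) = 1.
Proof. by rewrite ucircE /= cos2Dsin2 sqrtr1. Qed.

Lemma ucirc0 : ucirc 0 = 1.
Proof. by rewrite ucircE mulr0 cos0 sin0. Qed.

Lemma ucirc1 : ucirc 1 = 1.
Proof. by rewrite ucircE mulr1 mulr_natl cos2pi sin2pi. Qed.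

Definition twopii : C := (2 * pi)%:C * 'i.

Lemma twopii_neq0 : twopii != 0.
Proof.
have n1 : normc ('i : C) = 1 by rewrite /= expr0n /= add0r expr1n sqrtr1.
by rewrite -normc_gt0 normcMC n1 mulr1 normc_real normr_gt0 gt_eqF// mulr_gt0// pi_gt0.
Qed.

Lemma pathd_ucirc t : pathd ucirc t (twopii * ucirc t).
Proof.
rewrite mulrC; apply: (@pathd_comp _ cexp (fun t => twopii * t%:C)); first exact: hasd_cexp.
by rewrite -[X in pathd _ _ X]mulr1; apply: pathdZ; exact: pathd_real.
Qed.

Definition cpath (z0 : C) (r : R) (t : R) : C := z0 + r%:C * ucirc t.

Lemma pathd_cpath z0 r t : pathd (cpath z0 r) t (twopii * (cpath z0 r t - z0)).
Proof.
rewrite /cpath [z0 + _]addrC addrK mulrCA.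
rewrite -[X in pathd _ _ X]add0r; apply: pathdD; first exact: pathd_cst.
by apply: pathdZ; exact: pathd_ucirc.
Qed.

Lemma normc_cpath z0 r t : 0 <= r -> normc (cpath z0 r t - z0) = r.
Proof.
by move=> r0; rewrite /cpath addrAC subrr add0r normcMC normc_real normc_ucirc mulr1 ger0_norm.
Qed.

Lemma cpath_closed z0 r : cpath z0 r 0 = cpath z0 r 1.
Proof. by rewrite /cpath ucirc0 ucirc1. Qed.

End ComplexExponential.

(** * Bounded functionals on continuous functions *)

Section Functional.
Variable R : realType.
Local Notation C := (cplx R).
Implicit Types (z w : C) (F G : C -> C) (K : set C).

Definition onK K F := forall w, K w -> clim (nbhs w) F (F w).

(** A bounded linear functional on the continuous functions of K, with norm at
   most B: the features of a contour integral on which Cauchy's theorem rests.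
   Sums of contours, and averages over circles, are handled alike. *)
Record cfunctional K (L : (C -> C) -> C) (B : R) : Prop := CFunctional {
  cf_lin : forall c F G, onK K F -> onK K G -> L (fun w => c * F w + G w) = c * L F + L G;
  cf_ge0 : 0 <= B;
  cf_bd : forall F (M : R), onK K F -> 0 <= M -> (forall w, K w -> normc (F w) <= M) ->
    normc (L F) <= B * M }.

(** The contour integral of F(w) / (w - z0) along the circle, divided by
   2 pi i: contour integrals appear below with the factor w - z0. *)
Definition cmean (z0 : C) (r : R) F : C := Ic 0 1 (fun t => F (cpath z0 r t)).

Definition circle (z0 : C) (r : R) : set C := [set w | normc (w - z0) = r].

Lemma onK_cpath z0 r F : 0 <= r -> onK (circle z0 r) F ->
  ccont 0 1 (fun t => F (cpath z0 r t)).
Proof.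
move=> r0 cF t _; apply: (clim_compC (pathd_cvg (pathd_cpath z0 r t))).
by apply: cF; exact: normc_cpath.
Qed.

Lemma onKD K F G : onK K F -> onK K G -> onK K (fun w => F w + G w).
Proof. by move=> HF HG w Kw; apply: cvgDC; [exact: HF|exact: HG]. Qed.
Lemma onKM K F G : onK K F -> onK K G -> onK K (fun w => F w * G w).
Proof. by move=> HF HG w Kw; apply: cvgMC; [exact: HF|exact: HG]. Qed.
Lemma onKC K (c : C) : onK K (fun=> c).
Proof. by move=> w Kw; exact: climC. Qed.
Lemma onKid K : onK K (fun w => w).
Proof. by move=> w Kw; exact: clim_id. Qed.
Lemma onKB K F G : onK K F -> onK K G -> onK K (fun w => F w - G w).
Proof. by move=> HF HG w Kw; apply: cvgBC; [exact: HF|exact: HG]. Qed.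
Lemma onKV K F : (forall w, K w -> F w != 0) -> onK K F -> onK K (fun w => (F w)^-1).
Proof. by move=> F0 HF w Kw; apply: cvgVC; [exact: F0|exact: HF]. Qed.
Lemma onKhasd K F : (forall w, K w -> exists l, hasd F w l) -> onK K F.
Proof. by move=> HF w /HF[l /hasd_cvg]. Qed.

Lemma cmean_functional z0 r : 0 <= r -> cfunctional (circle z0 r) (cmean z0 r) 1.
Proof.
move=> r0; split=> //.
  move=> c F G cF cG; rewrite /cmean.
  have hF := onK_cpath r0 cF; have hG := onK_cpath r0 cG.
  rewrite -(IcZ c hF); apply: IcD; last exact: hG.
  by apply: ccontM; [exact: ccontC|exact: hF].
move=> F M cF M0 FM; have := @Ic_le _ 0 1 (fun t => F (cpath z0 r t)) M ler01 (onK_cpath r0 cF).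
by rewrite subr0; apply => t _; apply: FM; exact: normc_cpath.
Qed.

Section Theory.
Variables (K : set C) (L : (C -> C) -> C) (B : R).
Hypothesis HL : cfunctional K L B.

Lemma cf_ext F G : onK K F -> onK K G -> (forall w, K w -> F w = G w) -> L F = L G.
Proof.
move=> cF cG FG.
have cm : onK K (fun w => -1 * F w + G w).
  by apply: onKD; [apply: onKM; [exact: onKC|exact: cF]|exact: cG].
have : normc (L (fun w => -1 * F w + G w)) <= B * 0.
  apply: (cf_bd HL) => // w Kw.
  by rewrite FG// mulN1r addNr normc0.
rewrite mulr0 => H; have {H} : normc (L (fun w => -1 * F w + G w)) == 0.
  by rewrite eq_le H normc_ge0.
by rewrite normc_eq0 (cf_lin HL)// mulN1r addrC subr_eq0 eq_sym => /eqP.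
Qed.

Lemma cfD F G : onK K F -> onK K G -> L (fun w => F w + G w) = L F + L G.
Proof.
move=> cF cG; rewrite -[L F]mul1r -(cf_lin HL)//.
by congr L; apply/funext => w; rewrite mul1r.
Qed.

Lemma cf0 : L (fun=> 0) = 0.
Proof.
apply/eqP; rewrite -normc_eq0 eq_le normc_ge0 andbT -(mulr0 B).
by apply: (cf_bd HL) => // [|w _]; [exact: onKC|rewrite normc0].
Qed.

Lemma cfZ c F : onK K F -> L (fun w => c * F w) = c * L F.
Proof.
move=> cF; have := cf_lin HL c cF (@onKC K 0); rewrite cf0 addr0 => <-.
by congr L; apply/funext => w; rewrite addr0.
Qed.

Lemma cfB F G : onK K F -> onK K G -> L (fun w => F w - G w) = L F - L G.
Proof.
move=> cF cG; rewrite addrC -mulN1r -(cf_lin HL)//.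
by congr L; apply/funext => w; rewrite mulN1r addrC.
Qed.

End Theory.
End Functional.

(** * The mean value property and Cauchy's formula *)

Section CauchyTheory.
Variable R : realType.
Local Notation C := (cplx R).
Implicit Types (z w a h : C) (F G : C -> C) (K : set C) (r : R).

#[global] Instance cinfty_filter : Filter (@cinfty_nbhs R).
Proof.
split.
- by exists 0.
- move=> P Q [M HM] [N HN]; exists (Num.max M N) => z.
  by rewrite gt_max => /andP[/HM ? /HN ?].
- by move=> P Q PQ [M HM]; exists M => z /HM /PQ.
Qed.

(** In the coordinate log(w - z0) / (2 pi) the annulus is a rectangle of height
   1 whose horizontal sides carry the same values, by periodicity. Goursat's
   theorem then equates the integrals over the two vertical sides, which are
   the two means. *)
Lemma circle_const G z0 r1 r2 : 0 < r1 -> r1 <= r2 ->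
  (forall w, r1 <= normc (w - z0) <= r2 -> exists l, hasd G w l) ->
  cmean z0 r1 G = cmean z0 r2 G.
Proof.
move=> r10 r12 dG.
have r20 := lt_le_trans r10 r12.
have p0 : 0 < 2 * pi :> R by rewrite mulr_gt0// pi_gt0.
pose s r : R := ln r / (2 * pi).
pose E w := z0 + cexp ((2 * pi)%:C * w).
pose F w := G (E w).
have nE w : normc (E w - z0) = expR (2 * pi * complex.Re w).
  by rewrite /E addrAC subrr add0r normc_cexp Re_mul /= mul0r subr0.
have Es r : 0 < r -> expR (2 * pi * s r) = r.
  by move=> r0; rewrite /s mulrC divfK ?gt_eqF// lnK.
have s12 : s r1 <= s r2.
  by rewrite /s ler_pM2r ?invr_gt0// ler_ln ?posrE.
have dE w : exists l, hasd E w l.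
  exists (0 + cexp ((2 * pi)%:C * w) * ((2 * pi)%:C * 1)).
  apply: hasdD; first exact: hasd_cst.
  apply: (@hasd_comp _ (fun w => (2 * pi)%:C * w) (@cexp R)); last exact: hasd_cexp.
  by apply: hasdZ; exact: hasd_id.
have : rint F (s r1) (s r2) 0 1 = 0.
  apply: goursat => // x y /andP[x1 x2] _.
  have [l Hl] := dE (x +i* y).
  have [|m Hm] := dG (E (x +i* y)).
    rewrite nE /= -{1}(Es _ r10) -(Es _ r20) !ler_expR !ler_pM2l//.
    by rewrite x1 x2.
  by exists (m * l); exact: hasd_comp Hl Hm.
rewrite /rint.
have Ep x : E (x +i* 1) = E (x +i* 0).
  rewrite /E; congr (_ + _); rewrite /cexp !(Re_mul, Im_mul) /= !mul0r !mulr0 !mulr1 !subr0 !add0r !addr0.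
  by rewrite mulr_natl cos2pi sin2pi cos0 sin0.
rewrite (_ : (fun x => F (x +i* 1)) = (fun x => F (x +i* 0))); last first.
  by apply/funext => x; rewrite /F Ep.
rewrite subrr add0r => /eqP; rewrite mulf_eq0 => /orP[|].
  by rewrite eq_complex /= oner_eq0 andbF.
rewrite subr_eq0 => /eqP.
have Ec r : 0 < r -> (fun y => F (s r +i* y)) = (fun t => G (cpath z0 r t)).
  move=> r0; apply/funext => y; rewrite /F /E /cpath; congr (G (z0 + _)).
  rewrite ucircE /cexp !(Re_mul, Im_mul) /= !mul0r subr0 addr0 Es//.
by rewrite !Ec// => ->.
Qed.

Lemma cmean_cst z0 r (c : C) : cmean z0 r (fun=> c) = c.
Proof. by rewrite /cmean Ic_cst// subr0 mul1r. Qed.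

Lemma cmean_near z0 r F (c : C) (e : R) : 0 <= r -> onK (circle z0 r) F -> 0 <= e ->
  (forall w, normc (w - z0) = r -> normc (F w - c) <= e) ->
  normc (cmean z0 r F - c) <= e.
Proof.
move=> r0 cF e0 H; have HL := cmean_functional z0 r0.
rewrite -[X in cmean _ _ _ - X](cmean_cst z0 r) -(cfB HL cF (@onKC _ _ _)).
by rewrite -[leRHS]mul1r; exact: (cf_bd HL (onKB cF (@onKC _ _ _)) e0 H).
Qed.

(** Continuity of the mean in the radius: G is uniformly continuous near the
   compact circle of radius rho. *)
Lemma cmean_radius G z0 rho (e : R) : 0 < e -> 0 <= rho -> onK (circle z0 rho) G ->
  \forall r \near rho, 0 <= r -> onK (circle z0 r) G ->
    normc (cmean z0 r G - cmean z0 rho G) <= e.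
Proof.
move=> e0 rho0 cG.
have unif : \forall r \near rho, `[0, 1]%classic `<=`
    (fun t => normc (G (cpath z0 r t) - G (cpath z0 rho t)) < e).
  have cI : near_covering (`[0, 1]%classic : set R).
    by apply/compact_near_coveringP; exact: segment_compact.
  apply: (cI _ (nbhs rho) _ _) => t _.
  have Gt : clim (nbhs (cpath z0 rho t)) G (G (cpath z0 rho t)) by apply: cG; exact: normc_cpath.
  have L1 : clim (nbhs t) (fun s => G (cpath z0 rho s)) (G (cpath z0 rho t)).
    exact: clim_compC (pathd_cvg (pathd_cpath z0 rho t)) Gt.
  have fst_t : p.1 @[p --> filter_prod (nbhs t) (nbhs rho)] --> t by exact: cvg_fst.
  have L2 : clim (filter_prod (nbhs t) (nbhs rho)) (fun p => G (cpath z0 p.2 p.1)) (G (cpath z0 rho t)).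
    apply: (clim_compC _ Gt); apply: cvgDC; first exact: climC.
    apply: cvgMC; first by apply: cvgRealC; exact: cvg_snd.
    exact: (clim_comp fst_t (pathd_cvg (pathd_ucirc t))).
  have L : clim (filter_prod (nbhs t) (nbhs rho))
      (fun p => G (cpath z0 p.2 p.1) - G (cpath z0 rho p.1)) 0.
    by rewrite -(subrr (G (cpath z0 rho t))); apply: cvgBC L2 (clim_comp fst_t L1).
  move/cvg_normcP : L => /(_ _ e0).
  by apply: filterS => -[s r] /=; rewrite subr0.
apply: filterS unif => r H r0 cGr; rewrite /cmean.
have c1 := onK_cpath r0 cGr; have c2 := onK_cpath rho0 cG.
rewrite -(IcB c1 c2) -[leRHS]mul1r -[X in X * e](subr0 1).
apply: Ic_le; first exact: ler01.
  by apply: ccontD; [exact: c1|exact: ccontN].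
by move=> t t01; apply/ltW/H; rewrite /= in_itv.
Qed.

(** The means are constant on either side of the circle through an exceptional
   point, and continuity in the radius carries the value across it. *)
Lemma circle_const_except G z0 p r1 r2 : 0 < r1 -> r1 <= r2 ->
  onK [set w | r1 <= normc (w - z0) <= r2] G ->
  (forall w, r1 <= normc (w - z0) <= r2 -> w != p -> exists l, hasd G w l) ->
  cmean z0 r1 G = cmean z0 r2 G.
Proof.
move=> r10 r12 cG dG; set rho := normc (p - z0).
have off s t : r1 <= s -> s <= t -> t <= r2 -> t < rho \/ rho < s -> cmean z0 s G = cmean z0 t G.
  move=> s1 st t2 H; apply: circle_const => //; first exact: lt_le_trans s1.
  move=> w /andP[sw wt]; apply: dG; first by rewrite (le_trans s1 sw) (le_trans wt t2).
  by apply/eqP => wp; move: sw wt; rewrite wp -/rho; case: H; lra.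
have on s : r1 <= s <= r2 -> onK (circle z0 s) G.
  by move=> hs w; rewrite /circle /= => ws; apply: cG; rewrite /= ws.
have [rr1|rr1] := ltP rho r1; first by apply: off => //; right.
have [rr2|rr2] := ltP r2 rho; first by apply: off => //; left.
have hrho : r1 <= rho <= r2 by rewrite rr1.
have rho0 : 0 <= rho by exact: normc_ge0.
suff side s : r1 <= s <= r2 -> cmean z0 s G = cmean z0 rho G by rewrite !side ?lexx ?r12.
move=> /andP[s1 s2]; have [->//|sr] := eqVneq s rho.
apply/eqP; rewrite -subr_eq0 -normc_eq0 eq_le normc_ge0 andbT.
apply/ler_addgt0Pl => e e0; rewrite addr0.
have /real_nbhsP[d d0 Hd] := cmean_radius e0 rho0 (on _ hrho).
pose m := Num.min (d / 2) `|s - rho|.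
have m0 : 0 < m by rewrite lt_min divr_gt0 ?normr_gt0 ?subr_eq0.
have md : m <= d / 2 by rewrite ge_min lexx.
have ms : m <= `|s - rho| by rewrite ge_min lexx orbT.
have [lt|gt|eq] := ltgtP s rho; last by rewrite eq eqxx in sr.
  rewrite ltr0_norm ?subr_lt0// in ms.
  rewrite (off s (rho - m)) ?s1//; [|lra|lra|by left; lra].
  by apply: Hd; [rewrite addrAC subrr add0r normrN gtr0_norm//; lra|lra|apply: on; lra].
rewrite gtr0_norm ?subr_gt0// in ms.
rewrite -(off (rho + m) s) ?s2//; [|lra|lra|by right; lra].
by apply: Hd; [rewrite addrAC subrr add0r gtr0_norm//; lra|lra|apply: on; lra].
Qed.

Lemma mean_value_except G z0 p r : 0 < r ->
  onK [set w | normc (w - z0) <= r] G ->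
  (forall w, normc (w - z0) <= r -> w != p -> exists l, hasd G w l) -> cmean z0 r G = G z0.
Proof.
move=> r0 cG dG; apply/eqP; rewrite -subr_eq0 -normc_eq0 eq_le normc_ge0 andbT.
apply/ler_addgt0Pl => e e0; rewrite addr0.
have /cvg_normcP/(_ _ e0)/nbhs_normcP[d d0 Hd] : clim (nbhs z0) G (G z0).
  by apply: cG; rewrite /= subrr normc0 ltW.
pose r' := Num.min r (d / 2).
have r'0 : 0 < r' by rewrite lt_min r0 divr_gt0.
have r'r : r' <= r by rewrite ge_min lexx.
have r'd : r' < d by rewrite gt_min ltr_pdivrMr// ltr_pMr// ltr1n orbT.
rewrite -(@circle_const_except G z0 p r' r)//.
- apply: cmean_near (ltW r'0) _ (ltW e0) _.
    by move=> w wr; apply: cG; rewrite /= wr.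
  by move=> w wr; apply/ltW/Hd; rewrite wr.
- by move=> w /andP[_ wr]; exact: cG.
- by move=> w /andP[_ ?]; exact: dG.
Qed.

Lemma mean_value G z0 r : 0 < r ->
  (forall w, normc (w - z0) <= r -> exists l, hasd G w l) -> cmean z0 r G = G z0.
Proof.
move=> r0 dG; apply: (mean_value_except (p := z0) r0).
  by apply: onKhasd.
by move=> w wr _; exact: dG.
Qed.

(** The mean does not depend on the radius, which can be taken so large that the
   values on the circle are close to the limit. *)
Lemma mean_infty G z0 r (c : C) : 0 < r ->
  (forall w, r <= normc (w - z0) -> exists l, hasd G w l) ->
  clim (@cinfty_nbhs R) G c -> cmean z0 r G = c.
Proof.
move=> r0 dG cG; apply/eqP; rewrite -subr_eq0 -normc_eq0 eq_le normc_ge0 andbT.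
apply/ler_addgt0Pl => e e0; rewrite addr0.
have /cvg_normcP/(_ _ e0)[M HM] := cG.
pose r' := Num.max r (`|M| + normc z0 + 1).
have rr' : r <= r' by rewrite le_max lexx.
have r'0 := lt_le_trans r0 rr'.
have Mr' : `|M| + normc z0 + 1 <= r' by rewrite le_max lexx orbT.
rewrite (@circle_const G z0 r r')//; last first.
  by move=> w /andP[? _]; exact: dG.
apply: cmean_near (ltW r'0) _ (ltW e0) _.
  by apply: onKhasd => w wr; apply: dG; rewrite wr.
move=> w wr; apply/ltW/HM.
have := normcD (w - z0) z0; have := normcD w (- z0); rewrite wr normcNC.
have := ler_norm M; lra.
Qed.

Lemma clim_infty_inv a : clim (@cinfty_nbhs R) (fun w => (w - a)^-1) 0.
Proof.
apply/cvg_normcP => e e0; exists (normc a + e^-1) => w hw.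
have := normcD (w - a) a; rewrite subrK => A.
have B : e^-1 < normc (w - a) by lra.
rewrite subr0 normcV -[ltRHS]invrK ltf_pV2// posrE ?invr_gt0//.
by apply: lt_trans B; rewrite invr_gt0.
Qed.

Lemma infty_neq a : \forall w \near @cinfty_nbhs R, w != a.
Proof. by exists (normc a) => w; apply: contraTneq => ->; rewrite ltxx. Qed.

Lemma clim_infty_ratio z0 a : clim (@cinfty_nbhs R) (fun w => (w - z0) / (w - a)) 1.
Proof.
have : clim (@cinfty_nbhs R) (fun w => 1 + (a - z0) * (w - a)^-1) (1 + (a - z0) * 0).
  apply: cvgDC; first exact: climC.
  by apply: cvgMC; [exact: climC|exact: clim_infty_inv].
rewrite mulr0 addr0; apply: clim_near; near=> w.
have wa : w - a != 0 by rewrite subr_eq0; near: w; exact: infty_neq.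
have -> : w - z0 = (w - a) + (a - z0) by ring.
by rewrite [RHS]mulrDl divff.
Unshelve. all: by end_near. Qed.

Lemma hasd_shift a w : hasd (fun w => w - a) w 1.
Proof. by rewrite -(subr0 1); apply: hasdB; [exact: hasd_id|exact: hasd_cst]. Qed.

Lemma hasd_inv_shift a w : w != a -> hasd (fun w => (w - a)^-1) w (- 1 / (w - a) ^+ 2).
Proof.
by move=> wa; apply: hasdV; [rewrite subr_eq0|exact: hasd_shift].
Qed.

Lemma hasd_kernel z w : w != z -> hasd (fun a => (w - a)^-1) z ((w - z)^-1 ^+ 2).
Proof.
move=> wz.
have -> : (w - z)^-1 ^+ 2 = - (0 - 1) / (w - z) ^+ 2 by rewrite sub0r opprK exprVn mul1r.
apply: hasdV; first by rewrite subr_eq0.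
by apply: hasdB; [exact: hasd_cst|exact: hasd_id].
Qed.

Lemma cmean_kernel z0 r a : normc (a - z0) < r ->
  cmean z0 r (fun w => (w - z0) / (w - a)) = 1.
Proof.
move=> ar; apply: mean_infty; last exact: clim_infty_ratio.
  by apply: le_lt_trans ar; exact: normc_ge0.
move=> w wr; eexists; apply: hasdM; first exact: hasd_shift.
apply: hasd_inv_shift; apply: contraTneq wr => ->.
by rewrite -ltNge.
Qed.

(** Divided differences, completed on the diagonal by the derivative. *)
Definition dd F a z := if z == a then dC F a else (F z - F a) / (z - a).

Lemma ddE F a z : z != a -> dd F a z = (F z - F a) / (z - a).
Proof. by rewrite /dd => /negbTE ->. Qed.

Lemma dd_mul F a z : dd F a z * (z - a) = F z - F a.
Proof.
by rewrite /dd; case: eqVneq => [->|za]; rewrite ?subrr ?mulr0// divfK// subr_eq0.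
Qed.

Lemma hasd_dd_off F a z l : hasd F z l -> z != a -> exists l', hasd (dd F a) z l'.
Proof.
move=> Hl za; eexists.
apply: (@hasd_near _ (fun w => (F w - F a) * (w - a)^-1)); last first.
  apply: hasdM; last exact: hasd_inv_shift.
  by apply: hasdB; [exact: Hl|exact: hasd_cst].
have n0 : 0 < normc (z - a) by rewrite normc_gt0 subr_eq0.
have := near_normc z n0; apply: filterS => w hw; rewrite ddE//.
by apply: contraTneq hw => ->; rewrite normcBC ltxx.
Qed.

Lemma clim_dd F a : hasd F a (dC F a) -> clim (nbhs a) (dd F a) (dd F a a).
Proof.
move=> [q [qa q1 qE]]; rewrite {2}/dd eqxx.
have -> : dd F a = q; last exact: qa.
apply/funext => z; rewrite /dd; case: eqVneq => [->|za]; first by rewrite q1.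
by rewrite qE mulfK// subr_eq0.
Qed.

(** The mean value property for (w - z0) times the difference quotient of F at a,
   which is continuous at a and vanishes at z0. *)
Lemma cauchy_formula F z0 r a : (forall w, normc (w - z0) <= r -> exists l, hasd F w l) ->
  normc (a - z0) < r ->
  F a = cmean z0 r (fun w => F w * ((w - z0) / (w - a))).
Proof.
move=> dF ar; have r0 : 0 < r := le_lt_trans (normc_ge0 _) ar.
have dFa : hasd F a (dC F a).
  by have [l Hl] := dF a (ltW ar); rewrite (dCP Hl).
have ddc w : normc (w - z0) <= r -> clim (nbhs w) (dd F a) (dd F a w).
  move=> wr; have [->|wa] := eqVneq w a; first exact: clim_dd.
  by have [l Hl] := dF w wr; have [l' /hasd_cvg] := hasd_dd_off Hl wa.
have wa w : circle z0 r w -> w - a != 0.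
  move=> wr; rewrite subr_eq0; apply: contraTneq ar => wa.
  by rewrite -leNgt -wr wa.
have cs A : onK A (fun w => w - z0) by move=> w _; exact: hasd_cvg (hasd_shift _ _).
have cF : onK (circle z0 r) F by apply: onKhasd => w wr; apply: dF; rewrite wr.
have ck : onK (circle z0 r) (fun w => (w - z0) / (w - a)).
  by apply: (onKM (cs _) (onKV wa _)) => w _; exact: hasd_cvg (hasd_shift _ _).
have cd : onK (circle z0 r) (dd F a) by move=> w wr; apply: ddc; rewrite wr.
have HL := cmean_functional z0 (ltW r0).
have E0 : cmean z0 r (fun w => dd F a w * (w - z0)) = 0.
  suff -> : cmean z0 r (fun w => dd F a w * (w - z0)) = dd F a z0 * (z0 - z0) by rewrite subrr mulr0.
  apply: (@mean_value_except (fun w => dd F a w * (w - z0)) z0 a r r0).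
    by apply: onKM; [exact: ddc|exact: cs].
  move=> w wr wna; have [l Hl] := dF w wr; have [m Hm] := hasd_dd_off Hl wna.
  by eexists; apply: hasdM; [exact: Hm|exact: hasd_shift].
have cFk := onKM cF ck.
have cak := onKM (@onKC _ (circle z0 r) (F a)) ck.
have E1 : cmean z0 r (fun w => F w * ((w - z0) / (w - a)) - F a * ((w - z0) / (w - a))) = 0.
  rewrite -E0; apply: (cf_ext HL (onKB cFk cak) (onKM cd (cs _))).
  move=> w /wa wa0; rewrite -mulrBl -dd_mul.
  by rewrite -mulrA [(w - a) * _]mulrC divfK.
move: E1; rewrite (cfB HL cFk cak).
by rewrite (cfZ HL _ ck) cmean_kernel// mulr1 => /eqP; rewrite subr_eq0 => /eqP <-.
Qed.

End CauchyTheory.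

(** * Cauchy's estimates, regularity of holomorphic functions *)

Section CauchyEstimates.
Variable R : realType.
Local Notation C := (cplx R).
Implicit Types (z w a h : C) (F G : C -> C) (K U : set C) (r : R).

(** Cauchy's formula, and the expansion of its kernel to second order:
   1/(w - h) - 1/w - h/w^2 = h^2 / (w^2 (w - h)) for z0 = 0. *)
Lemma cauchy_taylor F z0 r (M : R) : 0 < r -> 0 <= M ->
  (forall w, normc (w - z0) <= r -> exists l, hasd F w l) ->
  (forall w, normc (w - z0) = r -> normc (F w) <= M) ->
  dC F z0 = cmean z0 r (fun w => F w * (w - z0)^-1) /\
  forall h, normc h <= r / 2 ->
    normc (F (z0 + h) - F z0 - h * dC F z0) <= 2 * M / r ^+ 2 * normc h ^+ 2.
Proof.
move=> r0 M0 dF FM.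
have HL := cmean_functional z0 (ltW r0).
have cF : onK (circle z0 r) F by apply: onKhasd => w wr; apply: dF; rewrite wr.
have cs (a : C) : onK (circle z0 r) (fun w => w - a).
  by move=> w _; exact: hasd_cvg (hasd_shift _ _).
have ci a : normc (a - z0) < r -> onK (circle z0 r) (fun w => (w - a)^-1).
  move=> ar; apply: (onKV _ (cs a)) => w wr.
  by rewrite subr_eq0; apply: contraTneq ar => <-; rewrite -leNgt wr.
have zr : normc (z0 - z0) < r by rewrite subrr normc0.
have nz w : circle z0 r w -> w - z0 != 0 by move=> wr; rewrite -normc_gt0 wr.
set F1 := cmean z0 r (fun w => F w * (w - z0)^-1).
have cF1 := onKM cF (ci _ zr).
have est h : normc h <= r / 2 ->
    normc (F (z0 + h) - F z0 - h * F1) <= 2 * M / r ^+ 2 * normc h ^+ 2.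
  move=> hr.
  have hr1 : normc (z0 + h - z0) < r.
    by rewrite [z0 + h]addrC addrK; apply: le_lt_trans hr _; rewrite ltr_pdivrMr// ltr_pMr// ltr1n.
  have nzh w : circle z0 r w -> w - (z0 + h) != 0.
    by move=> wr; rewrite subr_eq0; apply: contraTneq hr1 => <-; rewrite -leNgt wr.
  rewrite (cauchy_formula dF hr1) (cauchy_formula dF zr).
  have c1 := onKM cF (onKM (cs z0) (ci _ hr1)).
  have c2 := onKM cF (onKM (cs z0) (ci _ zr)).
  have c3 := onKM (@onKC _ _ h) cF1.
  rewrite -(cfB HL c1 c2) -(cfZ HL h cF1) -(cfB HL (onKB c1 c2) c3).
  rewrite -[leRHS]mul1r.
  apply: (cf_bd HL (onKB (onKB c1 c2) c3)).
    by rewrite mulr_ge0 ?sqr_ge0// divr_ge0 ?sqr_ge0// mulr_ge0.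
  move=> w wr; have wz := nz _ wr; have wh := nzh _ wr.
  have -> : F w * ((w - z0) / (w - (z0 + h))) - F w * ((w - z0) / (w - z0)) - h * (F w * (w - z0)^-1)
     = F w * (h ^+ 2 * ((w - (z0 + h))^-1 * (w - z0)^-1)) by field; rewrite wz wh.
  rewrite !normcMC !normcV wr -expr2.
  have A : r / 2 <= normc (w - (z0 + h)).
    have := normcD (w - (z0 + h)) h.
    have -> : w - (z0 + h) + h = w - z0 by ring.
    by rewrite wr; lra.
  have r20 : 0 < r / 2 by rewrite divr_gt0.
  have A' : (normc (w - (z0 + h)))^-1 <= (r / 2)^-1.
    by rewrite lef_pV2// posrE// (lt_le_trans r20).
  have -> : 2 * M / r ^+ 2 * normc h ^+ 2 = M * (normc h ^+ 2 * ((r / 2)^-1 * r^-1)).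
    by field; rewrite gt_eqF.
  apply: ler_pM; rewrite ?normc_ge0//.
  - by rewrite mulr_ge0 ?sqr_ge0// mulr_ge0 ?invr_ge0 ?normc_ge0// ltW.
  - exact: FM.
  - rewrite ler_wpM2l ?sqr_ge0// ler_wpM2r// invr_ge0 ltW//.
suff -> : dC F z0 = F1 by split.
apply: dCP; apply/hasdP => e e0.
set k := 2 * M / r ^+ 2 in est.
have k0 : 0 <= k by rewrite divr_ge0 ?sqr_ge0// mulr_ge0.
have d0 : 0 < Num.min (r / 2) (e / (k + 1)).
  by rewrite lt_min !divr_gt0// ltr_wpDl.
apply/nbhs_normcP; exists (Num.min (r / 2) (e / (k + 1))) => // w.
rewrite lt_min => /andP[/ltW w1 w2].
have := est _ w1; rewrite [z0 + _]addrC subrK [_ * F1]mulrC => /le_trans; apply.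
rewrite expr2 mulrA ler_wpM2r ?normc_ge0//.
move: w2; rewrite ltr_pdivlMr ?ltr_wpDl// => w2.
apply: le_trans (ltW w2); rewrite mulrC ler_wpM2l ?normc_ge0// lerDl//.
Qed.

Lemma cauchy_deriv_le F z0 r (M : R) : 0 < r -> 0 <= M ->
  (forall w, normc (w - z0) <= r -> exists l, hasd F w l) ->
  (forall w, normc (w - z0) = r -> normc (F w) <= M) ->
  normc (dC F z0) <= M / r.
Proof.
move=> r0 M0 dF FM.
have HL := cmean_functional z0 (ltW r0).
have cF : onK (circle z0 r) F by apply: onKhasd => w wr; apply: dF; rewrite wr.
have nz w : circle z0 r w -> w - z0 != 0 by move=> wr; rewrite -normc_gt0 wr.
have cs : onK (circle z0 r) (fun w => w - z0).
  by move=> w _; exact: hasd_cvg (hasd_shift _ _).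
have [E _] := cauchy_taylor r0 M0 dF FM.
rewrite E -[leRHS]mul1r; apply: (cf_bd HL (onKM cF (onKV nz cs))).
  by rewrite divr_ge0// ltW.
by move=> w wr; rewrite normcMC normcV wr ler_wpM2r ?invr_ge0 ?(ltW r0)//; exact: FM.
Qed.

(** Uniform bounds give uniform Taylor remainders by Cauchy's estimate, hence
   differentiation under a bounded functional. *)
Lemma param_hasd K L B (G : C -> C -> C) (D : C -> C) z0 rho (M : R) :
  cfunctional K L B -> 0 < rho -> 0 <= M ->
  (forall x a, K x -> normc (a - z0) < rho -> exists l, hasd (fun a => G a x) a l) ->
  (forall a, normc (a - z0) < rho -> onK K (G a)) ->
  (forall x a, K x -> normc (a - z0) < rho -> normc (G a x) <= M) ->
  onK K D -> (forall x, K x -> hasd (fun a => G a x) z0 (D x)) ->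
  hasd (fun a => L (G a)) z0 (L D).
Proof.
move=> HL rho0 M0 dG cG GM cD HD.
have B0 := cf_ge0 HL.
pose r := rho / 2.
have r0 : 0 < r by rewrite divr_gt0.
have rr a : normc (a - z0) <= r -> normc (a - z0) < rho by rewrite /r; lra.
have zr : normc (z0 - z0) < rho by rewrite subrr normc0.
set k := 2 * M / r ^+ 2.
have k0 : 0 <= k by rewrite divr_ge0 ?sqr_ge0// mulr_ge0.
apply/hasdP => e e0.
have bk : 0 < B * k + 1 by rewrite ltr_wpDl// mulr_ge0.
have d0 : 0 < Num.min (r / 2) (e / (B * k + 1)) by rewrite lt_min !divr_gt0.
apply/nbhs_normcP; exists (Num.min (r / 2) (e / (B * k + 1))) => // w.
rewrite lt_min => /andP[/ltW w1 w2].
have wr : normc (w - z0) < rho by apply: rr; lra.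
have cGw := cG _ wr; have cGz := cG _ zr.
have cwD := onKM (@onKC _ _ (w - z0)) cD.
rewrite -(cfB HL cGw cGz) [L D * _]mulrC -(cfZ HL _ cD) -(cfB HL (onKB cGw cGz) cwD).
apply: (@le_trans _ _ (B * (k * normc (w - z0) ^+ 2))).
  apply: (cf_bd HL (onKB (onKB cGw cGz) cwD)).
    by rewrite mulr_ge0// sqr_ge0.
  move=> x Kx.
  have [|_ est] := @cauchy_taylor (fun a => G a x) z0 r M r0 M0 (fun a ar => dG x a Kx (rr a ar)).
    by move=> a ar; apply: GM => //; apply: rr; rewrite ar.
  by have := est _ w1; rewrite (dCP (HD _ Kx)) [z0 + _]addrC subrK.
rewrite expr2 mulrA mulrA ler_wpM2r ?normc_ge0//.
move: w2; rewrite ltr_pdivlMr// => w2.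
by apply: le_trans (ltW w2); rewrite mulrDr mulr1 [leLHS]mulrC lerDl normc_ge0.
Qed.

(** The kernels 1/(x - a)^m are bounded as long as a stays away from K. *)
Lemma cauchy_transform_hasd K L B (g : C -> C) z0 (d N : R) (m : nat) :
  cfunctional K L B -> 0 < d -> (forall x, K x -> d <= normc (x - z0)) ->
  onK K g -> (forall x, K x -> normc (g x) <= N) -> 0 <= N ->
  hasd (fun a => L (fun x => g x * (x - a)^-1 ^+ m.+1)) z0
    (L (fun x => g x * (m.+1%:R * (x - z0)^-1 ^+ m.+2))).
Proof.
move=> HL d0 Kd cg gN N0.
have d20 : 0 < d / 2 by rewrite divr_gt0.
have away x a : K x -> normc (a - z0) < d / 2 -> d / 2 <= normc (x - a).
  move=> Kx ad; have := normcD (x - a) (a - z0); rewrite addrA subrK.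
  by have := Kd _ Kx; lra.
have cs (a : C) : onK K (fun x => x - a) by move=> x _; exact: hasd_cvg (hasd_shift _ _).
have zd : normc (z0 - z0) < d / 2 by rewrite subrr normc0.
have ci a n : normc (a - z0) < d / 2 -> onK K (fun x => (x - a)^-1 ^+ n).
  move=> ad x Kx; apply: cvgXC; apply: cvgVC; last exact: (cs a x Kx).
  by rewrite -normc_gt0; exact: lt_le_trans (away _ _ Kx ad).
have dk x a : K x -> normc (a - z0) < d / 2 ->
    hasd (fun a => g x * (x - a)^-1 ^+ m.+1) a (g x * (m.+1%:R * (x - a)^-1 ^+ m.+2)).
  move=> Kx ad; apply: hasdZ.
  have -> : m.+1%:R * (x - a)^-1 ^+ m.+2 = m.+1%:R * (x - a)^-1 ^+ m * (x - a)^-1 ^+ 2 :> C.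
    by rewrite -mulrA -exprD addn2.
  apply: hasdX; apply: hasd_kernel.
  by rewrite -subr_eq0 -normc_gt0; exact: lt_le_trans (away _ _ Kx ad).
apply: (@param_hasd K L B (fun a x => g x * (x - a)^-1 ^+ m.+1) _ z0 (d / 2) (N * ((d / 2)^-1) ^+ m.+1) HL d20).
- by rewrite mulr_ge0// exprn_ge0// invr_ge0 ltW.
- by move=> x a Kx ad; eexists; exact: dk.
- by move=> a ad; exact: (onKM cg (ci a _ ad)).
- move=> x a Kx ad; rewrite normcMC normcX normcV; apply: ler_pM.
  + exact: normc_ge0.
  + by rewrite exprn_ge0// invr_ge0 normc_ge0.
  + exact: gN.
  + have A := away _ _ Kx ad.
    rewrite lerXn2r ?nnegrE ?invr_ge0 ?normc_ge0 ?(ltW d20)//.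
    by rewrite lef_pV2// posrE// (lt_le_trans d20).
- exact: (onKM cg (onKM (@onKC _ _ _) (ci _ _ zd))).
- by move=> x Kx; exact: dk.
Qed.

Lemma local_bound U F z0 : open U -> hol U F -> U z0 ->
  exists2 rho : R, 0 < rho & forall w, normc (w - z0) < rho ->
    U w /\ normc (F w) <= normc (F z0) + 1.
Proof.
move=> oU HF Uz0.
have := hasd_cvg (HF _ Uz0) => /cvg_normcP/(_ _ ltr01)/nbhs_normcP[d d0 Hd].
have [e e0 He] := (open_normcP U).1 oU _ Uz0.
exists (Num.min d e); first by rewrite lt_min d0.
move=> w; rewrite lt_min => /andP[wd we]; split; first exact: He.
have := normcD (F w - F z0) (F z0); rewrite subrK => /le_trans; apply.
by rewrite addrC lerD2l; apply/ltW/Hd.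
Qed.

(** Cauchy's formula exhibits F and then F' as Cauchy transforms on a circle. *)
Lemma hol_dC U F : open U -> hol U F -> hol U (dC F).
Proof.
move=> oU HF; apply/holP => z0 Uz0.
have [rho rho0 Hrho] := local_bound oU HF Uz0.
pose r := rho / 2.
have r0 : 0 < r by rewrite divr_gt0.
have inr w : normc (w - z0) <= r -> U w /\ normc (F w) <= normc (F z0) + 1.
  by move=> wr; apply: Hrho; rewrite /r in wr; lra.
have dF w : normc (w - z0) <= r -> exists l, hasd F w l by move=> /inr[/HF]; exists (dC F w).
have HL := cmean_functional z0 (ltW r0).
have cF : onK (circle z0 r) F by apply: onKhasd => w wr; apply: dF; rewrite wr.
pose g w := F w * (w - z0).
have cg : onK (circle z0 r) g.
  by apply: (onKM cF) => w _; exact: hasd_cvg (hasd_shift _ _).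
pose N := (normc (F z0) + 1) * r.
have N0 : 0 <= N by rewrite mulr_ge0 ?addr_ge0 ?normc_ge0// ltW.
have gN w : circle z0 r w -> normc (g w) <= N.
  move=> wr; rewrite normcMC wr ler_wpM2r ?(ltW r0)//.
  by have [] := inr w; rewrite ?wr.
(* The points of the circle stay away from each point inside. *)
have gap a : normc (a - z0) < r -> 0 < r - normc (a - z0) /\
    forall x, circle z0 r x -> r - normc (a - z0) <= normc (x - a).
  move=> ar; split; first by rewrite subr_gt0.
  move=> x xr; have := normcD (x - a) (a - z0); rewrite addrA subrK xr; lra.
have FE a : normc (a - z0) < r -> F a = cmean z0 r (fun x => g x * (x - a)^-1 ^+ 1).
  move=> ar; rewrite (cauchy_formula dF ar); congr cmean.
  by apply/funext => w; rewrite expr1 /g mulrA.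
have near_r a : normc (a - z0) < r -> \forall x \near a, normc (x - z0) < r.
  move=> ar; have [d0 _] := gap _ ar; have := near_normc a d0.
  by apply: filterS => x xa; have := normcD (x - a) (a - z0); rewrite addrA subrK; lra.
have dCE a : normc (a - z0) < r -> dC F a = cmean z0 r (fun x => g x * (x - a)^-1 ^+ 2).
  move=> ar; have [d0 Hd] := gap _ ar.
  have := @cauchy_transform_hasd _ _ _ g a _ N 0 HL d0 Hd cg gN N0.
  move=> /(@hasd_near _ _ F) H; rewrite (dCP (H _)).
    by congr cmean; apply/funext => x; rewrite mul1r.
  by have := near_r _ ar; apply: filterS => x /FE ->.
have zr : normc (z0 - z0) < r by rewrite subrr normc0.
have [d0 Hd] := gap _ zr.
have := @cauchy_transform_hasd _ _ _ g z0 _ N 1 HL d0 Hd cg gN N0.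
move=> /(@hasd_near _ _ (dC F)) H; eexists; apply: H.
by have := near_r _ zr; apply: filterS => x /dCE ->.
Qed.

(** Cauchy's formula also exhibits the divided difference as a Cauchy transform
   on a circle around a, including at a, where the formula gives F'(a). *)
Lemma hol_dd U F a : open U -> hol U F -> hol U (dd F a).
Proof.
move=> oU HF; apply/holP => z; case: (eqVneq z a) => [->{z}|za] Uz; last first.
  exact: hasd_dd_off (HF _ Uz) za.
have [rho rho0 Hrho] := local_bound oU HF Uz.
pose r := rho / 2.
have r0 : 0 < r by rewrite divr_gt0.
have inr w : normc (w - a) <= r -> U w /\ normc (F w) <= normc (F a) + 1.
  by move=> wr; apply: Hrho; rewrite /r in wr; lra.
have dF w : normc (w - a) <= r -> exists l, hasd F w l by move=> /inr[/HF]; exists (dC F w).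
have HL := cmean_functional a (ltW r0).
have cF : onK (circle a r) F by apply: onKhasd => w wr; apply: dF; rewrite wr.
pose N := normc (F a) + 1.
have N0 : 0 <= N by rewrite addr_ge0 ?normc_ge0.
have FN w : circle a r w -> normc (F w) <= N by move=> wr; have [] := inr w; rewrite ?wr.
have Ka x : circle a r x -> r <= normc (x - a) by move=> ->.
have := @cauchy_transform_hasd _ _ _ F a r N 0 HL r0 Ka cF FN N0.
move=> /(@hasd_near _ _ (dd F a)) H; eexists; apply: H.
have := near_normc a r0; apply: filterS => z zr.
have [->|za] := eqVneq z a.
  have [E _] := cauchy_taylor r0 N0 dF FN.
  by rewrite /dd eqxx E; congr cmean; apply/funext => w; rewrite expr1.
have ar : normc (a - a) < r by rewrite subrr normc0.
have za0 : z - a != 0 by rewrite subr_eq0.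
apply: (mulIf za0); rewrite dd_mul (cauchy_formula dF zr) (cauchy_formula dF ar).
have cs (b : C) : onK (circle a r) (fun w => w - b).
  by move=> w _; exact: hasd_cvg (hasd_shift _ _).
have nz b w : normc (b - a) < r -> circle a r w -> w - b != 0.
  by move=> br wr; rewrite subr_eq0; apply: contraTneq br => <-; rewrite -leNgt wr.
have ci b : normc (b - a) < r -> onK (circle a r) (fun w => (w - b)^-1).
  by move=> br; apply: (onKV _ (cs b)) => w; exact: nz.
have c1 := onKM cF (onKM (cs a) (ci z zr)); have c2 := onKM cF (onKM (cs a) (ci a ar)).
have c3 : onK (circle a r) (fun w => F w * (w - z)^-1 ^+ 1).
  by apply: (onKM cF) => w wr; apply: cvgXC; exact: (ci z zr).
rewrite mulrC -(cfZ HL _ c3) -(cfB HL c1 c2).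
apply: (cf_ext HL (onKM (@onKC _ _ _) c3) (onKB c1 c2)).
move=> w wr; rewrite expr1; have A := nz _ _ zr wr; have D := nz _ _ ar wr.
by field; rewrite A D.
Qed.

(** Cauchy's formula outside of a disc: v dd u a v is holomorphic there and its
   value at infinity is c - u a, while the term in u a has mean 0 because a lies
   outside the circle. *)
Lemma exterior_cauchy u (r0 rho : R) a (c : C) : 0 <= r0 -> r0 < rho -> rho < normc a ->
  (forall w, r0 < normc w -> exists l, hasd u w l) ->
  clim (@cinfty_nbhs R) u c ->
  cmean 0 rho (fun v => u v * (v / (v - a))) = c - u a.
Proof.
move=> r00 r0rho rhoa du cu.
have rho0 : 0 < rho by apply: le_lt_trans r0rho.
pose U : set C := [set w | r0 < normc w].
have oU : open U.
  apply/open_normcP => z Uz; exists (normc z - r0); first by rewrite subr_gt0.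
  by move=> w wz; have := normcD (z - w) w; rewrite subrK normcBC /U /=; lra.
have HU : hol U u by apply/holP.
have Hq := hol_dd a oU HU.
have E1 : cmean 0 rho (fun v => v * dd u a v) = c - u a.
  apply: (mean_infty rho0).
    move=> w; rewrite subr0 => wr; have Uw : U w by apply: lt_le_trans wr.
    by eexists; apply: hasdM; [exact: hasd_id|exact: Hq].
  have : clim (@cinfty_nbhs R) (fun w => (w - 0) / (w - a) * (u w - u a)) (1 * (c - u a)).
    apply: cvgMC; first exact: clim_infty_ratio.
    by apply: cvgBC; [exact: cu|exact: climC].
  rewrite mul1r; apply: clim_near; near=> w.
  have wa : w != a by near: w; exact: infty_neq.
  by rewrite ddE// subr0; ring.
rewrite -E1; have HL := cmean_functional 0 (ltW rho0).
have nz w : circle 0 rho w -> w - a != 0.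
  by rewrite /circle /= subr0 => wr; rewrite subr_eq0; apply: contraTneq rhoa => <-; rewrite wr ltxx.
have UK w : circle 0 rho w -> U w by rewrite /circle /= subr0 => wr; rewrite /U /= wr.
have cu' : onK (circle 0 rho) u by apply: onKhasd => w /UK; exact: du.
have ck : onK (circle 0 rho) (fun v => v / (v - a)).
  apply: (onKM (@onKid _ _)); apply: (onKV nz) => w _; exact: hasd_cvg (hasd_shift _ _).
have cq : onK (circle 0 rho) (dd u a) by move=> w /UK /Hq /hasd_cvg.
have cuk := onKM cu' ck; have cvq := onKM (@onKid _ _) cq.
have cak := onKM (@onKC _ _ (u a)) ck.
apply/eqP; rewrite -subr_eq0 -(cfB HL cuk cvq).
have -> : cmean 0 rho (fun w => u w * (w / (w - a)) - w * dd u a w) =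
          cmean 0 rho (fun w => u a * (w / (w - a))).
  apply: (cf_ext HL (onKB cuk cvq) cak) => w wr.
  have wa := nz _ wr; have wa' : w != a by rewrite -subr_eq0.
  by rewrite ddE//; field.
rewrite (cfZ HL _ ck) (_ : cmean 0 rho (fun v => v / (v - a)) = 0) ?mulr0//.
rewrite (@mean_value _ (fun v => v / (v - a)) 0 rho rho0) ?mul0r// => w.
rewrite subr0 => wr; eexists; apply: hasdM; first exact: hasd_id.
by apply: hasd_inv_shift; apply: contraTneq rhoa => <-; rewrite -leNgt.
Unshelve. all: by end_near. Qed.

End CauchyEstimates.

(** * Cauchy's theorem in homology form *)

Section HomologyCauchy.
Variable R : realType.
Local Notation C := (cplx R).
Implicit Types (z w a h : C) (F G : C -> C) (K U : set C) (r : R).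

Lemma compact_bound K F : compact K -> onK K F ->
  exists2 N : R, 0 <= N & forall w, K w -> normc (F w) <= N.
Proof.
move=> /compact_near_coveringP cK cF.
have [M [_ HM]] : \forall M \near +oo, K `<=` (fun x => normc (F x) <= M).
  apply: cK => x Kx; have /cvg_normcP/(_ _ ltr01) := cF _ Kx.
  move=> H; near=> y M => /=.
  have A : normc (F y - F x) < 1 by near: y.
  have := normcD (F y - F x) (F x); rewrite subrK => /le_trans; apply.
  apply: (@le_trans _ _ (1 + normc (F x))); first by rewrite lerD2r ltW.
  by near: M; apply: nbhs_pinfty_ge; rewrite num_real.
exists (`|M| + 1); first by rewrite addr_ge0.
by move=> w Kw; apply: (HM (`|M| + 1)) => //; have := ler_norm M; lra.
Unshelve. all: by end_near. Qed.

Lemma compact_away K z : compact K -> ~ K z ->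
  exists2 d : R, 0 < d & forall w, K w -> d <= normc (w - z).
Proof.
move=> cK nK.
have : open (~` K) by apply: closed_openC; apply: compact_closed => //; exact: norm_hausdorff.
move=> /open_normcP/(_ _ nK)[d d0 Hd]; exists d => // w Kw.
by rewrite leNgt; apply/negP => /Hd.
Qed.

Lemma segment_pathd z w (t : R) : pathd (fun t => z + t%:C * (w - z)) t (w - z).
Proof.
have -> : (fun t => z + t%:C * (w - z)) = (fun t : R => z + (w - z) * t%:C).
  by apply/funext => s; rewrite mulrC.
rewrite -[X in pathd _ _ X]add0r; apply: pathdD; first exact: pathd_cst.
by rewrite -[X in pathd _ _ X]mulr1; apply: pathdZ; exact: pathd_real.
Qed.

Lemma segment_FTC F G z w :
  (forall t : R, 0 <= t <= 1 -> hasd F (z + t%:C * (w - z)) (G (z + t%:C * (w - z)))) ->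
  (forall t : R, 0 <= t <= 1 -> clim (nbhs (z + t%:C * (w - z))) G (G (z + t%:C * (w - z)))) ->
  F w - F z = Ic 0 1 (fun t => G (z + t%:C * (w - z)) * (w - z)).
Proof.
move=> dF cG.
have H1 (t : R) : 0 <= t <= 1 -> pathd (F \o (fun t => z + t%:C * (w - z))) t
    (G (z + t%:C * (w - z)) * (w - z)).
  by move=> ht; exact: pathd_comp (dF _ ht) (segment_pathd z w t).
have H2 : ccont 0 1 (fun t => G (z + t%:C * (w - z)) * (w - z)).
  move=> t ht; apply: cvgMC; last exact: climC.
  exact: clim_compC (pathd_cvg (segment_pathd z w t)) (cG _ ht).
rewrite (Ic_FTC ler01 H1 H2) /= rmorph0 rmorph1 mul0r addr0 mul1r.
by rewrite [z + _]addrC subrK.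
Qed.

Lemma hasd0_segment F z w :
  (forall t : R, 0 <= t <= 1 -> hasd F (z + t%:C * (w - z)) 0) -> F w = F z.
Proof.
move=> dF; apply: subr0_eq.
have H0 (t : R) : 0 <= t <= 1 -> clim (nbhs (z + t%:C * (w - z) : C)) (fun=> 0 : C) 0.
  by move=> _; exact: climC.
by rewrite (@segment_FTC F (fun=> 0) z w dF H0) mul0r Ic_cst ?ler01// mulr0.
Qed.

Lemma dd_sym F a b : dd F a b = dd F b a.
Proof.
have [->//|ab] := eqVneq a b.
by rewrite !ddE// 1?eq_sym// -[F b - F a]opprB -[b - a]opprB invrN mulrNN.
Qed.

(** Symmetry turns the derivative in a of dd F a x into a derivative of dd F x at
   z, which off the diagonal is the divided difference of order two. *)
Lemma hasd_dd_diag F z x : hasd F z (dC F z) -> (x = z -> hasd (dd F z) z (dC (dd F z) z)) ->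
  hasd (fun a => dd F a x) z (dd (dd F z) z x).
Proof.
move=> HF Hz.
have -> : (fun a => dd F a x) = dd F x by apply/funext => a; rewrite dd_sym.
have [xz|xz] := eqVneq x z; first by rewrite xz /dd eqxx; exact: Hz.
rewrite (ddE _ xz) (ddE _ xz).
have zx : z != x by rewrite eq_sym.
have -> : ((F x - F z) / (x - z) - dd F z z) / (x - z) =
   (dC F z - 0) * (z - x)^-1 + (F z - F x) * (- 1 / (z - x) ^+ 2).
  rewrite {1}/dd eqxx; field.
  by rewrite !subr_eq0 zx xz.
apply: (@hasd_near _ (fun w => (F w - F x) * (w - x)^-1)); last first.
  apply: hasdM; last exact: hasd_inv_shift.
  by apply: hasdB; [exact: HF|exact: hasd_cst].
have n0 : 0 < normc (z - x) by rewrite normc_gt0 subr_eq0.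
have := near_normc z n0; apply: filterS => w hw; rewrite ddE//.
by apply: contraTneq hw => ->; rewrite normcBC ltxx.
Qed.

Lemma disc_segment z0 z w r (t : R) : 0 <= t <= 1 ->
  normc (z - z0) < r -> normc (w - z0) < r -> normc (z + t%:C * (w - z) - z0) < r.
Proof.
move=> /andP[t0 t1] zr wr.
have -> : z + t%:C * (w - z) - z0 = (1 - t)%:C * (z - z0) + t%:C * (w - z0).
  by rewrite rmorphB rmorph1; ring.
apply: le_lt_trans (normcD _ _) _; rewrite !normcMC !normc_real !ger0_norm ?subr_ge0//.
set m := Num.max (normc (z - z0)) (normc (w - z0)).
have mr : m < r by rewrite gt_max zr.
apply: le_lt_trans mr.
have -> : m = (1 - t) * m + t * m by ring.
by apply: lerD; apply: ler_wpM2l; rewrite ?subr_ge0// /m le_max lexx ?orbT.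
Qed.

(** For x near z0 the divided difference is a mean of the derivative over a
   segment; for x away from z0 its denominator is bounded below. This uniform
   bound is what differentiation under a functional asks for. *)
Lemma dd_bound K U F z0 : open U -> hol U F -> compact K -> K `<=` U -> U z0 ->
  exists rho M : R, [/\ 0 < rho, 0 <= M, forall a, normc (a - z0) < rho -> U a &
    forall x a, K x -> normc (a - z0) < rho -> normc (dd F a x) <= M].
Proof.
move=> oU HF cK KU Uz0.
have HdF := hol_dC oU HF.
have [r1 r10 H1] := local_bound oU HF Uz0.
have [r2 r20 H2] := local_bound oU HdF Uz0.
have [N N0 HN] := compact_bound cK (fun w Kw => hasd_cvg (HF w (KU w Kw))).
set r := Num.min r1 r2.
have r0 : 0 < r by rewrite lt_min r10.
have rr1 : r <= r1 by rewrite ge_min lexx.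
have rr2 : r <= r2 by rewrite ge_min lexx orbT.
set M1 := normc (dC F z0) + 1 in H2; set M0 := normc (F z0) + 1 in H1.
have M00 : 0 <= M0 by rewrite addr_ge0 ?normc_ge0.
have M10 : 0 <= M1 by rewrite addr_ge0 ?normc_ge0.
have r2p : 0 < r / 2 by rewrite divr_gt0.
have Q0 : 0 <= (N + M0) / (r / 2) by apply: divr_ge0; [exact: addr_ge0|exact: ltW].
exists (r / 2), (M1 + (N + M0) / (r / 2)); split=> //.
- exact: addr_ge0.
- by move=> a ar; have [] := H1 a; first by apply: lt_le_trans rr1; lra.
move=> x a Kx ar; have ar' : normc (a - z0) < r by lra.
have [xr|xr] := ltP (normc (x - z0)) r.
  apply: (@le_trans _ _ M1); last by rewrite lerDl.
  have [->|xa] := eqVneq x a.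
    by rewrite /dd eqxx; have [] := H2 a; first exact: lt_le_trans rr2.
  rewrite ddE// normcMC normcV ler_pdivrMr ?normc_gt0 ?subr_eq0//.
  have Us (t : R) : 0 <= t <= 1 -> U (a + t%:C * (x - a)).
    by move=> ht; have [] := H1 _ (lt_le_trans (disc_segment ht ar' xr) rr1).
  have dCs (t : R) : 0 <= t <= 1 -> clim (nbhs (a + t%:C * (x - a))) (dC F) (dC F (a + t%:C * (x - a))).
    by move=> /Us /HdF /hasd_cvg.
  rewrite (segment_FTC (fun t ht => HF _ (Us t ht)) dCs).
  have -> : M1 * normc (x - a) = (1 - 0) * (M1 * normc (x - a)) by rewrite subr0 mul1r.
  apply: Ic_le; first exact: ler01.
    move=> t ht; apply: cvgMC; last exact: climC.
    exact: clim_compC (pathd_cvg (segment_pathd a x t)) (dCs _ ht).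
  move=> t ht; rewrite normcMC ler_wpM2r ?normc_ge0//.
  by have [] := H2 _ (lt_le_trans (disc_segment ht ar' xr) rr2).
apply: (@le_trans _ _ ((N + M0) / (r / 2))); last by rewrite lerDr.
have xa : r / 2 <= normc (x - a).
  by have := normcD (x - a) (a - z0); rewrite addrA subrK; lra.
have xa0 : 0 < normc (x - a) by lra.
have xa1 : x != a by rewrite -subr_eq0 -normc_gt0.
rewrite (ddE _ xa1) normcMC normcV.
apply: ler_pM; rewrite ?invr_ge0 ?normc_ge0//; last by rewrite lef_pV2// posrE.
apply: le_trans (normcD _ _) _; rewrite normcNC; apply: lerD; first exact: HN.
by have [] := H1 a; first exact: lt_le_trans rr1.
Qed.

Lemma entire_vanishing h0 (F : C -> C) : (forall z, exists l, hasd F z l) ->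
  clim (@cinfty_nbhs R) F 0 -> F h0 = 0.
Proof.
move=> dF cF; rewrite -(@mean_value _ F h0 1 ltr01); last by move=> w _; exact: dF.
by apply: (mean_infty ltr01 _ cF) => w _; exact: dF.
Qed.

Section Dixon.
Variables (K U : set C) (L : (C -> C) -> C) (B : R).
Hypotheses (HL : cfunctional K L B) (cK : compact K) (oU : open U) (KU : K `<=` U).
Hypothesis closedL : forall z, ~ K z -> L (fun w => (w - z)^-1 ^+ 2) = 0.
Hypothesis windL : forall z, ~ U z -> L (fun w => (w - z)^-1) = 0.

Let W z := L (fun w => (w - z)^-1).

Let onK_inv z : ~ K z -> onK K (fun w => (w - z)^-1).
Proof.
move=> nK; apply: onKV; last by move=> w _; exact: hasd_cvg (hasd_shift _ _).
by move=> w Kw; rewrite subr_eq0; apply/eqP => wz; apply: nK; rewrite -wz.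
Qed.

Let W_hasd z : ~ K z -> hasd W z 0.
Proof.
move=> nK; have [d d0 Hd] := compact_away cK nK.
have := @cauchy_transform_hasd _ K L B (fun=> 1) z d 1 0 HL d0 Hd (@onKC _ _ _).
rewrite normc1 lexx ler01 => /(_ (fun _ _ => isT) isT).
have E1 : (fun a => L (fun x => 1 * (x - a)^-1 ^+ 1)) = W.
  by apply/funext => a; congr L; apply/funext => x; rewrite mul1r.
have E2 : (fun x => 1 * (1 * (x - z)^-1 ^+ 2)) = (fun x => (x - z)^-1 ^+ 2).
  by apply/funext => x; rewrite !mul1r.
by rewrite E1 E2 closedL.
Qed.

Let W_far : exists2 M : R, 0 <= M &
  forall z, M < normc z -> ~ K z /\ W z = 0.
Proof.
have [N N0 HN] := compact_bound cK (@onKid _ K).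
exists N => // z zN.
(* W is constant along the ray from z to infinity, where it tends to 0. *)
have far (s : R) : 1 <= s -> ~ K (s%:C * z).
  move=> s1 /HN; rewrite normcMC normc_real ger0_norm; last exact: le_trans s1.
  apply/negP; rewrite -ltNge; apply: lt_le_trans zN _.
  by rewrite ler_peMl ?normc_ge0.
have nK : ~ K z by have := far 1 (lexx _); rewrite mul1r.
split=> //; apply/eqP; rewrite -normc_eq0 eq_le normc_ge0 andbT.
apply/ler_addgt0Pl => e e0; rewrite addr0.
have z0 : 0 < normc z by apply: le_lt_trans zN.
pose s := Num.max 1 ((N + B / e) / normc z).
have s1 : 1 <= s by rewrite le_max lexx.
have s0 : 0 < s by apply: lt_le_trans s1.
have -> : W z = W (s%:C * z).
  symmetry; apply: hasd0_segment => t /andP[t0 t1].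
  have -> : z + t%:C * (s%:C * z - z) = (1 + t * (s - 1))%:C * z.
    by rewrite rmorphD rmorph1 rmorphM rmorphB rmorph1; ring.
  apply: W_hasd; apply: far; rewrite lerDl mulr_ge0// subr_ge0//.
have sz : N + B / e <= s * normc z.
  by rewrite -ler_pdivrMr// le_max lexx orbT.
have B0 := cf_ge0 HL.
have [E|Bp] := eqVneq B 0.
  apply: (@le_trans _ _ 0); last exact: ltW.
  have [d d0 Hd] := compact_away cK (far _ s1).
  have := cf_bd HL (onK_inv (far _ s1)) (M := d^-1); rewrite E mul0r; apply.
    by rewrite invr_ge0 ltW.
  by move=> w /Hd dw; rewrite normcV lef_pV2// posrE// (lt_le_trans d0).
have Bp' : 0 < B by rewrite lt_neqAle eq_sym Bp.
have Be : 0 < B / e by rewrite divr_gt0.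
have -> : e = B * (B / e)^-1 by rewrite invf_div mulrCA divff// mulr1.
apply: (cf_bd HL (onK_inv (far _ s1))); first by rewrite invr_ge0 ltW.
move=> w /HN wN; rewrite normcV.
have := normcD (s%:C * z - w) w; rewrite subrK normcMC normc_real (gtr0_norm s0) => A.
have D : B / e <= normc (w - s%:C * z) by rewrite normcBC; lra.
by rewrite lef_pV2// posrE// (lt_le_trans Be).
Qed.

(** Outside K the winding W is locally constant; V is the open set where it
   vanishes, and contains the complement of U. *)
Let V z := exists2 d : R, 0 < d & forall w, normc (w - z) < d -> ~ K w /\ W w = 0.

Let V_W z : ~ K z -> W z = 0 -> V z.
Proof.
move=> nK Wz; have [d d0 Hd] := compact_away cK nK.
have nb w : normc (w - z) < d -> ~ K w by move=> wd /Hd; rewrite leNgt wd.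
exists d => // w wd; split; first exact: nb.
rewrite -Wz; apply: hasd0_segment => t ht; apply: W_hasd; apply: nb.
by apply: disc_segment => //; rewrite subrr normc0.
Qed.

Let V_notU z : ~ U z -> V z.
Proof. by move=> nU; apply: V_W; [move/KU|exact: windL]. Qed.

Let V_near z : V z -> \forall w \near z, V w.
Proof.
move=> [d d0 Hd]; apply: filterS (near_normc z d0) => w /Hd[nK Ww]; exact: V_W.
Qed.

Section One.
Variable F : C -> C.
Hypothesis HF : hol U F.

Let onF : onK K F.
Proof. by move=> w /KU /HF /hasd_cvg. Qed.

(** The two expressions agree on the intersection of U and V, where they differ
   by the multiple F z * W z of the winding. *)
Let h z := if `[< U z >] then L (dd F z) else L (fun w => F w * (w - z)^-1 ^+ 1).

Let onFi z : ~ K z -> onK K (fun w => F w * (w - z)^-1 ^+ 1).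
Proof. by move=> nK; apply: (onKM onF) => w Kw; apply: cvgXC; exact: onK_inv. Qed.

Let hV z : V z -> h z = L (fun w => F w * (w - z)^-1 ^+ 1).
Proof.
move=> [d d0 /(_ z)[]]; first by rewrite subrr normc0.
move=> nK Wz; rewrite /h; case: asboolP => // Uz.
have cW := onKM (@onKC _ K (F z)) (onK_inv nK).
have cFi := onFi nK.
have -> : L (fun w => F w * (w - z)^-1 ^+ 1) =
    L (fun w => F w * (w - z)^-1 ^+ 1 - F z * (w - z)^-1).
  by rewrite (cfB HL cFi cW) (cfZ HL _ (onK_inv nK)) -/(W z) Wz mulr0 subr0.
apply: (cf_ext HL _ (onKB cFi cW)).
  by move=> w /KU Uw; have := hol_dd z oU HF Uw; exact: hasd_cvg.
move=> w Kw; rewrite ddE; last by apply/eqP => wz; apply: nK; rewrite -wz.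
by rewrite expr1 mulrBl.
Qed.

Let h_hasd z : exists l, hasd h z l.
Proof.
have [N N0 HN] := compact_bound cK onF.
have [Uz|nU] := pselect (U z); last first.
  have Vz := V_notU nU; have [d0 d00 /(_ z)[|nK _]] := Vz; first by rewrite subrr normc0.
  have [d dp Hd] := compact_away cK nK.
  have := @cauchy_transform_hasd _ K L B F z d N 0 HL dp Hd onF HN N0.
  move=> /(@hasd_near _ _ h) H; eexists; apply: H.
  by apply: filterS (V_near Vz) => w /hV ->.
have [rho [M [rho0 M0 HU HM]]] := dd_bound oU HF cK KU Uz.
exists (L (dd (dd F z) z)).
apply: (@hasd_near _ (fun a => L (dd F a))).
  by apply: filterS (near_normc z rho0) => w /HU Uw; rewrite /h asboolT.
apply: (@param_hasd _ K L B (fun a x => dd F a x) (dd (dd F z) z) z rho M HL rho0 M0).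
- move=> x a Kx /HU Ua.
  have -> : (fun a => dd F a x) = dd F x by apply/funext => b; rewrite dd_sym.
  by eexists; exact: (hol_dd x oU HF Ua).
- by move=> a _ w /KU Uw; have := hol_dd a oU HF Uw; exact: hasd_cvg.
- exact: HM.
- by move=> w /KU Uw; have := hol_dd z oU (hol_dd z oU HF) Uw; exact: hasd_cvg.
- by move=> x Kx; exact: (@hasd_dd_diag F z x (HF Uz) (fun _ => hol_dd z oU HF Uz)).
Qed.

Let h_infty : clim (@cinfty_nbhs R) h 0.
Proof.
have [N N0 HN] := compact_bound cK onF.
have [M M0 HM] := W_far.
have [N' N'0 HN'] := compact_bound cK (@onKid _ K).
apply/cvg_normcP => e e0.
have B0 := cf_ge0 HL.
have BN : 0 <= B * N by rewrite mulr_ge0.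
pose D := (B * N + 1) / e.
have D0 : 0 < D by rewrite divr_gt0// ltr_wpDl.
exists (M + N' + D) => z hz; rewrite subr0.
have [nK Wz] : ~ K z /\ W z = 0 by apply: HM; lra.
rewrite hV; last exact: V_W.
apply: (@le_lt_trans _ _ (B * (N * D^-1))).
  apply: (cf_bd HL (onFi nK)); first by rewrite mulr_ge0// invr_ge0 ltW.
  move=> w Kw; rewrite expr1 normcMC normcV; apply: ler_pM; rewrite ?invr_ge0 ?normc_ge0//.
    exact: HN.
  have := normcD (z - w) w; rewrite subrK normcBC; have := HN' _ Kw => A A'.
  have A2 : D <= normc (w - z) by lra.
  by rewrite lef_pV2// posrE// (lt_le_trans D0).
rewrite mulrA /D invf_div mulrA ltr_pdivrMr ?ltr_wpDl//.
by rewrite mulrC ltr_pM2l// ltrDl.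
Qed.

Lemma dixon_dd z : U z -> L (dd F z) = 0.
Proof.
move=> Uz; have := entire_vanishing z h_hasd h_infty.
by rewrite /h asboolT.
Qed.

End One.

(** Dixon's argument: the divided difference z |-> L (dd F z), continued to all
   of the plane by the Cauchy transform of F, is entire and vanishes at
   infinity. *)
Theorem homology_cauchy F : hol U F -> L F = 0.
Proof.
move=> HF.
have [[z Kz]|nK] := pselect (exists z, K z); last first.
  have c0 : onK K (fun=> 0) by exact: onKC.
  rewrite -(cf0 HL); apply: (cf_ext HL _ c0) => w Kw; by case: nK; exists w.
have Uz := KU Kz.
(* The divided difference of (w - z) F(w) at z is F. *)
pose G w := (w - z) * F w.
have HG w : U w -> hasd G w (1 * F w + (w - z) * dC F w).
  by move=> Uw; apply: hasdM; [exact: hasd_shift|exact: HF].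
have /dixon_dd/(_ _ Uz) <- : hol U G by apply/holP => w /HG; exists (1 * F w + (w - z) * dC F w).
congr L; apply/funext => w; rewrite /dd; case: eqVneq => [->|wz].
  by rewrite (dCP (HG _ Uz)) subrr mul0r addr0 mul1r.
by rewrite /G subrr mul0r subr0 mulrAC divff ?mul1r// subr_eq0.
Qed.

End Dixon.
End HomologyCauchy.

(** * Piecewise C^1 contours as functionals *)

Section Contours.
Variable R : realType.
Local Notation C := (cplx R).
Local Notation mu := (@lebesgue_measure R).
Implicit Types (F H : C -> C) (K : set C) (a b c : R) (g gam : R -> C).

Lemma cf_add K L1 L2 (B1 B2 : R) : cfunctional K L1 B1 -> cfunctional K L2 B2 ->
  cfunctional K (fun F => L1 F + L2 F) (B1 + B2).
Proof.
move=> H1 H2; split.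
- by move=> c F G cF cG; rewrite (cf_lin H1 c cF cG) (cf_lin H2 c cF cG); ring.
- by rewrite addr_ge0// ?(cf_ge0 H1) ?(cf_ge0 H2).
- move=> F M cF M0 FM; apply: le_trans (normcD _ _) _; rewrite mulrDl.
  by apply: lerD; [exact: (cf_bd H1)|exact: (cf_bd H2)].
Qed.

Lemma cf_scale K L (B : R) (k : C) : cfunctional K L B ->
  cfunctional K (fun F => k * L F) (normc k * B).
Proof.
move=> H1; split.
- by move=> c F G cF cG; rewrite (cf_lin H1 c cF cG); ring.
- by rewrite mulr_ge0// ?normc_ge0 ?(cf_ge0 H1).
- move=> F M cF M0 FM; rewrite normcMC -mulrA ler_wpM2l ?normc_ge0//.
  exact: (cf_bd H1).
Qed.

Lemma cf_zero K : cfunctional K (fun=> 0) (0 : R).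
Proof.
split=> // [c F G _ _|F M _ _ _]; first by rewrite mulr0 addr0.
by rewrite normc0 mul0r.
Qed.

(** The integrand of a contour is continuous only inside each piece, so its
   values at the breakpoints have to be discarded. *)
Definition itv_good a b (u : R -> R) :=
  measurable_fun `[a, b] u /\
  (\int[mu]_(t in `[a, b]) (u t)%:E)%E \is a fin_num.

Lemma itv_good_piece a b (u v : R -> R) :
  (forall t, a < t < b -> u t = v t) ->
  (forall t, a <= t <= b -> v s @[s --> t] --> v t) ->
  itv_good a b u /\ \int[mu]_(t in `[a, b]) u t = \int[mu]_(t in `[a, b]) v t.
Proof.
move=> uv cv; have iv := real_ccont_integrable cv.
have mv : measurable_fun `]a, b[ v.
  apply: measurable_funS (measurable_itv _) _ _; last first.
    by apply/measurable_EFinP; exact: measurable_int iv.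
  exact: subset_itv_oo_cc.
have uv' : {in `]a, b[%classic, v =1 u}.
  by move=> t; rewrite inE /= in_itv /= => /uv ->.
have mu' : measurable_fun `]a, b[ u by apply: eq_measurable_fun mv.
have E : (\int[mu]_(t in `[a, b]) (u t)%:E = \int[mu]_(t in `[a, b]) (v t)%:E)%E.
  rewrite integral_itv_bndoo; last exact/measurable_EFinP.
  rewrite [RHS]integral_itv_bndoo; last exact/measurable_EFinP.
  by apply: eq_integral => t /uv' ->.
split; last by rewrite /Rintegral E.
split; first exact: measurable_fun_itv_cc mu'.
by rewrite E; exact: integrable_fin_num.
Qed.

Lemma itv_good_glue a b c (u : R -> R) : a <= b -> b <= c ->
  itv_good a b u -> itv_good b c u ->
  itv_good a c u /\ \int[mu]_(t in `[a, c]) u t =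
    \int[mu]_(t in `[a, b]) u t + \int[mu]_(t in `[b, c]) u t.
Proof.
move=> ab bc [m1 f1] [m2 f2].
have S : `[a, c]%classic = `[a, b]%classic `|` `]b, c]%classic :> set R.
  by rewrite -itv_bndbnd_setU// bnd_simp.
have m2' : measurable_fun `]b, c] u.
  by apply: measurable_funS (measurable_itv _) _ m2; exact: subset_itv_oc_cc.
have mac : measurable_fun `[a, c] u by rewrite S; apply/measurable_funU.
have E2 : (\int[mu]_(t in `]b, c]) (u t)%:E = \int[mu]_(t in `[b, c]) (u t)%:E)%E.
  by rewrite integral_itv_obnd_cbnd//; exact/measurable_EFinP.
have E : (\int[mu]_(t in `[a, c]) (u t)%:E =
    \int[mu]_(t in `[a, b]) (u t)%:E + \int[mu]_(t in `[b, c]) (u t)%:E)%E.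
  rewrite S integral_setU//.
  - by rewrite E2.
  - by rewrite -S; exact/measurable_EFinP.
  - apply/disj_setPRL => t /=; rewrite !in_itv /= => /andP[bt _].
    by move=> /andP[_]; rewrite leNgt bt.
split; last by rewrite /Rintegral E fineD.
by split=> //; rewrite E fin_numD f1.
Qed.

Lemma C1_pathP g : C1_path g ->
  (forall t, pathd g t (path_derive g t)) /\
  (forall t, clim (nbhs t) (path_derive g) (path_derive g t)).
Proof.
move=> Hg; have [dR cR] := Hg _ (or_introl erefl); have [dI cI] := Hg _ (or_intror erefl).
split=> t.
  by apply/pathd_ReIm; split; rewrite /= derive1E; exact/derivableP.
by apply: cvgComplex; [exact: cR|exact: cI].
Qed.

Definition integrand gam F (t : R) : C := F (gam t) * path_derive gam t.

Lemma piece_cfunctional K g a b : a <= b -> C1_path g ->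
  (forall t, a <= t <= b -> K (g t)) ->
  (exists B : R, cfunctional K (fun F => Ic a b (integrand g F)) B) /\
  (forall F, onK K F -> ccont a b (integrand g F)).
Proof.
move=> ab /C1_pathP[dg cg] Kg.
have ci F : onK K F -> ccont a b (integrand g F).
  move=> cF t tab; apply: cvgMC; last exact: cg.
  exact: clim_compC (pathd_cvg (dg t)) (cF _ (Kg _ tab)).
split=> //.
(* The maximal speed along the piece bounds the norm of the functional. *)
have [x _ Hx] : exists2 x, x \in `[a, b] & forall t, t \in `[a, b] ->
    normc (path_derive g t) <= normc (path_derive g x).
  apply: (@EVT_max _ (fun t => normc (path_derive g t))) => //.
  by apply: continuous_subspaceT => t; exact: cvgNormc (cg t).
exists ((b - a) * normc (path_derive g x)); split.
- move=> c F G cF cG; rewrite -(IcZ c (ci _ cF)) -(IcD _ (ci _ cG)).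
    by apply: eq_Ic => t _; rewrite /integrand; ring.
  by apply: ccontM; [exact: ccontC|exact: ci].
- by rewrite mulr_ge0 ?normc_ge0// subr_ge0.
- move=> F M cF M0 FM; rewrite -mulrA; apply: Ic_le => //; first exact: ci.
  move=> t tab; rewrite normcMC mulrC; apply: ler_pM; rewrite ?normc_ge0//.
    by apply: Hx; rewrite in_itv.
  by apply: FM; exact: Kg.
Qed.

Definition pieces a (s : seq R) gam := forall i, (i < size s)%N ->
  exists2 g : R -> C, C1_path g & {in `[nth 0 (a :: s) i, nth 0 s i], gam =1 g}.

Lemma pieces_cons a b s gam : pieces a (b :: s) gam ->
  (exists2 g : R -> C, C1_path g & {in `[a, b], gam =1 g}) /\ pieces b s gam.
Proof. by move=> H; split; [exact: (H 0%N)|move=> i si; exact: (H i.+1)]. Qed.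

Lemma path_le_last a (s : seq R) : path <%R a s -> a <= last a s.
Proof.
elim: s a => [|b s IH] a //= /andP[ab /IH]; exact/le_trans/ltW.
Qed.

(** Inside a piece gam coincides near t with its C^1 extension g, so that they
   have the same derivative at t; at the ends of the piece they need not. *)
Lemma piece_integrandE g gam a b F t : a < t < b -> {in `[a, b], gam =1 g} ->
  C1_path g -> integrand gam F t = integrand g F t.
Proof.
move=> tab gg /C1_pathP[dg _].
have -> : integrand gam F t = F (g t) * path_derive gam t.
  rewrite /integrand gg// in_itv /=; case/andP: tab => *; by rewrite !ltW.
congr (_ * _); apply: path_deriveE; apply: pathd_near (dg t).
have : t \in `]a, b[ by rewrite in_itv.
move=> /near_in_itvoo; apply: filterS => s; rewrite in_itv /= => /andP[s1 s2].
by rewrite gg// in_itv /= !ltW.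
Qed.

Lemma pieces_compact a s gam : path <%R a s -> pieces a s gam ->
  compact (gam @` `[a, last a s]).
Proof.
elim: s a => [|b s IH] a /=.
  by move=> _ _; rewrite set_itv1 image_set1; exact: compact_set1.
move=> /andP[ab ps] /pieces_cons[[g Hg gg] Hs].
have -> : gam @` `[a, last b s] = (g @` `[a, b]) `|` (gam @` `[b, last b s]).
  have bl := path_le_last ps.
  apply/seteqP; split => [_ [t /= tab <-]|w [[t /= tab <-]|[t /= tab <-]]].
  - have [tb|bt] := leP t b; [left|right]; exists t => //=; rewrite ?in_itv /=.
    + by move: tab; rewrite in_itv /= => /andP[-> _].
    + by rewrite gg// in_itv /= tb; move: tab; rewrite in_itv /= => /andP[-> _].
    + by rewrite ltW//; move: tab; rewrite in_itv /= => /andP[_ ->].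
  - exists t; last exact: gg.
    move: tab; rewrite /= !in_itv /= => /andP[-> tb]; exact: le_trans bl.
  - exists t => //; move: tab; rewrite /= !in_itv /= => /andP[tb ->].
    by rewrite (le_trans (ltW ab)).
apply: compactU; last exact: IH.
have [dg _] := C1_pathP Hg.
apply: continuous_compact; last exact: segment_compact.
by apply: continuous_subspaceT => t; have := pathd_cvg (dg t); rewrite climE.
Qed.

Lemma complex_addE (x y z w : R) : ((x + y) +i* (z + w) : C) = (x +i* z) + (y +i* w).
Proof. by []. Qed.

(** The integral over a chain of pieces is a bounded functional of the integrand
   and is computed by primitives: both follow by gluing one piece at a time,
   which also needs the integrands to be measurable with finite integral. *)
Lemma pieces_cfunctional K a s gam : path <%R a s -> pieces a s gam ->
  (forall t, a <= t <= last a s -> K (gam t)) ->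
  [/\ exists B : R, cfunctional K (fun F => Ic a (last a s) (integrand gam F)) B,
      forall F, onK K F ->
        itv_good a (last a s) (fun t => complex.Re (integrand gam F t)) /\
        itv_good a (last a s) (fun t => complex.Im (integrand gam F t)) &
      forall H F, onK K F -> (forall w, K w -> hasd H w (F w)) ->
        Ic a (last a s) (integrand gam F) = H (gam (last a s)) - H (gam a)].
Proof.
elim: s a => [|b s IH] a /=.
  move=> _ _ Ka; split.
  - exists 0; have -> : (fun F => Ic a a (integrand gam F)) = (fun=> 0).
      by apply/funext => F; rewrite Ic_point.
    exact: cf_zero.
  - by move=> F _; split; split; rewrite set_itv1 ?integral_set1//; exact: measurable_fun_set1.
  - by move=> H F _ _; rewrite Ic_point subrr.
move=> /andP[ab ps] /pieces_cons[[g Hg gg] Hs] Ka.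
have bl := path_le_last ps.
have [] := IH b ps Hs; first by move=> t /andP[bt tl]; apply: Ka; rewrite tl (le_trans (ltW ab)).
move=> [B2 HB2] good2 prim2.
have Kg t : a <= t <= b -> K (g t).
  by move=> /[dup] tab /andP[t1 t2]; rewrite -gg ?in_itv//; apply: Ka; rewrite t1 (le_trans t2).
have [[B1 HB1] c1] := piece_cfunctional (ltW ab) Hg Kg.
have glue F : onK K F ->
   (itv_good a (last b s) (fun t => complex.Re (integrand gam F t)) /\
    itv_good a (last b s) (fun t => complex.Im (integrand gam F t))) /\
   Ic a (last b s) (integrand gam F) = Ic a b (integrand g F) + Ic b (last b s) (integrand gam F).
  move=> cF; have [gR gI] := good2 F cF; have cgF := c1 F cF.
  have [p1 e1] := @itv_good_piece a b (fun t => complex.Re (integrand gam F t))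
    (fun t => complex.Re (integrand g F t))
    (fun t tab => congr1 (@complex.Re R) (piece_integrandE F tab gg Hg)) (fun t tab => cvgRe (cgF t tab)).
  have [p2 e2] := @itv_good_piece a b (fun t => complex.Im (integrand gam F t))
    (fun t => complex.Im (integrand g F t))
    (fun t tab => congr1 (@complex.Im R) (piece_integrandE F tab gg Hg)) (fun t tab => cvgIm (cgF t tab)).
  have [q1 E1] := itv_good_glue (ltW ab) bl p1 gR.
  have [q2 E2] := itv_good_glue (ltW ab) bl p2 gI.
  split; first by split; [exact: q1|exact: q2].
  by rewrite {1}/Ic E1 E2 e1 e2 complex_addE.
split.
- exists (B1 + B2); have H := cf_add HB1 HB2.
  split.
  + move=> c F G cF cG; have cFG : onK K (fun w => c * F w + G w).
      by apply: onKD; [apply: onKM; [exact: onKC|exact: cF]|exact: cG].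
    rewrite (glue _ cF).2 (glue _ cG).2 (glue _ cFG).2; exact: (cf_lin H c cF cG).
  + exact: (cf_ge0 H).
  + by move=> F M cF M0 FM; rewrite (glue _ cF).2; exact: (cf_bd H cF M0 FM).
- by move=> F cF; have [] := glue F cF.
- move=> H F cF dH; rewrite (glue _ cF).2 (prim2 H F cF dH).
  have [dg cg] := C1_pathP Hg.
  have dHg t : a <= t <= b -> pathd (H \o g) t (integrand g F t).
    by move=> tab; apply: pathd_comp (dg t); apply: dH; exact: Kg.
  rewrite (Ic_FTC (ltW ab) dHg (c1 F cF)) /= -!gg ?in_itv /= ?lexx ?(ltW ab)//.
  by ring.
Qed.

Lemma contour_integralE gam F : contour_integral gam F = Ic 0 1 (integrand gam F).
Proof. by []. Qed.

Lemma contour_compact gam : piecewise_C1 gam -> compact (gam @` `[0, 1]).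
Proof. by move=> [s [ps /eqP sl] Hs]; rewrite -sl; exact: pieces_compact. Qed.

Lemma contour_cfunctional K gam : piecewise_C1 gam ->
  gam @` `[0, 1] `<=` K ->
  (exists B : R, cfunctional K (contour_integral gam) B) /\
  (forall H F, gam 0 = gam 1 -> onK K F -> (forall w, K w -> hasd H w (F w)) ->
        contour_integral gam F = 0).
Proof.
move=> [s [ps /eqP sl] Hs] gK.
have gK' t : 0 <= t <= last 0 s -> K (gam t).
  by rewrite sl => t01; apply: gK; exists t => //=; rewrite in_itv.
have [[B HB] _ prim] := pieces_cfunctional ps Hs gK'.
rewrite sl in HB prim; split; first by exists B.
by move=> H F g01 cF dH; rewrite contour_integralE (prim H F cF dH) g01 subrr.
Qed.

End Contours.

(** * The exterior Riemann map of a convex continuum *)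

Section ExteriorMap.
Variable R : realType.
Local Notation C := (cplx R).
Implicit Types (z w a b : C) (F u : C -> C) (r : R).

Lemma polar w : normc w = 1 -> exists2 t : R, 0 <= t <= 1 & w = ucirc t.
Proof.
case: w => x y nw; have := normc_sqr (x +i* y : C); rewrite nw expr1n /= => /esym xy.
have p0 : 0 < pi :> R := pi_gt0 R.
have x1 : -1 <= x <= 1.
  rewrite -ler_norml -(@ler_pXn2r _ 2) ?nnegrE// real_normK ?num_real// expr1n -xy.
  by rewrite lerDl sqr_ge0.
have cs : cos (acos x) = x by rewrite acosK// in_itv.
have sn : sin (acos x) = `|y|.
  rewrite sin_acos// -sqrtr_sqr; congr Num.sqrt; rewrite -xy; ring.
have a0 : 0 <= acos x by exact: acos_ge0.
have api : acos x <= pi by exact: acos_lepi.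
have [y0|y0] := leP 0 y.
  exists (acos x / (2 * pi)).
    rewrite divr_ge0 ?mulr_ge0 ?(ltW p0)//= ler_pdivrMr ?mulr_gt0// mul1r; lra.
  by rewrite ucircE mulrC divfK ?gt_eqF ?mulr_gt0// cs sn ger0_norm.
exists (1 - acos x / (2 * pi)).
  have : acos x / (2 * pi) <= 1 by rewrite ler_pdivrMr ?mulr_gt0// mul1r; lra.
  have : 0 <= acos x / (2 * pi) by rewrite divr_ge0// ?mulr_ge0 ?(ltW p0).
  by move=> *; apply/andP; split; lra.
rewrite ucircE.
have -> : 2 * pi * (1 - acos x / (2 * pi)) = - acos x + pi *+ 2.
  have H (p A : R) : p != 0 -> 2 * p * (1 - A / (2 * p)) = - A + p *+ 2.
    by move=> pn0; rewrite -mulr_natl; field.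
  by apply: H; rewrite gt_eqF.
rewrite (cosD (- acos x) (pi *+ 2)) (sinD (- acos x) (pi *+ 2)) cos2pi sin2pi !mulr1 !mulr0 subr0 addr0 cosN sinN cs sn.
by rewrite ltr0_norm// opprK.
Qed.

Lemma polar_scaled w : w != 0 -> exists2 t : R, 0 <= t <= 1 & w = (normc w)%:C * ucirc t.
Proof.
move=> w0; have n0 : ((normc w)%:C : C) != 0.
  by rewrite -normc_gt0 normc_real normr_gt0 normc_eq0.
have [|t t01 E] := @polar (w / (normc w)%:C).
  by rewrite normcMC normcV normc_real ger0_norm ?normc_ge0// divff ?normc_eq0.
by exists t => //; rewrite -E mulrC divfK.
Qed.

Definition crot (r0 r1 t0 t1 s : R) : C := (r0 + s * (r1 - r0))%:C * ucirc (t0 + s * (t1 - t0)).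

Lemma crot_clim r0 r1 t0 t1 s : clim (nbhs s) (crot r0 r1 t0 t1) (crot r0 r1 t0 t1 s).
Proof.
have lin (p q : R) : p + x * (q - p) @[x --> s] --> p + s * (q - p).
  by apply: cvgD; [exact: cvg_cst|apply: cvgM; [exact: cvg_id|exact: cvg_cst]].
apply: cvgMC; first by apply: cvgRealC; exact: lin.
exact: clim_comp (lin t0 t1) (pathd_cvg (pathd_ucirc _)).
Qed.

(** Along a path joining two points outside a disc, the modulus of a function
   cannot jump over a value that it omits there. *)
Lemma exterior_IVT F r m w0 w1 : 0 < r ->
  (forall w, r < normc w -> clim (nbhs w) F (F w)) ->
  (forall w, r < normc w -> normc (F w) != m) ->
  r < normc w0 -> r < normc w1 -> m < normc (F w0) -> m < normc (F w1).
Proof.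
move=> r0 cF Fm rw0 rw1 m0; rewrite ltNge; apply/negP => m1.
have nz w : r < normc w -> w != 0 by move=> rw; rewrite -normc_gt0; exact: lt_trans rw.
have [t0 _ E0] := polar_scaled (nz _ rw0); have [t1 _ E1] := polar_scaled (nz _ rw1).
pose p := crot (normc w0) (normc w1) t0 t1.
have p0 : p 0 = w0 by rewrite /p /crot !mul0r !addr0 -E0.
have p1 : p 1 = w1 by rewrite /p /crot !mul1r ![_ + (_ - _)]addrC !subrK -E1.
have pr s : 0 <= s <= 1 -> r < normc (p s).
  move=> /andP[s0 s1]; rewrite /p /crot normcMC normc_real normc_ucirc mulr1.
  apply: lt_le_trans (ler_norm _).
  have -> : normc w0 + s * (normc w1 - normc w0) = (1 - s) * normc w0 + s * normc w1 by ring.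
  have := @ler_wpM2l _ (1 - s) _ (Num.min (normc w0) (normc w1)) (normc w0).
  rewrite subr_ge0 ge_min lexx => /(_ s1 isT) A.
  have := @ler_wpM2l _ s s0 (Num.min (normc w0) (normc w1)) (normc w1).
  rewrite ge_min lexx orbT => /(_ isT) B.
  apply: lt_le_trans (lerD A B); rewrite -mulrDl subrK mul1r lt_min rw0 rw1//.
have [|||s s01 Es] := @IVT R (fun s => normc (F (p s))) 0 1 m.
- exact: ler01.
- apply: continuous_in_subspaceT => s; rewrite inE /= in_itv /= => /pr rs.
  have cp : clim (nbhs s) p (p s) by exact: crot_clim.
  exact: (cvgNormc (clim_compC cp (cF _ rs))).
- by rewrite p0 p1 ge_min le_max m1 (ltW m0) orbT.
have := Fm (p s) (pr s _); rewrite Es eqxx => H; suff : false by [].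
by apply: H; move: s01; rewrite in_itv.
Qed.

Lemma circle_bound F r : 0 < r -> (forall w, normc w = r -> clim (nbhs w) F (F w)) ->
  exists M : R, forall w, normc w = r -> normc (F w) <= M.
Proof.
move=> r0 cF.
have nc t : normc (cpath 0 r t) = r by have := normc_cpath (0:C) t (ltW r0); rewrite subr0.
have [x _ Hx] : exists2 x, x \in `[0, 1] & forall t, t \in `[0, 1] ->
    normc (F (cpath 0 r t)) <= normc (F (cpath 0 r x)).
  apply: (@EVT_max _ (fun t => normc (F (cpath 0 r t)))); first exact: ler01.
  apply: continuous_subspaceT => t.
  exact: cvgNormc (clim_compC (pathd_cvg (pathd_cpath 0 r t)) (cF _ (nc t))).
exists (normc (F (cpath 0 r x))) => w wr.
have [|t t01 E] := @polar_scaled w; first by rewrite -normc_gt0 wr.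
have -> : w = cpath 0 r t by rewrite /cpath add0r -wr -E.
by apply: Hx; rewrite in_itv.
Qed.

(** Bernoulli's inequality. *)
Lemma expr_bounded_le1 (x k : R) : 0 <= x -> (forall n, x ^+ n <= k) -> x <= 1.
Proof.
move=> x0 H; rewrite leNgt; apply/negP => x1.
have d0 : 0 < x - 1 by rewrite subr_gt0.
have bern n : 1 + n%:R * (x - 1) <= x ^+ n.
  elim: n => [|n IH]; first by rewrite mul0r addr0 expr0.
  rewrite exprS; apply: le_trans (ler_wpM2l x0 IH).
  have : 0 <= n%:R * (x - 1) * (x - 1) by rewrite !mulr_ge0// ltW.
  by rewrite -natr1; nra.
have := bern (Num.truncn (`|k| / (x - 1))).+1.
move=> /le_trans/(_ (H _)); apply/negP; rewrite -ltNge.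
have := truncnS_gt (`|k| / (x - 1)); rewrite ltr_pdivrMr// => A.
by have := ler_norm k; lra.
Qed.

(** Cauchy's formula for the powers of u bounds u by its boundary values, by
   taking n-th roots. *)
Lemma schwarz_exterior u (c : C) : (forall w, 1 < normc w -> exists l, hasd u w l) ->
  (forall w, 1 < normc w -> normc (u w) <= normc w) ->
  clim (@cinfty_nbhs R) u c -> normc c <= 1 ->
  forall w, 1 < normc w -> normc (u w) <= 1.
Proof.
move=> du uw cu c1 a a1; apply/ler_addgt0Pl => e e0.
pose rho := 1 + Num.min e ((normc a - 1) / 2).
have m0 : 0 < Num.min e ((normc a - 1) / 2) by rewrite lt_min e0 divr_gt0 ?subr_gt0.
have rho1 : 1 < rho by rewrite ltrDl.
have rhoe : rho <= e + 1 by rewrite /rho [e + 1]addrC lerD2l ge_min lexx.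
have rhoa : rho < normc a.
  have : Num.min e ((normc a - 1) / 2) <= (normc a - 1) / 2 by rewrite ge_min lexx orbT.
  by rewrite /rho; lra.
apply: le_trans rhoe.
have rho0 : 0 < rho by lra.
have ar0 : 0 < normc a - rho by rewrite subr_gt0.
pose k := rho / (normc a - rho).
have k0 : 0 <= k by rewrite divr_ge0// ltW.
have HL := cmean_functional 0 (ltW rho0).
have K1 w : circle 0 rho w -> normc w = rho by rewrite /circle /= subr0.
have nz w : circle 0 rho w -> w - a != 0.
  by move=> /K1 wr; rewrite subr_eq0; apply: contraTneq rhoa => <-; rewrite wr ltxx.
have ck : onK (circle 0 rho) (fun v => v / (v - a)).
  apply: (onKM (@onKid _ _)); apply: (onKV nz) => w _; exact: hasd_cvg (hasd_shift _ _).
have dun n w : 1 < normc w -> exists l, hasd (fun w => u w ^+ n) w l.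
  move=> /du[l Hl]; case: n => [|n]; eexists; last exact: hasdX Hl.
  exact: hasd_cst.
have bound n : (normc (u a) / rho) ^+ n <= k + 1.
  rewrite expr_div_n ler_pdivrMr ?exprn_gt0//.
  have cun : onK (circle 0 rho) (fun w => u w ^+ n).
    by apply: onKhasd => w /K1 wr; apply: dun; rewrite wr.
  have cun' : clim (@cinfty_nbhs R) (fun w => u w ^+ n) (c ^+ n) by apply: cvgXC; exact: cu.
  have E := exterior_cauchy ler01 rho1 rhoa (dun n) cun'.
  have A : normc (c ^+ n - u a ^+ n) <= 1 * (rho ^+ n * k).
    rewrite -E; apply: (cf_bd HL (onKM cun ck)); first by rewrite mulr_ge0// exprn_ge0// ltW.
    move=> w Kw; have wr := K1 _ Kw; rewrite normcMC normcX; apply: ler_pM; rewrite ?exprn_ge0 ?normc_ge0//.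
      rewrite lerXn2r ?nnegrE ?normc_ge0 ?(ltW rho0)//.
      by have := uw w; rewrite wr; apply.
    rewrite normcMC normcV wr /k ler_wpM2l ?(ltW rho0)//.
    have := normcD (a - w) w; rewrite subrK wr normcBC => A.
    by rewrite lef_pV2// ?posrE//; [lra|apply: lt_le_trans ar0 _; lra].
  have cn : normc (c ^+ n) <= rho ^+ n.
    rewrite normcX; apply: (@le_trans _ _ 1); first by rewrite exprn_ile1// normc_ge0.
    by rewrite exprn_ege1// ltW.
  have := normcD (u a ^+ n - c ^+ n) (c ^+ n); rewrite subrK normcX normcBC.
  by move: A; rewrite mul1r; lra.
have := expr_bounded_le1 (divr_ge0 (normc_ge0 _) (ltW rho0)) bound.
by rewrite ler_pdivrMr// mul1r.
Qed.

Lemma cmean_kernel_out r a : 0 < r -> r < normc a -> cmean 0 r (fun v => v / (v - a)) = 0.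
Proof.
move=> r0 ra; rewrite (@mean_value _ (fun v => v / (v - a)) 0 r r0) ?mul0r// => w.
rewrite subr0 => wr; eexists; apply: hasdM; first exact: hasd_id.
by apply: hasd_inv_shift; apply: contraTneq ra => <-; rewrite -leNgt.
Qed.

Section Map.
Variables (E : set C) (phi psi : C -> C).
Hypothesis cE : convex_continuum E.
Hypothesis rm : exterior_riemann_map E phi psi.
Local Notation X := (@unit_disk_exterior R).
Local Notation infty := (@cinfty_nbhs R).

Let compactE : compact E. Proof. by case: cE. Qed.

Lemma X_open : open X.
Proof.
apply/open_normcP => z Xz; exists (normc z - 1); first by rewrite subr_gt0.
by move=> w wz; have := normcD (z - w) w; rewrite subrK normcBC /unit_disk_exterior /=; lra.
Qed.

Lemma hol_phi : hol (~` E) phi.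
Proof. by case: rm => -[[/holomorphic_hol]]. Qed.

Lemma hol_psi : hol X psi.
Proof. by case: rm => -[[_ /holomorphic_hol]]. Qed.

Lemma phi_out z : ~ E z -> 1 < normc (phi z).
Proof. by case: rm => -[_ [H _] _ _] _ _ nE; apply: H; exists z. Qed.

Lemma psi_out w : 1 < normc w -> ~ E (psi w).
Proof. by case: rm => -[_ [_ H] _ _] _ _ w1; apply: H; exists w. Qed.

Lemma psi_phi z : ~ E z -> psi (phi z) = z.
Proof. by case: rm => -[_ _ H _] _ _; exact: H. Qed.

Lemma phi_psi w : 1 < normc w -> phi (psi w) = w.
Proof. by case: rm => -[_ _ _ H] _ _; exact: H. Qed.

Lemma dphi_dpsi w : 1 < normc w -> dC phi (psi w) * dC psi w = 1.
Proof.
move=> w1; have H := hasd_comp (hol_psi w1) (hol_phi (psi_out w1)).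
apply: (hasd_unique H); apply: (@hasd_near _ id); last exact: hasd_id.
have := X_open; rewrite openE => /(_ w w1); apply: filterS => v v1 /=.
by rewrite phi_psi.
Qed.

Lemma dpsi_neq0 w : 1 < normc w -> dC psi w != 0.
Proof.
by move=> /dphi_dpsi H; apply/eqP => H0; move: H; rewrite H0 mulr0 => /esym/eqP; rewrite oner_eq0.
Qed.

(** The modulus of psi omits the value m far out, since phi is bounded on the
   circle of radius m; being larger than m somewhere far out, because phi tends
   to infinity, it is larger than m everywhere far out. *)
Lemma psi_infty (M : R) : exists N : R, forall w, N < normc w -> M < normc (psi w).
Proof.
have [N0 N00 HN0] := compact_bound compactE (@onKid _ E).
pose m := Num.max M N0 + 1.
have m0 : 0 < m by rewrite ltr_wpDl// le_max N00 orbT.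
have mM : M <= m by rewrite -[M]addr0 lerD// le_max lexx.
have mN : N0 < m by rewrite ltr_pwDr// le_max lexx orbT.
have out z : N0 < normc z -> ~ E z by move=> zN /HN0; rewrite leNgt zN.
have [M1 HM1] := @circle_bound phi m m0
  (fun w wm => hasd_cvg (hol_phi (out w (eq_rect_r (fun x => N0 < x) mN wm)))).
pose r := Num.max 1 M1.
have r0 : 0 < r by rewrite lt_max ltr01.
have r1 : 1 <= r by rewrite le_max lexx.
have rM : M1 <= r by rewrite le_max lexx orbT.
have cpsi w : r < normc w -> clim (nbhs w) psi (psi w).
  by move=> rw; apply: hasd_cvg; apply: hol_psi; exact: le_lt_trans rw.
have omit w : r < normc w -> normc (psi w) != m.
  move=> rw; have w1 : 1 < normc w := le_lt_trans r1 rw.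
  apply: contraTneq rw => /HM1; rewrite phi_psi//.
  by rewrite -leNgt => /le_trans; apply.
(* Far out phi is large, so the image of a far point is a start for the path. *)
have [w0 [rw0 mw0]] : exists w0, r < normc w0 /\ m < normc (psi w0).
  have [_ H _] := rm.
  have [N HN] : infty (fun z => r < normc (phi z)) by apply: (H [set w | r < normc w]); exists r.
  pose t := Num.max (Num.max N m) N0 + 1.
  have tn : normc (t%:C : C) = t.
    by rewrite normc_real ger0_norm// addr_ge0// le_max N00 orbT.
  have tE : ~ E (t%:C : C).
    by apply: out; rewrite tn ltr_pwDr// le_max lexx orbT.
  exists (phi t%:C); rewrite psi_phi//; split; last first.
    by rewrite tn ltr_pwDr// !le_max lexx orbT.
  by apply: HN; rewrite tn ltr_pwDr// !le_max lexx.
exists r => w rw; apply: le_lt_trans mM _.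
exact: (exterior_IVT r0 cpsi omit rw0 rw mw0).
Qed.

Lemma psi_cvg_infty : psi w @[w --> infty] --> infty.
Proof. by move=> P [M HM]; have [N HN] := psi_infty M; exists N => w /HN /HM. Qed.

Definition dphi_infty : R := xget 0 [set d : R | 0 < d /\ clim infty (fun z => phi z / z) d%:C].

Lemma dphi_inftyP : 0 < dphi_infty /\ clim infty (fun z => phi z / z) dphi_infty%:C.
Proof.
case: rm => _ _ [d d0 H].
by apply: (@xgetPex _ 0 [set d : R | 0 < d /\ clim infty (fun z => phi z / z) d%:C]); exists d; split; [exact: d0|rewrite climE; exact: H].
Qed.

Let kap : C := (dphi_infty%:C)^-1.

Let dphi_infty_neq0 : (dphi_infty%:C : C) != 0.
Proof. by have [d0 _] := dphi_inftyP; rewrite -normc_gt0 normc_real gtr0_norm. Qed.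

Let kap_neq0 : kap != 0.
Proof. by rewrite invr_neq0. Qed.

Lemma near_X : \forall w \near infty, 1 < normc w.
Proof. by exists 1. Qed.

Lemma psi_ratio : clim infty (fun w => psi w / w) kap.
Proof.
have [_ H] := dphi_inftyP.
have : clim infty (fun x => (phi (psi x) / psi x)^-1) kap.
  by apply: cvgVC; [exact: dphi_infty_neq0|exact: clim_comp psi_cvg_infty H].
apply: clim_near; near=> w.
have w1 : 1 < normc w by near: w; exact: near_X.
by rewrite phi_psi// invf_div.
Unshelve. all: by end_near. Qed.

(** Cauchy's estimate for psi(v) - kap v, which is o(v), on the disc of radius
   |w| / 8 around w. *)
Lemma dpsi_lim : clim infty (dC psi) kap.
Proof.
apply/cvg_normcP => e e0; pose e' := e / 10.
have e'0 : 0 < e' by rewrite divr_gt0.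
have /cvg_normcP/(_ _ e'0)[N HN] := psi_ratio.
exists (2 * `|N| + 4) => w hw.
have N0 := normr_ge0 N; have NN := ler_norm N.
pose F v := psi v - kap * v.
have far v : normc (v - w) < normc w / 2 -> 1 < normc v /\ N < normc v.
  by move=> vw; have := normcD (w - v) v; rewrite subrK normcBC; lra.
have dF v : normc (v - w) < normc w / 2 -> exists l, hasd F v l.
  move=> /far[v1 _]; eexists; apply: hasdB; first exact: hol_psi.
  by apply: hasdZ; exact: hasd_id.
have w1 : normc (w - w) < normc w / 2 by rewrite subrr normc0; lra.
have E1 : dC F w = dC psi w - kap.
  apply: dCP; apply: hasdB; first by apply: hol_psi; have [] := far _ w1.
  by rewrite -[X in hasd _ _ X]mulr1; apply: hasdZ; exact: hasd_id.
have w0 : 0 < normc w by lra.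
have r0 : 0 < normc w / 8 by lra.
have M0 : 0 <= e' * (normc w * (9 / 8)) by rewrite !mulr_ge0// ltW.
rewrite -E1; apply: le_lt_trans (@cauchy_deriv_le _ F w (normc w / 8) (e' * (normc w * (9 / 8))) r0 M0 _ _) _.
  by move=> v vw; apply: dF; lra.
  move=> v vw; have [v1 vN] : 1 < normc v /\ N < normc v by apply: far; rewrite vw; lra.
  have v0 : v != 0 by rewrite -normc_gt0; lra.
  have -> : F v = (psi v / v - kap) * v by rewrite mulrBl divfK.
  rewrite normcMC; apply: ler_pM; rewrite ?normc_ge0//; first exact/ltW/HN.
  by have := normcD (v - w) w; rewrite subrK vw; lra.
have -> : e' * (normc w * (9 / 8)) / (normc w / 8) = e * (9 / 10).
  by rewrite /e'; field; rewrite gt_eqF.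
by rewrite gtr_pMr//; lra.
Qed.

Lemma radial_lim b : clim infty (fun w => w * dC psi w / (psi w - b)) 1.
Proof.
have H : clim infty (fun w => dC psi w * (psi w / w - b * (w - 0)^-1)^-1) (kap * (kap - b * 0)^-1).
  apply: cvgMC; first exact: dpsi_lim.
  apply: cvgVC; first by rewrite mulr0 subr0.
  apply: cvgBC; first exact: psi_ratio.
  by apply: cvgMC; [exact: climC|exact: clim_infty_inv].
move: H; rewrite mulr0 subr0 divff//; apply: clim_near; near=> w.
have w0 : w != 0 by near: w; exact: infty_neq.
have -> : psi w / w - b * (w - 0)^-1 = (psi w - b) / w by rewrite subr0 mulrBl.
by rewrite invf_div mulrCA mulrA.
Unshelve. all: by end_near. Qed.

Lemma hasd_psi_shift w b : 1 < normc w -> hasd (fun v => psi v - b) w (dC psi w - 0).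
Proof. by move=> w1; apply: hasdB; [exact: hol_psi|exact: hasd_cst]. Qed.

Lemma radial_hol b w : 1 < normc w -> psi w != b ->
  exists l, hasd (fun w => w * dC psi w / (psi w - b)) w l.
Proof.
move=> w1 wb; eexists; apply: hasdM.
  by apply: hasdM; [exact: hasd_id|exact: (hol_dC X_open hol_psi)].
by apply: hasdV; [rewrite subr_eq0|exact: hasd_psi_shift].
Qed.

(** The mean is the winding number of the level curve of index tau about b, by
   the substitution z = psi(w). *)
Lemma winding_inside b tau : 1 < tau -> E b ->
  cmean 0 tau (fun w => w * dC psi w / (psi w - b)) = 1.
Proof.
move=> t1 Eb; apply: (mean_infty _ _ (radial_lim b)); first exact: lt_trans t1.
move=> w; rewrite subr0 => wt; have w1 := lt_le_trans t1 wt.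
by apply: radial_hol => //; apply/eqP => wb; apply: (psi_out w1); rewrite wb.
Qed.

(** Since psi is injective, psi(w) - psi(w0) = (w - w0) S(w) with S
   holomorphic and without zeros. The logarithmic derivative of w - w0
   contributes nothing because w0 lies outside the circle, and that of S
   contributes its value at infinity, which is 0. *)
Lemma winding_outside w0 tau : 1 < tau -> tau < normc w0 ->
  cmean 0 tau (fun w => w * dC psi w / (psi w - psi w0)) = 0.
Proof.
move=> t1 tw0; have w01 := lt_trans t1 tw0; have t0 : 0 < tau := lt_trans ltr01 t1.
set S := dd psi w0; have HS := hol_dd w0 X_open hol_psi; rewrite -/S in HS.
have HdS := hol_dC X_open HS.
have S0 w : 1 < normc w -> S w != 0.
  move=> w1; have [->|ww0] := eqVneq w w0; first by rewrite /S /dd eqxx; exact: dpsi_neq0.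
  rewrite /S (ddE _ ww0) mulf_neq0 ?invr_neq0 ?subr_eq0//.
  by apply: contra_neq ww0 => /(congr1 phi); rewrite !phi_psi.
pose T w := w * dC S w / S w.
have NE w : 1 < normc w -> w != w0 -> w * dC psi w / (psi w - psi w0) = w / (w - w0) + T w.
  move=> w1 ww0.
  have dpE : dC psi w = S w * 1 + dC S w * (w - w0).
    have H := hasdM (HS _ w1) (hasd_shift w0 w).
    rewrite addrC [RHS]addrC; apply: dCP; rewrite addrC.
    apply: (@hasd_near _ (fun v => S v * (v - w0) + psi w0)).
      by apply: filterE => v; rewrite dd_mul subrK.
    by rewrite -[X in hasd _ _ X]addr0; apply: hasdD; [exact: H|exact: hasd_cst].
  rewrite -dd_mul -/S dpE /T mulr1; field.
  by rewrite subr_eq0 ww0 S0.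
have HT w : 1 < normc w -> exists l, hasd T w l.
  move=> w1; eexists; apply: hasdM.
    by apply: hasdM; [exact: hasd_id|exact: HdS].
  by apply: hasdV; [exact: S0|exact: HS].
have T0 : clim infty T 0.
  have : clim infty (fun w => w * dC psi w / (psi w - psi w0) - (w - 0) / (w - w0)) (1 - 1).
    by apply: cvgBC; [exact: radial_lim|exact: clim_infty_ratio].
  rewrite subrr; apply: clim_near; near=> w.
  rewrite NE; [by rewrite subr0 addrC addKr|by near: w; exact: near_X|by near: w; exact: infty_neq].
have HL := cmean_functional 0 (ltW t0).
have K1 w : circle 0 tau w -> normc w = tau by rewrite /circle /= subr0.
have ww0 w : circle 0 tau w -> w != w0.
  by move=> /K1 wt; apply: contraTneq tw0 => <-; rewrite wt ltxx.
have X1 w : circle 0 tau w -> 1 < normc w by move=> /K1 ->.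
have cT : onK (circle 0 tau) T by apply: onKhasd => w /X1; exact: HT.
have ck : onK (circle 0 tau) (fun w => w / (w - w0)).
  apply: onKhasd => w /ww0 H; eexists; apply: hasdM; first exact: hasd_id.
  exact: hasd_inv_shift.
have cN : onK (circle 0 tau) (fun w => w * dC psi w / (psi w - psi w0)).
  apply: onKhasd => w Kw; apply: radial_hol; first exact: X1.
  by apply: contra_neq (ww0 _ Kw) => /(congr1 phi); rewrite !phi_psi//; exact: X1.
rewrite (cf_ext HL cN (onKD ck cT)); last by move=> w Kw; apply: NE; [exact: X1|exact: ww0].
rewrite (cfD HL ck cT) (cmean_kernel_out t0 tw0) add0r.
apply: (mean_infty t0 _ T0) => w; rewrite subr0 => wt.
by apply: HT; exact: lt_le_trans wt.
Unshelve. all: by end_near. Qed.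

(** Otherwise w, between z and a point of E, would be in E. *)
Lemma convex_out z w (t : R) : E z -> 1 <= t -> ~ E w -> ~ E (z + t%:C * (w - z)).
Proof.
move=> Ez t1 nw Ep; apply: nw.
have t0 : 0 < t := lt_le_trans ltr01 t1.
have tc0 : (t%:C : C) != 0 by rewrite -normc_gt0 normc_real gtr0_norm.
have [_ _ _ cv] := cE.
have l0 : 0 <= ((t^-1)%:C : R[i]) by rewrite lecR invr_ge0 ltW.
have l1 : ((t^-1)%:C : R[i]) <= 1 by rewrite lecR invf_le1.
have := cv _ _ (Itv01 l0 l1) (mem_set Ep) (mem_set Ez) => /set_mem.
set y := (X in E X); suff -> : y = w by [].
have -> : y = (t^-1)%:C * (z + t%:C * (w - z)) + (1 - (t^-1)%:C) * z by [].
rewrite mulrDr mulrA -rmorphM mulVf ?gt_eqF// rmorph1; ring.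
Qed.

(** Schwarz's lemma for the ratio v / phi(z + t (psi(v) - z)), which is
   holomorphic outside the unit disc because the homothety maps the complement
   of E into itself, and which tends to 1/t at infinity. *)
Lemma starlike_growth z w (t : R) : E z -> 1 < t -> 1 < normc w ->
  normc w <= normc (phi (z + t%:C * (psi w - z))).
Proof.
move=> Ez t1 w1; have t0 : 0 < t := lt_trans ltr01 t1.
have tc0 : (t%:C : C) != 0 by rewrite -normc_gt0 normc_real gtr0_norm.
pose p v := z + t%:C * (psi v - z).
pose u v := v / phi (p v).
have pE v : 1 < normc v -> ~ E (p v).
  by move=> v1; apply: convex_out (ltW t1) (psi_out v1).
have nphi v : 1 < normc v -> 1 < normc (phi (p v)) by move=> /pE/phi_out.
have nphi0 v : 1 < normc v -> phi (p v) != 0.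
  by move=> /nphi H; rewrite -normc_gt0; exact: lt_trans H.
have du v : 1 < normc v -> exists l, hasd u v l.
  move=> v1; eexists; apply: hasdM; first exact: hasd_id.
  apply: hasdV; first exact: nphi0.
  apply: (@hasd_comp _ p phi); last exact: (hol_phi (pE _ v1)).
  apply: hasdD; first exact: hasd_cst.
  by apply: hasdZ; exact: hasd_psi_shift.
have uv v : 1 < normc v -> normc (u v) <= normc v.
  move=> v1; rewrite /u normcMC normcV ler_pdivrMr; last exact: lt_trans (nphi _ v1).
  by rewrite ler_peMr ?normc_ge0// ltW// nphi.
have pw : clim infty (fun v => p v / v) (t%:C * kap).
  have : clim infty (fun v => (z - t%:C * z) * (v - 0)^-1 + t%:C * (psi v / v)) ((z - t%:C * z) * 0 + t%:C * kap).
    apply: cvgDC; apply: cvgMC; [exact: climC|exact: clim_infty_inv|exact: climC|exact: psi_ratio].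
  rewrite mulr0 add0r; apply: clim_near; near=> v.
  by rewrite /p subr0; ring.
have p_infty : p v @[v --> infty] --> infty.
  move=> P [M HM]; have [N HN] := psi_infty (normc z + (`|M| + normc z) / t).
  exists N => v /HN Hv; apply: HM.
  have := normcD (p v - z) z; rewrite subrK => A.
  have := normcD (psi v - z) z; rewrite subrK => B.
  have := normcD (p v) (- z); rewrite normcNC.
  have -> : p v - z = t%:C * (psi v - z) by rewrite /p addrAC subrr add0r.
  rewrite normcMC normc_real gtr0_norm// => D.
  have : (`|M| + normc z) / t < normc (psi v - z) by lra.
  rewrite ltr_pdivrMr// mulrC => G; have := ler_norm M; lra.
have [_ Hphi] := dphi_inftyP.
have L : clim infty (fun v => (phi (p v) / p v)^-1 * (p v / v)^-1) (dphi_infty%:C^-1 * (t%:C * kap)^-1).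
  apply: cvgMC; apply: cvgVC.
  - exact: dphi_infty_neq0.
  - exact: clim_comp p_infty Hphi.
  - by rewrite mulf_neq0.
  - exact: pw.
have cu : clim infty u (t%:C^-1).
  have -> : (t%:C^-1 : C) = dphi_infty%:C^-1 * (t%:C * kap)^-1.
    by rewrite /kap invfM invrK mulrCA mulVf ?mulr1.
  have H : infty (fun v => 0 < normc (p v)).
    by apply: (p_infty [set w | 0 < normc w]); exists 0.
  move: L; apply: clim_near; near=> v.
  have v0 : v != 0 by near: v; exact: infty_neq.
  have v1 : 1 < normc v by near: v; exact: near_X.
  have pv0 : p v != 0 by rewrite -normc_gt0; near: v; exact: H.
  by rewrite /u !invf_div; field; rewrite pv0 nphi0.
have c1 : normc (t%:C^-1 : C) <= 1.
  by rewrite normcV normc_real gtr0_norm// invf_le1// ltW.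
have := schwarz_exterior du uv cu c1 w1.
by rewrite /u normcMC normcV ler_pdivrMr ?mul1r//; exact: lt_trans (nphi _ w1).
Unshelve. all: by end_near. Qed.

(** The complement of a set that is starlike about z is swept outwards by the
   homotheties of centre z, along which |phi| increases by Schwarz's lemma;
   differentiating this growth at t = 1 gives the inequality. *)
Lemma starlike_Re z w : E z -> 1 < normc w ->
  0 <= complex.Re (((w * dC psi w)^*)%C * (psi w - z)).
Proof.
move=> Ez w1; set l := dC phi (psi w) * (psi w - z).
have dp0 := dpsi_neq0 w1.
suff H : 0 <= complex.Re ((w^*)%C * l).
  have -> : ((w * dC psi w)^*)%C * (psi w - z) = ((normc (dC psi w)) ^+ 2)%:C * ((w^*)%C * l).
    rewrite /l -conjc_mul rmorphM /=.
    have -> : dC phi (psi w) = (dC psi w)^-1.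
      by apply: (mulIf dp0); rewrite dphi_dpsi// mulVf.
    by field.
  by rewrite Re_mul /= mul0r subr0 mulr_ge0// sqr_ge0.
pose g (t : R) := phi (z + t%:C * (psi w - z)).
have E1 : z + (1:R)%:C * (psi w - z) = psi w by rewrite mul1r addrC subrK.
have dg : pathd g 1 l.
  apply: (@pathd_comp _ phi (fun t : R => z + t%:C * (psi w - z))).
    by rewrite E1; exact: (hol_phi (psi_out w1)).
  exact: segment_pathd.
have [q [q1 ql qE]] := dg.
have g1 : g 1 = w by rewrite /g E1 phi_psi.
(* |g(s)|^2 - |w|^2 = (s - 1) k(s), and g grows in modulus for s > 1. *)
pose k (s : R) := 2 * complex.Re ((w^*)%C * q s) + normc (q s) ^+ 2 * (s - 1).
have kpos s : 1 < s -> 0 <= k s.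
  move=> s1; have := starlike_growth Ez s1 w1; rewrite -/(g s) => G.
  have gE : g s = w + q s * (s - 1)%:C by rewrite rmorphB -qE g1 addrC subrK.
  have : 0 <= normc (g s) ^+ 2 - normc w ^+ 2.
    by rewrite subr_ge0 lerXn2r ?nnegrE ?normc_ge0.
  have -> : normc (g s) ^+ 2 - normc w ^+ 2 = k s * (s - 1).
    rewrite gE /k !normc_sqr !(Re_add, Im_add) !(Re_mul, Im_mul).
    by case: (w) (q s) => x y [a b] /=; ring.
  by rewrite pmulr_lge0// subr_gt0.
have kl : k s @[s --> (1:R)] --> 2 * complex.Re ((w^*)%C * l) + normc l ^+ 2 * (1 - 1).
  apply: cvgD.
    apply: cvgM; first exact: cvg_cst.
    have H : clim (nbhs (1:R)) (fun s => (w^*)%C * q s) ((w^*)%C * l).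
      by apply: cvgMC; [exact: climC|exact: q1].
    exact: (cvgRe H).
  apply: cvgM; last by apply: cvgB; [exact: cvg_id|exact: cvg_cst].
  rewrite expr2; under eq_cvg do rewrite expr2.
  by apply: cvgM; exact: (cvgNormc q1).
rewrite subrr mulr0 addr0 in kl.
rewrite leNgt; apply/negP => neg.
have neg' : 0 < - (2 * complex.Re ((w^*)%C * l)) by lra.
move/cvgrPdist_lt : kl => /(_ _ neg') /real_nbhsP[d d0 /(_ (1 + d / 2))].
rewrite addrAC subrr add0r gtr0_norm ?divr_gt0// ltr_pdivrMr// ltr_pMr// ltr1n => /(_ isT).
have : 0 <= k (1 + d / 2) by apply: kpos; rewrite ltrDl divr_gt0.
by rewrite distrC; have := ler_norm (k (1 + d / 2) - 2 * complex.Re ((w^*)%C * l)); lra.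
Qed.

End Map.
End ExteriorMap.

(** * Deformation of a contour to a level curve *)

Section Deformation.
Variable R : realType.
Local Notation C := (cplx R).
Implicit Types (z w a b : C) (F H : C -> C) (K U : set C) (Gam : seq (R -> C)).

Lemma twopiiE : 2 * pi%:C * 'i = twopii R.
Proof. by rewrite /twopii rmorphM /= rmorph_nat. Qed.

Lemma system_image_cons g Gam :
  system_image (g :: Gam) = (g @` `[0, 1]) `|` system_image Gam.
Proof.
apply/seteqP; split => [w [h /= hG hw]|w [gw|[h /= hG hw]]].
- by move: hG; rewrite inE => /orP[/eqP <-|hG]; [left|right; exists h].
- by exists g => //=; rewrite inE eqxx.
- by exists h => //=; rewrite inE hG orbT.
Qed.

Lemma system_compact Gam : (forall g, g \in Gam -> piecewise_C1 g) -> compact (system_image Gam).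
Proof.
elim: Gam => [|g Gam IH] HG.
  have -> : system_image ([::] : seq (R -> C)) = set0 by apply/seteqP; split => // w [].
  exact: compact0.
rewrite system_image_cons; apply: compactU.
  by apply: contour_compact; apply: HG; rewrite inE eqxx.
by apply: IH => h hG; apply: HG; rewrite inE hG orbT.
Qed.

Lemma system_cfunctional K Gam :
  (forall g, g \in Gam -> piecewise_C1 g /\ g 0 = g 1) -> system_image Gam `<=` K ->
  (exists B : R, cfunctional K (system_integral Gam) B) /\
  (forall H F, onK K F -> (forall w, K w -> hasd H w (F w)) -> system_integral Gam F = 0).
Proof.
elim: Gam => [|g Gam IH] HG.
  move=> _; split; last by move=> H F _ _; rewrite /system_integral big_nil.
  exists 0; have -> : system_integral ([::] : seq (R -> C)) = (fun=> 0).
    by apply/funext => F; rewrite /system_integral big_nil.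
  exact: cf_zero.
rewrite system_image_cons => GK.
have [pg cg] := HG g (mem_head _ _).
have [[B1 H1] p1] := contour_cfunctional pg (fun w gw => GK w (or_introl gw)).
have [|[B2 H2] p2] := IH _ (fun w gw => GK w (or_intror gw)).
  by move=> h hG; apply: HG; rewrite inE hG orbT.
have E : system_integral (g :: Gam) = (fun F => contour_integral g F + system_integral Gam F).
  by apply/funext => F; rewrite /system_integral big_cons.
rewrite E; split; first by exists (B1 + B2); exact: cf_add.
by move=> H F cF dH; rewrite (p1 H F cg cF dH) (p2 H F cF dH) addr0.
Qed.

Section Level.
Variables (E : set C) (phi psi : C -> C) (tau : R).
Hypothesis cE : convex_continuum E.
Hypothesis rm : exterior_riemann_map E phi psi.
Hypothesis tau1 : 1 < tau.

Definition level_curve (t : R) : C := psi (cpath 0 tau t).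

Let tau0 : 0 < tau := lt_trans ltr01 tau1.

Lemma normc_cpath0 t : normc (cpath 0 tau t) = tau.
Proof. by have := normc_cpath (0:C) t (ltW tau0); rewrite subr0. Qed.

Let cp1 t : 1 < normc (cpath 0 tau t).
Proof. by rewrite normc_cpath0. Qed.

Let dl t : C := dC psi (cpath 0 tau t) * (twopii R * (cpath 0 tau t - 0)).

Lemma pathd_level t : pathd level_curve t (dl t).
Proof. exact: pathd_comp (hol_psi rm (cp1 t)) (pathd_cpath 0 tau t). Qed.

Let dl_clim t : clim (nbhs t) dl (dl t).
Proof.
have cc := pathd_cvg (pathd_cpath 0 tau t).
apply: cvgMC.
  by apply: (clim_compC cc); exact: hasd_cvg (hol_dC (@X_open R) (hol_psi rm) (cp1 t)).
by apply: cvgMC; [exact: climC|apply: cvgBC; [exact: cc|exact: climC]].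
Qed.

Lemma level_piecewise : piecewise_C1 level_curve.
Proof.
exists [:: 1]; first by split => //=; rewrite ltr01.
move=> [|//] _; exists level_curve; last by [].
move=> p [->|->]; split.
- by move=> t; have [[]] := (pathd_ReIm _ _ _).1 (pathd_level t).
- have -> : derive1 (@complex.Re R \o level_curve) = (fun t => complex.Re (dl t)).
    apply/funext => t; have [[_ H] _] := (pathd_ReIm _ _ _).1 (pathd_level t).
    by rewrite derive1E.
  by move=> t; exact: (cvgRe (@dl_clim t)).
- by move=> t; have [_ []] := (pathd_ReIm _ _ _).1 (pathd_level t).
- have -> : derive1 (@complex.Im R \o level_curve) = (fun t => complex.Im (dl t)).
    apply/funext => t; have [_ [_ H]] := (pathd_ReIm _ _ _).1 (pathd_level t).
    by rewrite derive1E.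
  by move=> t; exact: (cvgIm (@dl_clim t)).
Qed.

Lemma level_closed : level_curve 0 = level_curve 1.
Proof. by rewrite /level_curve cpath_closed. Qed.

Lemma onK_level F : (forall w, normc w = tau -> clim (nbhs (psi w)) F (F (psi w))) ->
  onK (circle 0 tau) (fun w => F (psi w) * (w * dC psi w)).
Proof.
move=> cF w; rewrite /circle /= subr0 => wt; have w1 : 1 < normc w by rewrite wt.
apply: cvgMC.
  exact: clim_compC (hasd_cvg (hol_psi rm w1)) (cF _ wt).
apply: cvgMC; first exact: clim_id.
exact: hasd_cvg (hol_dC (@X_open R) (hol_psi rm) w1).
Qed.

Lemma level_integral F : (forall w, normc w = tau -> clim (nbhs (psi w)) F (F (psi w))) ->
  contour_integral level_curve F =
  twopii R * cmean 0 tau (fun w => F (psi w) * (w * dC psi w)).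
Proof.
move=> cF; have HL := cmean_functional 0 (ltW tau0).
rewrite -(cfZ HL _ (onK_level cF)) contour_integralE /cmean; apply: eq_Ic => t _.
rewrite /integrand (path_deriveE (pathd_level t)) /dl subr0 /level_curve.
by ring.
Qed.

(** The level curve and Gam wind equally often about each point outside the
   region where F is holomorphic, so that their difference is homologous to 0
   in that region. *)
Lemma contour_deformation (Omega S : set C) Gam F :
  open Omega -> level_set psi tau `<=` Omega -> closed S -> S `<=` E ->
  (forall g, g \in Gam -> piecewise_C1 g /\ g 0 = g 1) ->
  system_image Gam `<=` Omega ->
  (forall z, ~ Omega z -> winding_number Gam z = 0) ->
  (forall z, S z -> ~ system_image Gam z /\ winding_number Gam z = 1) ->
  hol (Omega `\` S) F ->
  (twopii R)^-1 * system_integral Gam F = cmean 0 tau (fun w => F (psi w) * (w * dC psi w)).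
Proof.
move=> oO lO cS SE HG GO w0 w1 HF.
have tpi0 := twopii_neq0 R.
have lev t : Omega (level_curve t) /\ ~ S (level_curve t).
  split; last by move=> /SE; exact: (psi_out rm (cp1 t)).
  apply: lO => -[w /= tw]; have w1' : 1 < normc w := lt_trans tau1 tw.
  move=> /(congr1 phi); rewrite (phi_psi rm w1') (phi_psi rm (cp1 t)) => wE.
  by move: tw; rewrite wE normc_cpath0 ltxx.
have polar_level w : normc w = tau -> exists t, w = cpath 0 tau t.
  move=> wt; have [|t _ Ew] := @polar_scaled R w; first by rewrite -normc_gt0 wt.
  by exists t; rewrite /cpath add0r -wt.
set U := Omega `\` S.
have oU : open U by rewrite /U setDE; apply: openI => //; exact: closed_openC.
pose K := system_image (level_curve :: Gam).
have HG' g : g \in level_curve :: Gam -> piecewise_C1 g /\ g 0 = g 1.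
  rewrite inE => /orP[/eqP ->|]; last exact: HG.
  by split; [exact: level_piecewise|exact: level_closed].
have cK : compact K by apply: system_compact => g /HG'[].
have GK : system_image Gam `<=` K by rewrite /K system_image_cons; right.
have lK t : 0 <= t <= 1 -> K (level_curve t).
  by move=> t01; rewrite /K system_image_cons; left; exists t => //=; rewrite in_itv.
have KU : K `<=` U.
  rewrite /K system_image_cons => w [[t _ <-]|Gw]; first by have [? ?] := lev t.
  by split; [exact: GO|move=> /w1[]].
have [[B1 H1] p1] := system_cfunctional HG GK.
have lKs : level_curve @` `[0, 1] `<=` K.
  by move=> w [t /= t01 <-]; apply: lK; move: t01; rewrite in_itv.
have [[B2 H2] p2] := contour_cfunctional level_piecewise lKs.
pose L F := system_integral Gam F + (-1) * contour_integral level_curve F.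
have HL : cfunctional K L (B1 + normc (-1 : C) * B2) by exact: (cf_add H1 (cf_scale (-1) H2)).
have cinv z : ~ K z -> forall w, K w -> w != z by move=> nK w Kw; apply/eqP => wz; apply: nK; rewrite -wz.
(* 1/(w - z)^2 has a primitive away from z. *)
have closedL z : ~ K z -> L (fun w => (w - z)^-1 ^+ 2) = 0.
  move=> /cinv nK.
  have dH w : K w -> hasd (fun w => - (w - z)^-1) w ((w - z)^-1 ^+ 2).
    move=> /nK wz; have -> : (w - z)^-1 ^+ 2 = - (- 1 / (w - z) ^+ 2) by rewrite mulN1r opprK exprVn.
    by apply: hasdN; exact: hasd_inv_shift.
  have cF : onK K (fun w => (w - z)^-1 ^+ 2).
    by apply: onKhasd => w /nK wz; eexists; apply: hasdX; exact: hasd_inv_shift.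
  by rewrite /L (p1 _ _ cF dH) (p2 _ _ level_closed cF dH) mulr0 addr0.
have wind_level z : ~ (exists t, level_curve t = z) -> contour_integral level_curve (fun w => (w - z)^-1) =
    twopii R * cmean 0 tau (fun w => w * dC psi w / (psi w - z)).
  move=> nz; rewrite level_integral; first by congr (_ * cmean _ _ _); apply/funext => w; rewrite mulrC.
  move=> w wt; apply: cvgVC; last exact: hasd_cvg (hasd_shift _ _).
  rewrite subr_eq0; apply/eqP => wz; apply: nz.
  by have [t wE] := polar_level _ wt; exists t; rewrite /level_curve -wE.
have winding_system z c : winding_number Gam z = c -> system_integral Gam (fun w => (w - z)^-1) = twopii R * c.
  by rewrite /winding_number twopiiE => <-; rewrite mulVKf.
have windL z : ~ U z -> L (fun w => (w - z)^-1) = 0.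
  move=> nU; have nl : ~ (exists t, level_curve t = z) by move=> [t tz]; apply: nU; rewrite -tz; have [] := lev t.
  rewrite /L (wind_level _ nl).
  have [Oz|nO] := pselect (Omega z); last first.
    rewrite (winding_system z 0 (w0 _ nO)) mulr0 add0r.
    have [w tw wz] : (psi @` [set w | tau < normc w]) z.
      by apply: contrapT => H; apply: nO; apply: lO.
    by rewrite -wz (winding_outside cE rm tau1 tw) !mulr0.
  have Sz : S z by apply: contrapT => nS; apply: nU.
  rewrite (winding_system z 1 (w1 _ Sz).2) (winding_inside cE rm tau1 (SE _ Sz)).
  by rewrite mulN1r subrr.
have := homology_cauchy HL cK oU KU closedL windL HF.
rewrite /L mulN1r => /subr0_eq ->; rewrite level_integral ?mulKf//.
move=> w wt; have [t wE] := polar_level _ wt; have [? ?] := lev t.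
by rewrite wE; apply: hasd_cvg (HF _ _).
Qed.

End Level.

End Deformation.

(** * Decay from domination by a positive real part *)

Section Decay.
Variable R : realType.
Local Notation C := (cplx R).
Local Notation infty := (@cinfty_nbhs R).
Local Notation mu := (@lebesgue_measure R).
Implicit Types (z w : C) (rho tau : R) (q p : C -> C).

Lemma Ic_conj (a b : R) (u : R -> C) : ccont a b u ->
  Ic a b (fun t => (u t)^*%C) = ((Ic a b u)^*)%C.
Proof.
move=> cu; apply: complex_ext => /=.
  by apply: eq_Rintegral => t _; case: (u t).
rewrite -[RHS]mulN1r -RintegralZl//; last exact: ccont_Im.
by apply: eq_Rintegral => t _; rewrite mulN1r; case: (u t).
Qed.

(** This kernel is the part of order at most -(n+1) in w of the exterior Cauchy
   kernel w / (w - v) = sum over j >= 0 of (v / w)^j. *)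
Definition decay_kernel (n : nat) w v := (v / w) ^+ n.+1 * (w / (w - v)).

Lemma hasd_decay_kernel n w v : w != 0 -> v != w -> exists l, hasd (decay_kernel n w) v l.
Proof.
move=> w0 vw; eexists; apply: hasdM.
  by apply: hasdX; apply: hasdM; [exact: hasd_id|exact: hasd_cst].
apply: hasdM; first exact: hasd_cst.
apply: hasdV; first by rewrite subr_eq0 eq_sym.
by apply: hasdB; [exact: hasd_cst|exact: hasd_id].
Qed.

(** On the circle of radius rho the conjugate of the kernel is the boundary
   value of a function holomorphic outside it. *)
Lemma conj_decay_kernel n w v rho : w != 0 -> v != 0 -> normc v = rho -> v != w ->
  ((decay_kernel n w v)^*)%C =
  (((rho ^+ 2)%:C / (w^*)%C) * (v - 0)^-1) ^+ n.+1 * ((v - 0) / (v - (rho ^+ 2)%:C / (w^*)%C)).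
Proof.
move=> w0 v0 vr vw.
have cw0 : (w^*)%C != 0 by rewrite -normc_gt0 normc_conj normc_gt0.
have cv : (v^*)%C = (rho ^+ 2)%:C / v by rewrite -vr -conjc_mul mulfK.
have cvw : (w^*)%C - (v^*)%C != 0.
  by rewrite -rmorphB -normc_gt0 normc_conj normc_gt0 subr_eq0 eq_sym.
move: ((rho ^+ 2)%:C) cv => r2 cv.
rewrite subr0 /decay_kernel rmorphM rmorphXn !rmorphM /= !fmorphV /= rmorphB /=.
have -> : (v^*)%C / (w^*)%C = r2 / (w^*)%C / v by rewrite cv mulrAC.
congr (_ * _); rewrite cv in cvw *.
move: (w^*)%C cw0 cvw => cw cw0 cvw.
have cvw' : v * cw - r2 != 0.
  by apply: contra_neq cvw => H; apply: (mulIf v0); rewrite mul0r mulrBl divfK// mulrC.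
have cvw'' : cw * v - r2 != 0 by rewrite mulrC.
by field; rewrite ?v0 ?cw0 ?cvw' ?cvw''.
Qed.

Lemma normc_decay_kernel n w v rho tau : 0 < rho -> rho < tau -> normc v = rho -> normc w = tau ->
  normc (decay_kernel n w v) <= (rho / tau) ^+ n.+1 * (tau / (tau - rho)).
Proof.
move=> r0 rt vr wt; have t0 : 0 < tau := lt_trans r0 rt.
rewrite /decay_kernel !normcMC normcX !normcMC !normcV vr wt.
rewrite ler_wpM2l ?exprn_ge0 ?divr_ge0 ?(ltW r0) ?(ltW t0)// ler_wpM2l ?(ltW t0)//.
have := normcD (w - v) v; rewrite subrK vr wt => A.
by rewrite lef_pV2// ?posrE ?subr_gt0//; lra.
Qed.

(** A function whose Laurent series at infinity starts at order n.+1 is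
   recovered by a decaying kernel, and adding to it a constant and the
   conjugate of a function bounded at infinity does not change the integral. *)
Lemma decay_representation n q1 q2 (c0 c2 : C) w rho : 1 < rho -> rho < normc w ->
  (forall v, 1 < normc v -> exists l, hasd q1 v l) ->
  (forall v, 1 < normc v -> exists l, hasd q2 v l) ->
  clim infty (fun v => v ^+ n * q1 v) 0 -> clim infty q2 c2 ->
  q1 w = Ic 0 1 (fun t => decay_kernel n w (cpath 0 rho t) *
     (q1 (cpath 0 rho t) + (q2 (cpath 0 rho t))^*%C + c0)).
Proof.
move=> r1 rw d1 d2 l1 l2.
have r0 : 0 < rho := lt_trans ltr01 r1.
have w0 : w != 0 by rewrite -normc_gt0; exact: lt_trans rw.
have HL := cmean_functional 0 (ltW r0).
have nc t : normc (cpath 0 rho t) = rho by have := normc_cpath (0:C) t (ltW r0); rewrite subr0.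
have K1 v : circle 0 rho v -> normc v = rho by rewrite /circle /= subr0.
have vw v : normc v = rho -> v != w by move=> vr; apply: contraTneq rw => <-; rewrite vr ltxx.
have v0 v : normc v = rho -> v != 0 by move=> vr; rewrite -normc_gt0 vr.
have cK : onK (circle 0 rho) (decay_kernel n w).
  by apply: onKhasd => v /K1 vr; apply: hasd_decay_kernel => //; exact: vw.
have cq1 : onK (circle 0 rho) q1 by apply: onKhasd => v /K1 vr; apply: d1; rewrite vr.
have cq2 : onK (circle 0 rho) q2 by apply: onKhasd => v /K1 vr; apply: d2; rewrite vr.
have cq2c : onK (circle 0 rho) (fun v => (q2 v)^*%C).
  by move=> v Kv; apply: cvgConj; exact: cq2.
have cKc := onKM cK (@onKC _ (circle 0 rho) c0).
have cK1 := onKM cK cq1; have cK2 := onKM cK cq2c.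
have -> : Ic 0 1 (fun t => decay_kernel n w (cpath 0 rho t) *
     (q1 (cpath 0 rho t) + (q2 (cpath 0 rho t))^*%C + c0)) =
   cmean 0 rho (fun v => decay_kernel n w v * q1 v) +
   cmean 0 rho (fun v => decay_kernel n w v * (q2 v)^*%C) +
   cmean 0 rho (fun v => decay_kernel n w v * c0).
  rewrite -(cfD HL cK1 cK2) -(cfD HL (onKD cK1 cK2) cKc).
  by apply: eq_Ic => t _; rewrite !mulrDr.
have -> : cmean 0 rho (fun v => decay_kernel n w v * c0) = 0.
  rewrite (@mean_value _ (fun v => decay_kernel n w v * c0) 0 rho r0).
    by rewrite /decay_kernel mul0r exprS !mul0r.
  move=> v; rewrite subr0 => vr; have [|l Hl] := @hasd_decay_kernel n w v w0.
    by apply: contraTneq rw => <-; rewrite -leNgt.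
  by eexists; apply: hasdM; [exact: Hl|exact: hasd_cst].
(* On the circle the conjugate of this integrand is K2 q2, which vanishes at infinity. *)
have -> : cmean 0 rho (fun v => decay_kernel n w v * (q2 v)^*%C) = 0.
  pose K2 v := (((rho ^+ 2)%:C / (w^*)%C) * (v - 0)^-1) ^+ n.+1 * ((v - 0) / (v - (rho ^+ 2)%:C / (w^*)%C)).
  have cut : normc ((rho ^+ 2)%:C / (w^*)%C) < rho.
    rewrite normcMC normcV normc_conj normc_real ger0_norm ?sqr_ge0//.
    by rewrite ltr_pdivrMr ?(lt_trans r0)// expr2 ltr_pM2l.
  have dK2 v : rho <= normc v -> exists l, hasd K2 v l.
    move=> vr; have vz : v != 0 by rewrite -normc_gt0; exact: lt_le_trans vr.
    eexists; apply: hasdM.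
      by apply: hasdX; apply: hasdM; [exact: hasd_cst|exact: hasd_inv_shift].
    apply: hasdM; first exact: hasd_shift.
    by apply: hasd_inv_shift; apply: contraTneq vr => ->; rewrite -ltNge.
  have dK2q v : rho <= normc v -> exists l, hasd (fun v => K2 v * q2 v) v l.
    move=> vr; have [l Hl] := dK2 _ vr; have [m Hm] := d2 v (lt_le_trans r1 vr).
    by eexists; exact: hasdM Hl Hm.
  have lim : clim infty (fun v => K2 v * q2 v) (((rho ^+ 2)%:C / (w^*)%C * 0) ^+ n.+1 * 1 * c2).
    apply: cvgMC; last exact: l2.
    apply: cvgMC; last exact: clim_infty_ratio.
    by apply: cvgXC; apply: cvgMC; [exact: climC|exact: clim_infty_inv].
  have E0 : cmean 0 rho (fun v => K2 v * q2 v) = 0.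
    rewrite (mean_infty r0 _ lim); first by rewrite mulr0 exprS !mul0r.
    by move=> v; rewrite subr0; exact: dK2q.
  have cK2q : onK (circle 0 rho) (fun v => K2 v * q2 v).
    by apply: onKhasd => v /K1 vr; apply: dK2q; rewrite vr.
  have -> : cmean 0 rho (fun v => decay_kernel n w v * (q2 v)^*%C) =
      ((cmean 0 rho (fun v => K2 v * q2 v))^*)%C.
    rewrite /cmean -(Ic_conj (onK_cpath (ltW r0) cK2q)); apply: eq_Ic => t _.
    rewrite rmorphM /= /K2 -(conj_decay_kernel n w0 (v0 _ (nc t)) (nc t) (vw _ (nc t))).
    by rewrite conjcK.
  by rewrite E0 rmorph0.
rewrite !addr0.
have dv v : 1 < normc v -> exists l, hasd (fun v => v ^+ n * q1 v) v l.
  move=> /d1[l Hl]; case: n {cK cKc cK1 cK2 l1} => [|n]; eexists; apply: hasdM; try exact: Hl.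
    exact: hasd_cst.
  by apply: hasdX; exact: hasd_id.
have EC := exterior_cauchy ler01 r1 rw dv l1.
rewrite sub0r in EC.
have wn0 : w ^+ n != 0 by rewrite expf_neq0.
have ck : onK (circle 0 rho) (fun v => v ^+ n * q1 v * (v / (v - w))).
  apply: onKM; first by apply: onKhasd => v /K1 vr; apply: dv; rewrite vr.
  apply: onKhasd => v /K1 vr; eexists; apply: hasdM; first exact: hasd_id.
  by apply: hasd_inv_shift; exact: vw.
have -> : cmean 0 rho (fun v => decay_kernel n w v * q1 v) =
    cmean 0 rho (fun v => - (w ^+ n)^-1 * (v ^+ n * q1 v * (v / (v - w)))).
  apply: eq_Ic => t _; rewrite /decay_kernel.
  move: (cpath 0 rho t) (vw _ (nc t)) => v vw'.
  have A : v - w != 0 by rewrite subr_eq0.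
  have B : w - v != 0 by rewrite subr_eq0 eq_sym.
  by rewrite expr_div_n !exprS; field; rewrite A B w0 wn0.
by rewrite (cfZ HL _ ck) EC mulrNN mulrA mulVf// mul1r.
Qed.

(** The kernel is bounded by k on the circle of radius rho, and the mean of the
   dominating real part is its value P at infinity. *)
Lemma decay_bound_lt n q1 q2 p (c0 c2 : C) (P : R) w tau rho : 1 < rho -> rho < tau -> normc w = tau ->
  (forall v, 1 < normc v -> exists l, hasd q1 v l) ->
  (forall v, 1 < normc v -> exists l, hasd q2 v l) ->
  (forall v, 1 < normc v -> exists l, hasd p v l) ->
  clim infty (fun v => v ^+ n * q1 v) 0 -> clim infty q2 c2 -> clim infty p P%:C ->
  (forall v, 1 < normc v -> normc (q1 v + (q2 v)^*%C + c0) <= complex.Re (p v)) ->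
  normc (q1 w) <= (rho / tau) ^+ n.+1 * (tau / (tau - rho)) * P.
Proof.
move=> r1 rt wt d1 d2 dp l1 l2 lp dom.
have r0 : 0 < rho := lt_trans ltr01 r1.
have t0 : 0 < tau := lt_trans r0 rt.
have rw : rho < normc w by rewrite wt.
have w0 : w != 0 by rewrite -normc_gt0; exact: lt_trans rw.
have nc t : normc (cpath 0 rho t) = rho by have := normc_cpath (0:C) t (ltW r0); rewrite subr0.
have vw v : normc v = rho -> v != w by move=> vr; apply: contraTneq rw => <-; rewrite vr ltxx.
rewrite (decay_representation c0 r1 rw d1 d2 l1 l2).
set k := (rho / tau) ^+ n.+1 * (tau / (tau - rho)).
have k0 : 0 <= k.
  by rewrite mulr_ge0 ?exprn_ge0 ?divr_ge0 ?subr_ge0 ?(ltW r0) ?(ltW t0) ?(ltW rt).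
have cp : ccont 0 1 (fun t => p (cpath 0 rho t)).
  apply: (onK_cpath (ltW r0)); apply: onKhasd => v; rewrite /circle /= subr0 => vr.
  by apply: dp; rewrite vr.
have iRe := ccont_Re cp.
have EP : \int[mu]_(t in `[0, 1]) complex.Re (p (cpath 0 rho t)) = P.
  have := @mean_infty _ p 0 rho P%:C r0; rewrite /cmean => H.
  have {H} : Ic 0 1 (fun t => p (cpath 0 rho t)) = P%:C.
    by apply: H => // v; rewrite subr0 => vr; apply: dp; exact: lt_le_trans vr.
  by move=> /(congr1 (@complex.Re R)).
have -> : k * P = \int[mu]_(t in `[0, 1]) (k * complex.Re (p (cpath 0 rho t))).
  by rewrite RintegralZl// EP.
apply: Ic_norm_le.
- move=> t _; have cc := pathd_cvg (pathd_cpath 0 rho t).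
  apply: cvgMC.
    have [l /hasd_cvg H] := @hasd_decay_kernel n w _ w0 (vw _ (nc t)).
    exact: clim_compC cc H.
  have t1 : 1 < normc (cpath 0 rho t) by rewrite nc.
  have [l Hl] := d1 _ t1; have [m Hm] := d2 _ t1.
  apply: cvgDC; last exact: climC.
  apply: cvgDC; first exact: clim_compC cc (hasd_cvg Hl).
  by apply: cvgConj; exact: clim_compC cc (hasd_cvg Hm).
- exact: real_ccontZ.
- move=> t _; rewrite normcMC; apply: ler_pM; rewrite ?normc_ge0//.
    exact: normc_decay_kernel.
  by apply: dom; rewrite nc.
Qed.

(** Letting the radius of the circle of integration tend to 1. *)
Lemma decay_bound n q1 q2 p (c0 c2 : C) (P : R) w tau : 1 < tau -> normc w = tau ->
  (forall v, 1 < normc v -> exists l, hasd q1 v l) ->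
  (forall v, 1 < normc v -> exists l, hasd q2 v l) ->
  (forall v, 1 < normc v -> exists l, hasd p v l) ->
  clim infty (fun v => v ^+ n * q1 v) 0 -> clim infty q2 c2 -> clim infty p P%:C ->
  (forall v, 1 < normc v -> normc (q1 v + (q2 v)^*%C + c0) <= complex.Re (p v)) ->
  normc (q1 w) <= (1 / tau) ^+ n.+1 * (tau / (tau - 1)) * P.
Proof.
move=> t1 wt d1 d2 dp l1 l2 lp dom.
have t0 : 0 < tau := lt_trans ltr01 t1.
pose k (rho : R) := (rho / tau) ^+ n.+1 * (tau / (tau - rho)) * P.
have kc : k rho @[rho --> (1:R)] --> k 1.
  apply: cvgM; last exact: cvg_cst.
  apply: cvgM.
    have H : (fun x : R => x / tau) rho @[rho --> (1:R)] --> (1 / tau : R).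
      by apply: cvgM; [exact: cvg_id|exact: cvg_cst].
    elim: n.+1 => [|m IH]; first by rewrite expr0; under eq_cvg do rewrite expr0; exact: cvg_cst.
    by rewrite exprS; under eq_cvg do rewrite exprS; apply: cvgM.
  apply: cvgM; first exact: cvg_cst.
  apply: cvgV; first by rewrite subr_eq0 gt_eqF.
  by apply: cvgB; [exact: cvg_cst|exact: cvg_id].
rewrite -/(k 1); rewrite leNgt; apply/negP => lt.
have e0 : 0 < normc (q1 w) - k 1 by rewrite subr_gt0.
move/cvgrPdist_lt : kc => /(_ _ e0) /real_nbhsP[d d0 Hd].
pose rho := 1 + Num.min (d / 2) ((tau - 1) / 2).
have m0 : 0 < Num.min (d / 2) ((tau - 1) / 2) by rewrite lt_min !divr_gt0// subr_gt0.
have md : Num.min (d / 2) ((tau - 1) / 2) <= d / 2 by rewrite ge_min lexx.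
have mt : Num.min (d / 2) ((tau - 1) / 2) <= (tau - 1) / 2 by rewrite ge_min lexx orbT.
have r1 : 1 < rho by rewrite ltrDl.
have rt : rho < tau by rewrite /rho; lra.
have := decay_bound_lt r1 rt wt d1 d2 dp l1 l2 lp dom; rewrite -/(k rho).
have := Hd rho; rewrite /rho addrAC subrr add0r gtr0_norm// -/rho => /(_ _).
have mdd : Num.min (d / 2) ((tau - 1) / 2) < d by lra.
move=> /(_ mdd); rewrite distrC; have := ler_norm (k rho - k 1); lra.
Qed.

End Decay.

(** * The resolvent of a banded matrix *)

Section Resolvent.
Variables (R : realType) (n : nat).
Local Notation C := (cplx R).
Local Notation infty := (@cinfty_nbhs R).
Implicit Types (A : 'M[R[i]]_n) (z w a : C) (p : {poly R[i]}).

Lemma hasd_horner p z : hasd (fun z => p.[z] : C) z (p^`().[z]).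
Proof.
elim/poly_ind: p => [|p c IH].
  have -> : (fun z : C => (0 : {poly R[i]}).[z] : C) = (fun=> 0) by apply/funext => x; rewrite horner0.
  by rewrite deriv0 horner0; exact: hasd_cst.
have -> : (fun z : C => (p * 'X + c%:P).[z] : C) = (fun z => p.[z] * z + c).
  by apply/funext => x; rewrite !hornerE.
have -> : (p * 'X + c%:P)^`().[z] = (p^`().[z] * z + p.[z] * 1) + 0.
  by rewrite derivD derivM derivX derivC !hornerE.
apply: hasdD; last exact: hasd_cst.
by apply: hasdM; [exact: IH|exact: hasd_id].
Qed.

Lemma map_char_poly_mx A z : map_mx (horner_eval z) (char_poly_mx A) = z%:M - A.
Proof.
apply/matrixP => i j; rewrite !mxE /horner_eval !hornerE.
by case: (i == j) => /=; rewrite !hornerE.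
Qed.

(** Cramer's rule, with the characteristic polynomial as denominator. *)
Lemma resolvent_entry A z i j : ~~ eigenvalue A z ->
  invmx (z%:M - A) i j = ((char_poly A).[z])^-1 * (\adj (char_poly_mx A) i j).[z].
Proof.
rewrite eigenvalue_root_char /root => nz.
have dE : \det (z%:M - A) = (char_poly A).[z].
  by rewrite -map_char_poly_mx det_map_mx.
rewrite /invmx unitmxE dE unitfE nz mxE; congr (_ * _).
by rewrite -map_char_poly_mx -map_mx_adj mxE.
Qed.

Lemma eigenvalue_near A z : ~~ eigenvalue A z -> \forall w \near z, ~~ eigenvalue A w.
Proof.
rewrite eigenvalue_root_char /root -normc_gt0 => nz.
have /cvg_normcP/(_ _ nz) := hasd_cvg (hasd_horner (char_poly A) z).
apply: filterS => w; rewrite eigenvalue_root_char /root.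
by apply: contraTneq => ->; rewrite sub0r normcNC ltxx.
Qed.

Lemma spectrum_closed A : closed ([set a | eigenvalue A a] : set C).
Proof.
rewrite -openC; apply/open_normcP => z /= /negP /eigenvalue_near /nbhs_normcP[e e0 He].
by exists e => // w /He /negP.
Qed.

Lemma hasd_resolvent A z i j : ~~ eigenvalue A z ->
  exists l, hasd (fun z => invmx (z%:M - A) i j : C) z l.
Proof.
move=> nz; have := nz; rewrite eigenvalue_root_char /root => pz.
eexists; apply: (@hasd_near _ (fun w => ((char_poly A).[w])^-1 * (\adj (char_poly_mx A) i j).[w])).
  by apply: filterS (eigenvalue_near nz) => w nw; rewrite resolvent_entry.
by apply: hasdM; [apply: hasdV; [exact: pz|exact: hasd_horner]|exact: hasd_horner].
Qed.

Lemma resolvent_unit A z : ~~ eigenvalue A z -> z%:M - A \in unitmx.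
Proof.
rewrite eigenvalue_root_char /root => nz.
by rewrite unitmxE -map_char_poly_mx det_map_mx unitfE.
Qed.

Lemma resolvent_eq A z : ~~ eigenvalue A z ->
  z *: invmx (z%:M - A) = 1%:M + A *m invmx (z%:M - A).
Proof.
move=> /resolvent_unit/mulmxV; rewrite mulmxBl mul_scalar_mx => <-.
by rewrite subrK.
Qed.

Lemma clim_sum (T : Type) (F : set_system T) {FF : Filter F} (I : Type) (r : seq I)
    (f : I -> T -> C) (l : I -> C) : (forall i, clim F (f i) (l i)) ->
  clim F (fun x => \sum_(i <- r) f i x) (\sum_(i <- r) l i).
Proof.
move=> H; elim: r => [|i r IH].
  rewrite big_nil; have -> : (fun x => \sum_(i <- [::]) f i x) = (fun=> 0).
    by apply/funext => x; rewrite big_nil.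
  exact: climC.
rewrite big_cons; have -> : (fun x => \sum_(j <- i :: r) f j x) = (fun x => f i x + \sum_(j <- r) f j x).
  by apply/funext => x; rewrite big_cons.
by apply: cvgDC; [exact: H|exact: IH].
Qed.

(** The relation z B = 1 + A B for the resolvent B bounds |z| times the sum b of
   the moduli of its entries by a constant plus a constant times b. *)
Lemma resolvent_lim0 A (N : R) i j : (forall z, N < normc z -> ~~ eigenvalue A z) ->
  clim infty (fun z => invmx (z%:M - A) i j : C) 0.
Proof.
move=> HN; apply/cvg_normcP => e e0.
pose al := \sum_(i < n) \sum_(k < n) normc (A i k).
pose m := \sum_(i < n) \sum_(j < n) (1 : R).
have al0 : 0 <= al by apply: sumr_ge0 => ? _; apply: sumr_ge0 => ? _; exact: normc_ge0.
have m0 : 0 <= m by apply: sumr_ge0 => ? _; apply: sumr_ge0 => ? _; exact: ler01.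
exists (`|N| + m * al + (m + 1) / e) => z hz.
have me : 0 < (m + 1) / e by rewrite divr_gt0// ltr_wpDl.
have mal : 0 <= m * al by exact: mulr_ge0.
have nz : ~~ eigenvalue A z by apply: HN; have := ler_norm N; lra.
set B := invmx (z%:M - A).
pose b := \sum_(i < n) \sum_(j < n) normc (B i j).
have entry_le (M : 'M[R[i]]_n) x y : normc (M x y) <= \sum_(i < n) \sum_(j < n) normc (M i j).
  rewrite (bigD1 x)//= (bigD1 y)//= -addrA lerDl addr_ge0//.
    by apply: sumr_ge0 => ? _; exact: normc_ge0.
  by apply: sumr_ge0 => ? _; apply: sumr_ge0 => ? _; exact: normc_ge0.
have normc_sum (I : finType) (f : I -> C) : normc (\sum_k f k) <= \sum_k normc (f k).
  apply: (big_ind2 (fun (x : C) (y : R) => normc x <= y)) => //; first by rewrite normc0.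
  by move=> x1 x2 y1 y2 H1 H2; apply: le_trans (normcD _ _) _; exact: lerD.
have row_le x y : normc z * normc (B x y) <= 1 + al * b.
  have := congr1 (fun M : 'M[R[i]]_n => M x y) (resolvent_eq nz); rewrite -/B !mxE => E.
  have -> : normc z * normc (B x y) = normc (z * B x y) by rewrite normcMC.
  rewrite E; apply: le_trans (normcD _ _) _; apply: lerD.
    by case: (x == y); rewrite ?normc1 ?normc0.
  apply: le_trans (normc_sum _ _) _.
  apply: (@le_trans _ _ (\sum_(k < n) normc (A x k) * b)).
    by apply: ler_sum => k _; rewrite normcMC ler_wpM2l ?normc_ge0//; exact: entry_le.
  rewrite -mulr_suml ler_wpM2r//.
    by apply: sumr_ge0 => ? _; apply: sumr_ge0 => ? _; exact: normc_ge0.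
  rewrite /al [leRHS](bigD1 x)//= lerDl.
  by apply: sumr_ge0 => ? _; apply: sumr_ge0 => ? _; exact: normc_ge0.
have b_le : normc z * b <= m * (1 + al * b).
  rewrite /b /m mulr_sumr mulr_suml; apply: ler_sum => x _.
  rewrite mulr_sumr mulr_suml; apply: ler_sum => y _; rewrite mul1r; exact: row_le.
have b0 : 0 <= b by apply: sumr_ge0 => ? _; apply: sumr_ge0 => ? _; exact: normc_ge0.
rewrite subr0; apply: le_lt_trans (entry_le B i j) _; rewrite -/b.
have H : (m + 1) / e * b <= m.
  have -> : m = m * (1 + al * b) - m * al * b by ring.
  rewrite lerBrDr -mulrDl; apply: le_trans b_le; rewrite ler_wpM2r//.
  by have := normr_ge0 N; lra.
have : (m + 1) * b <= m * e.
  by move: H; rewrite mulrAC ler_pdivrMr.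
move=> H'; rewrite -(@ltr_pM2l _ (m + 1)) ?ltr_wpDl//.
by apply: le_lt_trans H' _; rewrite mulrDl mul1r ltrDl.
Qed.

Definition mpow A j : 'M[R[i]]_n := iter j (fun M => M *m A) 1%:M.

(** Iterating z B = 1 + A B for the resolvent B: as long as the powers of A
   vanish at the entry, only the last term contributes. *)
Lemma mpow_resolvent A z k l j : ~~ eigenvalue A z ->
  (forall i, (i < j)%N -> mpow A i k l = 0) ->
  z ^+ j * invmx (z%:M - A) k l = (mpow A j *m invmx (z%:M - A)) k l.
Proof.
move=> nz; elim: j => [|j IH] H; first by rewrite expr0 mul1r mul1mx.
rewrite exprS -mulrA IH; last by move=> i ij; apply: H; exact: leqW.
have -> : z * (mpow A j *m invmx (z%:M - A)) k l = (mpow A j *m (z *: invmx (z%:M - A))) k l.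
  by rewrite -scalemxAr [RHS]mxE.
rewrite resolvent_eq// mulmxDr mulmx1 [LHS]mxE H// add0r mulmxA.
by [].
Qed.

Lemma mpow_banded A beta gamma j (k l : 'I_n) : banded beta gamma A ->
  (j * beta < l - k)%N || (j * gamma < k - l)%N -> mpow A j k l = 0.
Proof.
move=> bA; elim: j k l => [|j IH] k l H.
  rewrite /mpow /= mxE; case: eqP => // kl; move: H; rewrite kl subnn !mul0n ltnn.
  by [].
rewrite /mpow iterS -/(mpow A j) mxE big1// => i _.
have [h|h] := boolP ((j * beta < i - k)%N || (j * gamma < k - i)%N).
  by rewrite IH// mul0r.
rewrite bA ?mulr0//; move: H h; rewrite negb_or -!leqNgt !mulSn.
by move=> /orP[H|H] /andP[h1 h2]; apply/orP; [left|right]; lia.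
Qed.

End Resolvent.

(** * The field of values and the Hermitian part of the resolvent *)

Section FieldOfValues.
Variables (R : realType) (n : nat).
Local Notation C := (cplx R).
Local Open Scope sesquilinear_scope.
Implicit Types (A Q : 'M[R[i]]_n) (v x : 'cV[R[i]]_n) (z w a : C).

Lemma conjCE (a : R[i]) : Num.conj a = (a^*)%C.
Proof. by []. Qed.

Lemma form_self x : (x^t* *m x) 0 0 = (\sum_(i < n) normc (x i 0) ^+ 2)%:C.
Proof.
rewrite mxE rmorph_sum /=; apply: eq_bigr => i _.
by rewrite !mxE conjCE conjc_mul.
Qed.

Lemma form_swap x v : (v^t* *m x) 0 0 = (((x^t* *m v) 0 0)^*)%C.
Proof.
rewrite !mxE rmorph_sum; apply: eq_bigr => i _.
by rewrite !mxE !conjCE rmorphM /= conjcK mulrC.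
Qed.

Lemma rayleigh A x (s : R) : s = \sum_(i < n) normc (x i 0) ^+ 2 -> 0 < s ->
  field_of_values A ((x^t* *m A *m x) 0 0 / s%:C).
Proof.
move=> sE s0; pose c : R := (Num.sqrt s)^-1.
have c0 : 0 <= c by rewrite invr_ge0 sqrtr_ge0.
have c2 : c ^+ 2 = s^-1 by rewrite exprVn sqr_sqrtr// ltW.
exists (c%:C *: x).
  rewrite /euclidean_norm (_ : \sum_(i < n) _ = 1) ?sqrtr1//.
  under eq_bigr do rewrite mxE normcMC normc_real ger0_norm// exprMn.
  by rewrite -mulr_sumr -sE c2 mulVf// gt_eqF.
have -> : (c%:C *: x)^t* = c%:C *: x^t*.
  by apply/matrixP => i j; rewrite !mxE rmorphM /= conjCE conjc_real.
rewrite -scalemxAl -scalemxAr -scalemxAl scalerA [RHS]mxE -rmorphM -expr2 c2.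
by rewrite mulrC fmorphV.
Qed.

Lemma eigenvalue_in_field A a : eigenvalue A a -> field_of_values A a.
Proof.
move=> /eigenvalueP[v vA v0].
pose x : 'cV[R[i]]_n := v^t*.
have xv : x^t* = v by apply/matrixP => i j; rewrite !mxE !conjCE conjcK.
pose s : R := \sum_(i < n) normc (x i 0) ^+ 2.
have s0 : 0 < s.
  rewrite lt_neqAle eq_sym sumr_ge0 ?andbT; last by move=> *; exact: sqr_ge0.
  apply: contra_neq v0 => /psumr_eq0P H; apply/rowP => i; rewrite mxE.
  have := H (fun i _ => sqr_ge0 _) i isT => /eqP.
  by rewrite sqrf_eq0 normc_eq0 !mxE conjCE -normc_eq0 normc_conj normc_eq0 => /eqP.
have := rayleigh A (erefl s) s0; rewrite xv vA -scalemxAl mxE.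
have -> : (v *m x) 0 0 = s%:C by rewrite -{1}xv form_self.
by rewrite mulfK// -normc_eq0 normc_real normr_eq0 gt_eqF.
Qed.

(** With x = B v for the resolvent B at ps, the form v^* B v is the conjugate of
   x^* (ps - A) x, which is |x|^2 (ps - z) for a point z of the field of values. *)
Lemma resolvent_positive A v (ps N : C) : ~~ eigenvalue A ps ->
  (forall z, field_of_values A z -> 0 <= complex.Re ((N^*)%C * (ps - z))) ->
  0 <= complex.Re (N * (v^t* *m invmx (ps%:M - A) *m v) 0 0).
Proof.
move=> nps HW; set B := invmx _; pose x := B *m v.
have vE : v = (ps%:M - A) *m x by rewrite /x mulmxA mulmxV ?mul1mx//; exact: resolvent_unit.
rewrite -mulmxA -/x form_swap {1}vE mulmxA mulmxBr mul_mx_scalar mulmxBl -scalemxAl.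
pose s : R := \sum_(i < n) normc (x i 0) ^+ 2.
have s0 : 0 <= s by apply: sumr_ge0 => *; exact: sqr_ge0.
have entry (M M' : 'M[R[i]]_(1, 1)) : (ps *: M - M') 0 0 = ps * M 0 0 - M' 0 0 by rewrite !mxE.
rewrite entry form_self -/s.
have [sz|sn] := eqVneq s 0.
  have x0 : x = 0.
    apply/colP => i; rewrite [RHS]mxE; have /psumr_eq0P H := sz.
    have := H (fun i _ => sqr_ge0 _) i isT => /eqP.
    by rewrite sqrf_eq0 normc_eq0 => /eqP.
  by rewrite sz x0 mulmx0 mxE subr0 mulr0 rmorph0 mulr0.
have sp : 0 < s by rewrite lt_neqAle eq_sym sn.
have := HW _ (rayleigh A (erefl s) sp); rewrite -/s.
set a := (x^t* *m A *m x) 0 0; move=> H.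
have sc0 : (s%:C : C) != 0 by rewrite -normc_eq0 normc_real normr_eq0.
have -> : ps * s%:C - a = s%:C * (ps - a / s%:C) by field.
have cr (X : C) : ((s%:C * X)^*)%C = s%:C * (X^*)%C.
  by case: X => u t; apply: complex_ext; rewrite /=; ring.
rewrite cr mulrCA Re_mul /= mul0r subr0 mulr_ge0//.
have -> : N * ((ps - a / s%:C)^*)%C = (((N^*)%C * (ps - a / s%:C))^*)%C by rewrite rmorphM /= conjcK.
by case: (_ * _) H.
Qed.

Lemma form_delta Q (k l : 'I_n) : (delta_mx (0 : 'I_1) k *m Q *m delta_mx l (0 : 'I_1)) 0 0 = Q k l.
Proof. by rewrite -rowE -colE !mxE. Qed.

(** The form at the vectors e_k + c e_l, with c of modulus 1 chosen to rotate the
   off-diagonal term onto the negative real axis. *)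
Lemma positive_offdiag Q (k l : 'I_n) :
  (forall v, 0 <= complex.Re ((v^t* *m Q *m v) 0 0)) ->
  normc (Q k l + ((Q l k)^*)%C) <= complex.Re (Q k k + Q l l).
Proof.
move=> HQ.
have H (c : C) : normc c = 1 ->
    0 <= complex.Re (Q k k + Q l l) + complex.Re (c * (Q k l + ((Q l k)^*)%C)).
  move=> c1; have := HQ (delta_mx k 0 + c *: delta_mx l 0).
  have -> : (delta_mx k 0 + c *: delta_mx l 0 : 'cV[R[i]]_n)^t* = delta_mx 0 k + (c^*)%C *: delta_mx 0 l.
    apply/matrixP => i j; rewrite !mxE rmorphD rmorphM /= !conjCE ord1 !eqxx !andbT.
    by rewrite !rmorph_nat.
  rewrite !mulmxDl !mulmxDr -!scalemxAl -!scalemxAr.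
  have entry (M1 M2 M3 M4 : 'M[R[i]]_(1, 1)) (e e' : C) :
      (M1 + e' *: M2 + (e *: M3 + e *: (e' *: M4))) 0 0 = M1 0 0 + e' * M2 0 0 + (e * M3 0 0 + e * (e' * M4 0 0)).
    by rewrite !mxE.
  rewrite entry !form_delta mulrA conjc_mul c1 expr1n mul1r.
  rewrite !Re_add !Re_mul.
  by case: (Q k l) (Q l k) (c) => a b [a' b'] [x y] /=; lra.
set s := Q k l + _.
have [->|s0] := eqVneq s 0.
  rewrite normc0; have := H 1 (normc1 _); have := H (-1).
  by rewrite normcNC normc1 => /(_ erefl); rewrite -/s mulN1r mul1r Re_opp; lra.
have n0 : 0 < normc s by rewrite normc_gt0.
have := H (- (s^*)%C / (normc s)%:C).
rewrite normcMC normcV normcNC normc_conj normc_real gtr0_norm// divff ?gt_eqF// => /(_ erefl).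
rewrite -/s mulrAC mulNr conjc_mul expr2 rmorphM -mulNr mulfK; last first.
  by rewrite -normc_eq0 normc_real normr_eq0 gt_eqF.
by rewrite Re_opp /=; lra.
Qed.

End FieldOfValues.

(** * Decay of the entries of a function of a banded matrix *)

Section BandedDecay.
Variable R : realType.
Local Notation C := (cplx R).
Local Notation infty := (@cinfty_nbhs R).

(** The rounded quotient is the least number of steps of length at most b from x
   to y; with fewer steps the distance is not covered. *)
Lemma ceil_steps (x y b : nat) : (x < y)%N -> (0 < b)%N ->
  exists2 m : nat, Num.ceil ((y%:R - x%:R) / b%:R : R) = Posz m.+1 &
    forall j, (j <= m)%N -> (j * b < y - x)%N.
Proof.
move=> xy b0; set q := (_ / _ : R).
have b0' : 0 < b%:R :> R by rewrite ltr0n.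
have q0 : 0 < q by rewrite divr_gt0// subr_gt0 ltr_nat.
have : 0 < Num.ceil q by rewrite ceil_gt_int.
case E : (Num.ceil q) => [[|m]|//] // _; exists m => // j jm.
have : (Posz j < Num.ceil q)%R by rewrite E ltz_nat ltnS.
rewrite ceil_gt_int /q ltr_pdivlMr// -natrB ?(ltnW xy)//.
by rewrite -[_%:~R]/(j%:R : R) -natrM ltr_nat.
Qed.

Variables (n beta gamma : nat) (A : 'M[R[i]]_n) (E : set C) (phi psi : C -> C).
Hypotheses (beta0 : (0 < beta)%N) (gamma0 : (0 < gamma)%N).
Hypothesis bA : banded beta gamma A.
Hypothesis cE : convex_continuum E.
Hypothesis WE : field_of_values A `<=` E.
Hypothesis rm : exterior_riemann_map E phi psi.

Let B z : 'M[R[i]]_n := invmx (z%:M - A).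
Let Q w (i j : 'I_n) : C := w * dC psi w * B (psi w) i j.

Lemma not_eigenvalue_out z : ~ E z -> ~~ eigenvalue A z.
Proof. by move=> nE; apply/negP => /eigenvalue_in_field /WE. Qed.

Lemma far_not_eigenvalue : exists N : R, forall z : C, N < normc z -> ~~ eigenvalue A z.
Proof.
have [cpE] : compact E /\ True by case: cE.
have [N _ HN] := compact_bound cpE (@onKid _ E).
by exists N => z zN; apply: not_eigenvalue_out => /HN; rewrite leNgt zN.
Qed.

Lemma Q_hol i j w : 1 < normc w -> exists l, hasd (fun w => Q w i j) w l.
Proof.
move=> w1; have ne := not_eigenvalue_out (psi_out rm w1).
have [l Hl] := hasd_resolvent i j ne.
eexists; apply: hasdM.
  by apply: hasdM; [exact: hasd_id|exact: (hol_dC (@X_open R) (hol_psi rm) w1)].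
exact: (hasd_comp (hol_psi rm w1) Hl).
Qed.

Lemma resolvent_lim_psi (M : 'M[R[i]]_n) i j :
  clim infty (fun w => (M *m B (psi w)) i j) 0.
Proof.
have [N HN] := far_not_eigenvalue.
have -> : (fun w => (M *m B (psi w)) i j) = (fun w => \sum_(k < n) M i k * B (psi w) k j).
  by apply/funext => w; rewrite mxE.
have H k : clim infty (fun w => M i k * B (psi w) k j) (M i k * 0).
  apply: cvgMC; first exact: climC.
  exact: (clim_comp (psi_cvg_infty cE rm) (resolvent_lim0 k j HN)).
have L : clim infty (fun w => \sum_(k < n) M i k * B (psi w) k j) (\sum_(k < n) M i k * 0).
  exact: clim_sum H.
have S : \sum_(k < n) M i k * 0 = 0 :> C by apply: big1 => k _; exact: mulr0.
by rewrite S in L; exact: L.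
Qed.

Lemma psi_neq0_near : infty (fun w => psi w != 0).
Proof.
have [N HN] := psi_infty cE rm 0; exists N => w /HN.
by rewrite normc_gt0.
Qed.

(** Powers of A vanish at this entry up to the order m, so that it has order
   -(m+1) in psi(w), and psi(w) is comparable to w at infinity. *)
Lemma Q_decay (m : nat) (k l : 'I_n) : (forall j, (j <= m)%N -> mpow A j k l = 0) ->
  clim infty (fun w => w ^+ m * Q w k l) 0.
Proof.
move=> Hm; have [cap0 _] := dphi_inftyP rm; have rat := psi_ratio cE rm.
have kap0 : ((dphi_infty phi)%:C : C)^-1 != 0.
  by rewrite invr_neq0// -normc_eq0 normc_real normr_eq0 gt_eqF.
have L : clim infty (fun w => (psi w / w)^-1 ^+ m * (w * dC psi w / (psi w - 0)) * (mpow A m.+1 *m B (psi w)) k l)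
    (((dphi_infty phi)%:C^-1)^-1 ^+ m * 1 * 0).
  apply: cvgMC; last exact: resolvent_lim_psi.
  apply: cvgMC; last exact: (radial_lim cE rm 0).
  by apply: cvgXC; apply: cvgVC; [exact: kap0|exact: rat].
move: L; rewrite mulr0; apply: clim_near; near=> w.
have w1 : 1 < normc w by near: w; exact: near_X.
have w0 : w != 0 by near: w; exact: infty_neq.
have p0 : psi w != 0 by near: w; exact: psi_neq0_near.
have ne := not_eigenvalue_out (psi_out rm w1).
rewrite -(mpow_resolvent ne); last by move=> i im; apply: Hm.
rewrite subr0 /Q -/(B (psi w)) invf_div expr_div_n exprS.
have pm0 : psi w ^+ m != 0 by rewrite expf_neq0.
by field; rewrite p0 pm0.
Unshelve. all: by end_near. Qed.

(** z B = 1 + A B for the resolvent B, and B tends to 0 at infinity. *)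
Lemma Q_lim k l : clim infty (fun w => Q w k l) (k == l)%:R.
Proof.
have L : clim infty (fun w => (w * dC psi w / (psi w - 0)) * ((k == l)%:R + (A *m B (psi w)) k l))
    (1 * ((k == l)%:R + 0)).
  apply: cvgMC; first exact: (radial_lim cE rm 0).
  by apply: cvgDC; [exact: climC|exact: resolvent_lim_psi].
move: L; rewrite mul1r addr0; apply: clim_near; near=> w.
have w1 : 1 < normc w by near: w; exact: near_X.
have p0 : psi w != 0 by near: w; exact: psi_neq0_near.
have ne := not_eigenvalue_out (psi_out rm w1).
have -> : (k == l)%:R + (A *m B (psi w)) k l = psi w * B (psi w) k l.
  have entry (a : C) (M M1 M2 : 'M[R[i]]_n) : a *: M = M1 + M2 -> a * M k l = M1 k l + M2 k l.
    by move=> /matrixP/(_ k l); rewrite !mxE.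
  have -> : (k == l)%:R = (1%:M : 'M[R[i]]_n) k l by rewrite mxE.
  by rewrite (entry _ _ _ _ (resolvent_eq ne)).
by rewrite subr0 /Q; field.
Unshelve. all: by end_near. Qed.

(** The field of values lies in the convex set E, which makes the Hermitian part
   of Q(w) nonnegative. *)
Lemma Q_offdiag w k l : 1 < normc w ->
  normc (Q w k l + ((Q w l k)^*)%C) <= complex.Re (Q w k k + Q w l l).
Proof.
move=> w1; have ne := not_eigenvalue_out (psi_out rm w1).
have := @positive_offdiag R n ((w * dC psi w) *: B (psi w)) k l.
rewrite !mxE; apply => v.
rewrite -scalemxAr -scalemxAl mxE; apply: (resolvent_positive v ne) => z /WE Ez.
exact: (starlike_Re cE rm Ez w1).
Qed.

Lemma decay_exponentP (k l : 'I_n) : k != l ->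
  exists2 m : nat, decay_exponent R beta gamma k l = Posz m.+1 &
    forall j, (j <= m)%N -> mpow A j k l = 0.
Proof.
move=> kl; rewrite /decay_exponent; case: ltnP => [lt|ge].
  have [m -> Hm] := ceil_steps lt beta0; exists m => // j /Hm jb.
  by apply: (mpow_banded bA); rewrite jb.
have lt : (l < k)%N by rewrite ltn_neqAle ge andbT eq_sym.
have [m -> Hm] := ceil_steps lt gamma0; exists m => // j /Hm jb.
by apply: (mpow_banded bA); rewrite jb orbT.
Qed.

(** Off the diagonal, Q(w)_kl is dominated through Q(w)_lk by the real part of
   Q(w)_kk + Q(w)_ll, whose value at infinity is 2. On the diagonal, where the
   exponent is 0, the same bound is applied to Q(w)_kk - 1, which vanishes at
   infinity; it gives 2 / (tau - 1) + 1, at most 2 tau / (tau - 1). *)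
Lemma Q_bound (w : C) tau k l : 1 < tau -> normc w = tau ->
  normc (Q w k l) <= 2 * (tau / (tau - 1)) * (1 / tau) ^ decay_exponent R beta gamma k l.
Proof.
move=> t1 wt; have t0 : 0 < tau := lt_trans ltr01 t1.
have tm : 0 < tau - 1 by rewrite subr_gt0.
have hp (v : C) : 1 < normc v -> exists l', hasd (fun v => Q v k k + Q v l l) v l'.
  move=> v1; have [a Ha] := Q_hol k k v1; have [b Hb] := Q_hol l l v1.
  by eexists; exact: hasdD Ha Hb.
have lp : clim infty (fun v => Q v k k + Q v l l) (2 : R)%:C.
  have -> : ((2 : R)%:C : C) = (k == k)%:R + (l == l)%:R by rewrite !eqxx -natrD rmorph_nat.
  by apply: cvgDC; exact: Q_lim.
have [kl|kl] := eqVneq k l; last first.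
  have [m -> Hm] := decay_exponentP kl.
  have dom (v : C) : 1 < normc v -> normc (Q v k l + ((Q v l k)^*)%C + 0) <= complex.Re (Q v k k + Q v l l).
    by move=> v1; rewrite addr0; exact: Q_offdiag.
  have := @decay_bound R m (fun v => Q v k l) (fun v => Q v l k) (fun v => Q v k k + Q v l l)
    0 _ 2 w tau t1 wt (@Q_hol k l) (@Q_hol l k) hp (Q_decay Hm) (@Q_lim l k) lp dom.
  rewrite -[_ ^ Posz m.+1]/((1 / tau) ^+ m.+1) => H.
  have -> : 2 * (tau / (tau - 1)) * (1 / tau) ^+ m.+1 = (1 / tau) ^+ m.+1 * (tau / (tau - 1)) * 2 by ring.
  exact: H.
rewrite -kl in hp lp *.
have -> : decay_exponent R beta gamma k k = 0.
  by rewrite /decay_exponent ltnn subrr mul0r ceil0.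
rewrite expr0z mulr1.
have h1 (v : C) : 1 < normc v -> exists l', hasd (fun v => Q v k k - 1) v l'.
  by move=> v1; have [a Ha] := Q_hol k k v1; eexists; apply: hasdB; [exact: Ha|exact: hasd_cst].
have l1 : clim infty (fun v => v ^+ 0 * (Q v k k - 1)) 0.
  have -> : (0 : C) = 1 * ((k == k)%:R - 1) by rewrite eqxx subrr mulr0.
  by apply: cvgMC; [exact: climC|apply: cvgBC; [exact: Q_lim|exact: climC]].
have dom (v : C) : 1 < normc v -> normc (Q v k k - 1 + ((Q v k k)^*)%C + 1) <= complex.Re (Q v k k + Q v k k).
  move=> v1; have -> : Q v k k - 1 + ((Q v k k)^*)%C + 1 = Q v k k + ((Q v k k)^*)%C by ring.
  exact: Q_offdiag.
have := @decay_bound R 0 (fun v => Q v k k - 1) (fun v => Q v k k) (fun v => Q v k k + Q v k k)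
    1 _ 2 w tau t1 wt h1 (@Q_hol k k) hp l1 (@Q_lim k k) lp dom.
rewrite expr1 => H.
have := normcD (Q w k k - 1) 1; rewrite subrK normc1 => /le_trans; apply.
have -> : 2 * (tau / (tau - 1)) = 1 / tau * (tau / (tau - 1)) * 2 + 2.
  by field; rewrite !gt_eqF.
by apply: lerD => //; lra.
Qed.

Variables (f : C -> C) (tau : R) (Omega : set C) (Gam : seq (R -> C)).
Hypothesis tau1 : 1 < tau.
Hypothesis fO : analytic_nbhd (level_set psi tau) Omega f.
Hypothesis enc : encircles_spectrum Omega A Gam.

Let tau0 : 0 < tau := lt_trans ltr01 tau1.

(** The change of variables z = psi(w), after deformation of the contours to the
   level curve. The spectrum is all that is removed from the domain of f, and
   it lies in E. *)
Lemma matrix_function_mean k l :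
  matrix_function Gam f A k l = cmean 0 tau (fun w => f (psi w) * Q w k l).
Proof.
have [oO lO /holomorphic_hol hf] := fO.
have [jG GO w0 w1] := enc.
rewrite mxE twopiiE.
have := @contour_deformation R E phi psi tau cE rm tau1 Omega [set a | eigenvalue A a] Gam
  (fun z => f z * B z k l) oO lO (@spectrum_closed R n A).
move=> H; rewrite H {H}.
- by congr cmean; apply/funext => w; rewrite /Q; ring.
- by move=> a /= /eigenvalue_in_field /WE.
- by move=> g /jG[pg cg _].
- exact: GO.
- exact: w0.
- by move=> z /= /w1.
- apply/holP => z [Oz /negP nz]; have [m Hm] := hasd_resolvent k l nz.
  by eexists; apply: hasdM; [exact: hf|exact: Hm].
Qed.

Lemma banded_decay k l :
  normc (matrix_function Gam f A k l) <=
    2 * (tau / (tau - 1)) *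
    sup [set normc (f (psi w)) | w in [set w : C | normc w = tau]] *
    (1 / tau) ^ decay_exponent R beta gamma k l.
Proof.
rewrite matrix_function_mean.
have [oO lO /holomorphic_hol hf] := fO.
have lev (w : C) : normc w = tau -> Omega (psi w).
  move=> wt; apply: lO => -[v /= tv]; have v1 : 1 < normc v := lt_trans tau1 tv.
  have wn1 : 1 < normc w by rewrite wt.
  move=> /(congr1 phi); rewrite (phi_psi rm v1) (phi_psi rm wn1) => vw.
  by move: tv; rewrite vw wt ltxx.
have cfp (w : C) : normc w = tau -> clim (nbhs w) (fun w => f (psi w)) (f (psi w)).
  move=> wt; have wn1 : 1 < normc w by rewrite wt.
  exact: clim_compC (hasd_cvg (hol_psi rm wn1)) (hasd_cvg (hf _ (lev _ wt))).
set V := [set normc (f (psi w)) | w in [set w : C | normc w = tau]].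
have [M HM] := circle_bound tau0 cfp.
have tn : normc (tau%:C : C) = tau by rewrite normc_real gtr0_norm.
have hs : has_sup V.
  split; first by exists (normc (f (psi tau%:C))), (tau%:C : C).
  by exists M => _ [w /= wt <-]; exact: HM.
have leS (w : C) : normc w = tau -> normc (f (psi w)) <= sup V.
  by move=> wt; apply: sup_upper_bound => //; exists w.
have S0 : 0 <= sup V by apply: le_trans (leS _ tn); exact: normc_ge0.
have HL := cmean_functional 0 (ltW tau0).
set b := 2 * (tau / (tau - 1)); set x := (1 / tau) ^ _.
have bx0 : 0 <= b * x.
  by apply: le_trans (Q_bound k l tau1 tn); exact: normc_ge0.
rewrite -mulrA [sup V * x]mulrC mulrA -[leRHS]mul1r.
apply: (cf_bd HL); last 2 first.
- by rewrite mulr_ge0.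
- move=> w; rewrite /circle /= subr0 => wt; rewrite normcMC mulrC.
  by apply: ler_pM; rewrite ?normc_ge0//; [exact: Q_bound|exact: leS].
move=> w; rewrite /circle /= subr0 => wt.
have wn1 : 1 < normc w by rewrite wt.
by apply: cvgMC; [exact: cfp|have [m /hasd_cvg] := Q_hol k l wn1].
Qed.

End BandedDecay.

Local Close Scope complex_scope.
Unset Implicit Arguments.

Theorem theorem2p3 (R : realType) (n beta gamma : nat) (A : 'M[R[i]]_n)
    (E : set (cplx R)) (phi psi : cplx R -> cplx R)
    (f : cplx R -> cplx R) (tau : R)
    (Omega : set (cplx R)) (Gam : seq (R -> cplx R)) :
  (1 <= beta)%N -> (1 <= gamma)%N ->
  banded beta gamma A ->
  convex_continuum E ->
  field_of_values A `<=` E ->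
  exterior_riemann_map E phi psi ->
  1 < tau ->
  analytic_nbhd (level_set psi tau) Omega f ->
  encircles_spectrum Omega A Gam ->
  forall k l : 'I_n,
    normc (matrix_function Gam f A k l) <=
      2 * (tau / (tau - 1)) *
      sup [set normc (f (psi w)) | w in [set w : cplx R | normc w = tau]] *
      (1 / tau) ^ decay_exponent R beta gamma k l.
Proof.
move=> beta0 gamma0 bA cE WE rm tau1 fO enc k l.
exact: (banded_decay beta0 gamma0 bA cE WE rm tau1 fO enc k l).
Qed.
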